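(* Let $E$ be a Banach lattice which is of Krivine type $\le q$ for some $q<\infty$ and of Krivine type $\ge p$ for some $p>1$. Then $E$ admits an equivalent norm $\|\cdot\|$ for which both the upper and the lower decoupling inequalities, both for symmetric and for tetrahedral functions, hold for the Rademacher (hence the Gaussian) law by means of comparison in $L^r$, $1<r<\infty$. More precisely, for such a norm and $1<r<\infty$ there exists a constant $c>0$ such that, when $\boldsymbol X$ is a Rademacher sequence or a sequence of independent standard Gaussian random variables and $\mathbb X=[\boldsymbol X_1,\boldsymbol X_2,\ldots]$ is a matrix whose columns are independent copies of $\boldsymbol X$, one has $$\Big\|\sum_{k\ge 0} c^{-k}Q_k(f_k)\Big\|_{L^r(E)}\le\Big\|\sum_{k\ge0}\overline{Q}_k(f_k)\Big\|_{L^r(E)}\le\Big\|\sum_{k\ge0}c^{k}Q_k(f_k)\Big\|_{L^r(E)}$$ for every finitely supported $f=(f_k)_{k\ge0}$, $f_k:\mathbb N^k\to E$, vanishing on diagonals, which is either symmetric or tetrahedral, where $Q_k(f_k)=\langle f_k\boldsymbol X^{\otimes k}\rangle$ in both cases, $\overline Q_k(f_k)=\frac{1}{\sqrt{k!}}\,\langle f_k\mathbb X^{\otimes k}\rangle$ if $f$ is symmetric, and $\overline Q_k(f_k)=\langle f_k\mathbb X^{\otimes k}\rangle$ if $f$ is tetrahedral.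
   Context: A Rademacher sequence is a sequence of independent random variables taking the values $\pm1$ with probability $1/2$ each. For finitely supported $f_k:\mathbb N^k\to E$, $\boldsymbol X=(X_j)_{j\in\mathbb N}$ and $\mathbb X$ with columns $\boldsymbol X_i=(X_{ij})_{j\in\mathbb N}$, put $\langle f_k\mathbb X^{\otimes k}\rangle=\sum f_k(i_1,\dots,i_k)X_{1i_1}\cdots X_{ki_k}$ and $\langle f_k\boldsymbol X^{\otimes k}\rangle=\sum f_k(i_1,\dots,i_k)X_{i_1}\cdots X_{i_k}$, the sums being over all $(i_1,\dots,i_k)\in\mathbb N^k$; for $k=0$, $f_0\in E$ and both equal $f_0$. Only finitely many $f_k$ are nonzero. ''Vanishing on diagonals'': $f_k(i_1,\dots,i_k)=0$ if two indices coincide. ''Symmetric'': every $f_k$ is invariant under permutations of its arguments. ''Tetrahedral'': $f_k(i_1,\dots,i_k)=0$ unless $i_1<\dots<i_k$. The upper decoupling inequality is the domination of the coupled chaos $\sum_k Q_k$ by the decoupled chaos $\sum_k\overline Q_k$, and the lower decoupling inequality is the domination of the decoupled chaos by the coupled one, in both cases up to multiplying the $k$-homogeneous terms by $k$-th powers of a constant. A Banach lattice $E$ is of Krivine type $\ge p$ ($p$-convex) if for some $C$, $\|(\sum_{i=1}^n|x_i|^p)^{1/p}\|\le C(\sum_{i=1}^n\|x_i\|^p)^{1/p}$ for all finite families in $E$; it is of Krivine type $\le q$ ($q$-concave) if for some $C$, $(\sum_{i=1}^n\|x_i\|^q)^{1/q}\le C\|(\sum_{i=1}^n|x_i|^q)^{1/q}\|$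 for all finite families in $E$. $\|\theta\|_{L^r(E)}=(\mathbb E\|\theta\|^r)^{1/r}$, where $\mathbb E$ denotes expectation.
   Formalization: For symmetric f the factor in Q̄_k is √k! instead of 1/√k!; as printed the left inequality fails for E=ℝ, r=2, f_k the indicator of the permutations of (1,…,k), where it would force c^{-k}k!≤1 for all k. *)

(* Defs.v *)
From HB Require Import structures.
From mathcomp Require Import all_boot all_order all_algebra all_fingroup.
From mathcomp Require Import all_classical all_reals all_analysis.

Set Implicit Arguments.
Unset Strict Implicit.
Unset Printing Implicit Defensive.

Import Order.TTheory GRing.Theory Num.Theory.
Import numFieldNormedType.Exports.

Local Open Scope classical_set_scope.
Local Open Scope ring_scope.

(* The order is not taken from Order.Lattice: Hierarchy Builder rejects a join
   of Order.Lattice with the Zmodule hierarchy declared after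
   Num.RealDomain. The infimum of x and y is - bsup (- x) (- y). *)
HB.mixin Record isBanachLattice (R : realType) E of CompleteNormedModule R E := {
  ble : E -> E -> Prop;
  bsup : E -> E -> E;
  ble_refl : forall x, ble x x;
  ble_antisym : forall x y, ble x y -> ble y x -> x = y;
  ble_trans : forall y x z, ble x y -> ble y z -> ble x z;
  ble_supl : forall x y, ble x (bsup x y);
  ble_supr : forall x y, ble y (bsup x y);
  bsup_le : forall x y z, ble x z -> ble y z -> ble (bsup x y) z;
  ble_addr : forall x y z, ble x y -> ble (x + z) (y + z);
  ble_scale : forall (a : R) x y, 0 <= a -> ble x y -> ble (a *: x) (a *: y);
  ble_norm : forall x y, ble (bsup x (- x)) (bsup y (- y)) -> `|x| <= `|y|
}.

#[short(type="banachLatticeType")]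
HB.structure Definition BanachLattice (R : realType) :=
  {E of isBanachLattice R E & CompleteNormedModule R E}.

Section KrivineType.
Context {R : realType} (E : banachLatticeType R).

Definition pos_homogeneous n (h : 'rV[R]_n -> R) : Prop :=
  continuous h /\ forall (a : R) v, 0 <= a -> h (a *: v) = a * h v.

(* Krivine's functional calculus at x_1, ..., x_n: the lattice homomorphism
   tau from the vector lattice of continuous positively homogeneous functions
   on R^n to E that sends the i-th coordinate to x_i. By Krivine's theorem it
   exists and is unique on that lattice; the values of tau at other functions
   are irrelevant. *)
Record krivine_calculus n (x : 'I_n -> E) (tau : ('rV[R]_n -> R) -> E) : Prop := {
  krivine_coord : forall i, tau (fun v => v ord0 i) = x i;
  krivine_linear : forall (a : R) g h, pos_homogeneous g -> pos_homogeneous h ->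
    tau (fun v => a * g v + h v) = a *: tau g + tau h;
  krivine_sup : forall g h, pos_homogeneous g -> pos_homogeneous h ->
    tau (fun v => Num.max (g v) (h v)) = bsup (tau g) (tau h)
}.

(* y = (|x_1|^p + ... + |x_n|^p)^(1/p) *)
Definition is_lp_sum (p : R) n (x : 'I_n -> E) (y : E) : Prop :=
  exists2 tau, krivine_calculus x tau &
    y = tau (fun v => (\sum_(i < n) `|v ord0 i| `^ p) `^ p^-1).

Definition krivine_type_ge (p : R) : Prop :=
  exists C : R, forall n (x : 'I_n -> E) (y : E), is_lp_sum p x y ->
    `|y| <= C * (\sum_(i < n) `|x i| `^ p) `^ p^-1.

Definition krivine_type_le (q : R) : Prop :=
  exists C : R, forall n (x : 'I_n -> E) (y : E), is_lp_sum q x y ->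
    (\sum_(i < n) `|x i| `^ q) `^ q^-1 <= C * `|y|.

End KrivineType.

Definition equivalent_norm (R : realType) (E : normedModType R) (N : E -> R) : Prop :=
  [/\ forall x y, N (x + y) <= N x + N y,
      forall (a : R) x, N (a *: x) = `|a| * N x,
      forall x, N x = 0 -> x = 0 &
      exists2 ab : R * R, 0 < ab.1 /\ 0 < ab.2 &
        forall x, ab.1 * `|x| <= N x <= ab.2 * `|x|].

Section RandomSequences.
Context {R : realType}.

(* Mutual independence of the X_i : Omega -> T, where S is the sigma-algebra
   of T. It is an argument because T is also instantiated with R^N. *)
Definition mutually_independent d (Omega : measurableType d)
    (P : probability Omega R) (T : Type) (S : set (set T))
    (X : nat -> Omega -> T) : Prop :=
  forall (s : seq nat) (A : nat -> set T), uniq s ->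
    (forall i, S (A i)) ->
    P (\bigcap_(i in [set` s]) X i @^-1` A i) = (\prod_(i <- s) P (X i @^-1` A i))%E.

(* the product sigma-algebra of R^N *)
Definition seq_measurable : set (set (nat -> R)) :=
  <<s [set A | exists (j : nat) (B : set R),
         measurable B /\ A = [set x | B (x j)]] >>.

Definition rademacher_sequence d (Omega : measurableType d)
    (P : probability Omega R) (X : nat -> {RV P >-> R}) : Prop :=
  mutually_independent P measurable (fun j w => X j w) /\
  forall j, P (X j @^-1` [set 1]) = (2^-1)%:E /\
            P (X j @^-1` [set (-1)]) = (2^-1)%:E.

Definition gaussian_sequence d (Omega : measurableType d)
    (P : probability Omega R) (X : nat -> {RV P >-> R}) : Prop :=
  mutually_independent P measurable (fun j w => X j w) /\
  forall j (B : set R), measurable B ->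
    distribution P (X j) B = normal_prob 0 1 B.

(* The columns XX i = (XX i j)_j are independent R^N-valued random elements,
   each with the law of the sequence X; X may live on another space. *)
Definition independent_copies d (Omega : measurableType d)
    (P : probability Omega R) (X : nat -> {RV P >-> R})
    d' (Omega' : measurableType d') (P' : probability Omega' R)
    (XX : nat -> nat -> {RV P' >-> R}) : Prop :=
  mutually_independent P' seq_measurable (fun i w j => XX i j w) /\
  forall i A, seq_measurable A ->
    P' [set w | A (fun j => XX i j w)] = P [set w | A (fun j => X j w)].

End RandomSequences.

Section Chaos.
Context {R : realType} {E : normedModType R}.

(* All sums below are over the (finite) support; indices in N^k start at 0. *)
Definition coupled k (f : k.-tuple nat -> E) (x : nat -> R) : E :=
  \sum_(i \in [set: k.-tuple nat]) (\prod_(l < k) x (tnth i l)) *: f i.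

Definition decoupled k (f : k.-tuple nat -> E) (x : nat -> nat -> R) : E :=
  \sum_(i \in [set: k.-tuple nat]) (\prod_(l < k) x l (tnth i l)) *: f i.

Implicit Type f : forall k, k.-tuple nat -> E.

Definition finitely_supported f : Prop :=
  (forall k, finite_set [set i | f k i != 0]) /\
  finite_set [set k | exists i, f k i != 0].

Definition vanishes_on_diagonals f : Prop :=
  forall k (i : k.-tuple nat), ~~ uniq i -> f k i = 0.

Definition symmetric_family f : Prop :=
  forall k (s : 'S_k) (i : k.-tuple nat), f k [tuple tnth i (s l) | l < k] = f k i.

Definition tetrahedral f : Prop :=
  forall k (i : k.-tuple nat), ~~ sorted ltn i -> f k i = 0.

Definition LrE (N : E -> R) (r : R) d (Omega : measurableType d)
    (P : probability Omega R) (theta : Omega -> E) : \bar R :=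
  Lnorm P r%:E (fun w => (N (theta w))%:E).

(* Degree k contributes Q_k = coupled (f k) and Qbar_k = a k *: decoupled (f k).
   In the scalar case with f_k vanishing on diagonals, E |decoupled|^2 is
   sum |f_k|^2, while E |coupled|^2 is sum |f_k|^2 if f_k is tetrahedral and
   k! * sum |f_k|^2 if f_k is symmetric; the matching normalizations are
   a k = 1 and a k = sqrt k! respectively. *)
Definition decoupling_inequalities (N : E -> R) (r c : R)
    d (Omega : measurableType d) (P : probability Omega R)
    (X : nat -> {RV P >-> R})
    d' (Omega' : measurableType d') (P' : probability Omega' R)
    (XX : nat -> nat -> {RV P' >-> R})
    (a : nat -> R) f : Prop :=
  let Q k w := coupled (f k) (fun j => X j w) in
  let Qbar k w := a k *: decoupled (f k) (fun i j => XX i j w) in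
  let lower w := \sum_(k \in [set: nat]) c ^- k *: Q k w in
  let middle w := \sum_(k \in [set: nat]) Qbar k w in
  let upper w := \sum_(k \in [set: nat]) c ^+ k *: Q k w in
  (LrE N r P lower <= LrE N r P' middle)%E /\
  (LrE N r P' middle <= LrE N r P upper)%E.

End Chaos.

Arguments rademacher_sequence {R d Omega} P X.
Arguments gaussian_sequence {R d Omega} P X.
Arguments independent_copies {R d Omega} P X {d' Omega'} P' XX.
Arguments decoupling_inequalities {R E} N r c {d Omega} P X {d' Omega'} P' XX a f.

(* Main.v *)
From HB Require Import structures.
Require Import Defs.
From mathcomp Require Import all_boot all_order all_algebra all_fingroup.
From mathcomp Require Import all_classical all_reals all_analysis.
From mathcomp Require Import measurable_realfun.
From mathcomp Require Import ring lra zify.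

(** Krivine's functional calculus reduces the inequalities to scalar ones.

    A lattice that is p-convex and q-concave has an equivalent norm [N] whose convexity and concavity
    constants are one ([convex_concave_renorming]); with constant one, convexity passes to smaller and
    concavity to larger exponents.  Consider a random vector [sum_i A_i f_i] with scalar coefficients
    [A_i].  The function [v |-> || sum_i A_i v_i ||_q] on R^n is continuous and positively homogeneous,
    so it has a value at [f] in the lattice.  Concavity with exponent [q] bounds the L^q(N)-norm of the
    random vector by the norm of this value ([concave_transfer]), and convexity gives the opposite
    bound ([convex_transfer]).  As the calculus and [N] are monotone, a pointwise inequality between
    the scalar functions of two random vectors, with exponent [q] on the left and [p] on the right,
    yields an inequality between their L^r(N)-norms for [p <= r <= q] ([vector_comparison]).

    It remains to compare scalar chaoses, with an L^(2m)-norm on the left and, on the right, the norm for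
    the exponent conjugate to [2m]; [m] is chosen so large that these exponents enclose [r] and
    the exponents of [N].  Both chaoses are multi-affine forms in independent variables whose odd moments
    vanish and which have finite moments and a common variance.  With the given normalizations they have
    the same second moment ([second_moments_agree]).  For small [rho] multiplying the terms of
    degree [k] by [rho^k] is a contraction from L^2 to L^(2m) ([hypercontractivity]), and by duality
    from the conjugate exponent to L^2 ([nq_dual]).  Hence a chaos dilated twice is dominated by the other one
    ([compare_nq]), in both directions, and [c = rho^-2].  The factor [rho] depends on [m]
    and on the moments of the two laws only ([good_parameters]). *)

Set Implicit Arguments.
Unset Strict Implicit.
Unset Printing Implicit Defensive.

Import Order.TTheory GRing.Theory Num.Theory.
Import numFieldNormedType.Exports.
Local Open Scope classical_set_scope.
Local Open Scope ring_scope.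

(** * The real line as a Banach lattice *)

(** With this instance a lattice expression in the coordinates of a vector and the same expression
    in elements of [E] are values of one definition, so that each algebraic identity is proved once. *)
Section RealLattice.
Variable R : realType.
Implicit Types x y z : R^o.

Let rle x y : Prop := x <= y.

Fact rle_refl x : rle x x. Proof. exact: lexx. Qed.

Fact rle_antisym x y : rle x y -> rle y x -> x = y.
Proof. by move=> xy yx; apply/eqP; rewrite eq_le xy yx. Qed.

Fact rle_trans y x z : rle x y -> rle y z -> rle x z.
Proof. exact: le_trans. Qed.

Fact rle_supl x y : rle x (Num.max x y).
Proof. by rewrite /rle le_max lexx. Qed.

Fact rle_supr x y : rle y (Num.max x y).
Proof. by rewrite /rle le_max lexx orbT. Qed.

Fact rsup_le x y z : rle x z -> rle y z -> rle (Num.max x y) z.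
Proof. by rewrite /rle ge_max => -> ->. Qed.

Fact rle_addr x y z : rle x y -> rle (x + z) (y + z).
Proof. by rewrite /rle lerD2r. Qed.

Fact rle_scale (a : R) x y : 0 <= a -> rle x y -> rle (a *: x) (a *: y).
Proof. by move=> a0 xy; apply: (ler_wpM2l a0). Qed.

Fact rle_norm x y : rle (Num.max x (- x)) (Num.max y (- y)) -> `|x| <= `|y|.
Proof. by rewrite /rle !maxrN. Qed.

HB.instance Definition _ := @isBanachLattice.Build R R^o rle _
  rle_refl rle_antisym rle_trans rle_supl rle_supr rsup_le rle_addr
  rle_scale rle_norm.

End RealLattice.

(** * Vector lattice identities *)

Section LatticeBasics.
Variables (R : realType) (E : banachLatticeType R).
Implicit Types x y z : E.

Definition babs x : E := bsup x (- x).

Lemma ble_tr x y z : ble x y -> ble y z -> ble x z.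
Proof. exact: ble_trans. Qed.

Lemma ble_add x y z w : ble x y -> ble z w -> ble (x + z) (y + w).
Proof.
move=> xy zw; apply: (@ble_trans _ _ (y + z)); first exact: ble_addr.
by rewrite ![y + _]addrC; exact: ble_addr.
Qed.

Lemma ble_subr x y z : ble (x + z) y <-> ble x (y - z).
Proof.
split=> h; first by rewrite -(addrK z x); exact: ble_addr.
by rewrite -(subrK z y); exact: ble_addr.
Qed.

Lemma ble_sub0 x y : ble x y <-> ble (x - y) 0.
Proof.
split=> h; first by rewrite -(subrr y); exact: ble_addr.
by rewrite -(subrK y x) -[X in ble _ X]add0r; exact: ble_addr.
Qed.

Lemma ble_opp x y : ble x y -> ble (- y) (- x).
Proof. by move=> xy; rewrite ble_sub0 opprK addrC -ble_sub0. Qed.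

(** Equalities between suprema are proved by comparing upper bounds. *)
Lemma ble_lub x y : (forall z, ble x z <-> ble y z) -> x = y.
Proof. by move=> h; apply: ble_antisym; apply/h; exact: ble_refl. Qed.

Lemma bsup_leP x y z : ble (bsup x y) z <-> ble x z /\ ble y z.
Proof.
split=> [h|[]]; last exact: bsup_le.
by split; apply: ble_tr h; [exact: ble_supl|exact: ble_supr].
Qed.

Lemma bsupC x y : bsup x y = bsup y x.
Proof. by apply: ble_lub => z; rewrite !bsup_leP; tauto. Qed.

Lemma bsup_addr x y z : bsup x y + z = bsup (x + z) (y + z).
Proof. by apply: ble_lub => w; rewrite ble_subr !bsup_leP -!ble_subr. Qed.

Lemma bsup_scale (a : R) x y : 0 <= a -> a *: bsup x y = bsup (a *: x) (a *: y).
Proof.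
rewrite le_eqVlt => /predU1P[<-|a0].
  by rewrite !scale0r; apply: ble_lub => z; rewrite bsup_leP; tauto.
have aP u w : ble (a *: u) w <-> ble u (a^-1 *: w).
  have a1 : 0 <= a^-1 by rewrite invr_ge0 ltW.
  split=> /ble_scale h.
    by have := h _ a1; rewrite scalerA mulVf ?gt_eqF// scale1r.
  by have := h _ (ltW a0); rewrite scalerA mulfV ?gt_eqF// scale1r.
by apply: ble_lub => w; rewrite aP !bsup_leP !aP.
Qed.

Lemma babs_ge0 x : ble 0 (babs x).
Proof.
have h : ble 0 (2 *: babs x).
  rewrite scaler_nat mulr2n -(subrr x).
  by apply: ble_add; [exact: ble_supl|exact: ble_supr].
have := @ble_scale _ _ 2^-1 _ _ _ h.
by rewrite scaler0 scalerA mulVf// scale1r; apply; rewrite invr_ge0.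
Qed.

Lemma babs_id x : ble 0 x -> babs x = x.
Proof.
move=> x0; apply: ble_antisym; last exact: ble_supl.
apply: bsup_le; first exact: ble_refl.
apply: (ble_tr _ x0); rewrite -[X in ble _ X]oppr0; exact: ble_opp.
Qed.

Lemma norm_babs x : `|babs x| = `|x|.
Proof.
have e : babs (babs x) = babs x by rewrite babs_id//; exact: babs_ge0.
by apply/eqP; rewrite eq_le; apply/andP; split; apply: ble_norm; rewrite -/(babs x) -/(babs (babs x)) e; exact: ble_refl.
Qed.

Lemma babsN x : babs (- x) = babs x.
Proof. by rewrite /babs opprK bsupC. Qed.

Lemma babsP x y : ble (babs x) y <-> ble x y /\ ble (- x) y.
Proof. exact: bsup_leP. Qed.

Lemma norm_le_of_babs x y : ble (babs x) y -> `|x| <= `|y|.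
Proof.
by move=> xy; apply: ble_norm; apply: ble_tr xy _; exact: ble_supl.
Qed.

Lemma babsZ (a : R) x : babs (a *: x) = `|a| *: babs x.
Proof.
have h (b : R) : 0 <= b -> babs (b *: x) = b *: babs x.
  by move=> b0; rewrite /babs bsup_scale// scalerN.
have [a0|a0] := lerP 0 a; first by rewrite ger0_norm// h.
by rewrite ltr0_norm// -h ?oppr_ge0 ?ltW// scaleNr babsN.
Qed.

(** The supremum is 1-Lipschitz in each argument because [|a \/ b - c \/ d|] is dominated by
    [|a - c| + |b - d|].  This is what makes the closure of the elementary calculus below respect
    suprema. *)
Lemma norm_bsup_sub (a b c d : E) : `|bsup a b - bsup c d| <= `|a - c| + `|b - d|.
Proof.
rewrite -(norm_babs (a - c)) -(norm_babs (b - d)).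
apply: le_trans (ler_normD _ _); apply: norm_le_of_babs.
have half (u v w t : E) : ble (bsup u v - bsup w t) (babs (u - w) + babs (v - t)).
  rewrite ble_subr opprK; apply: bsup_le.
    rewrite -[u in ble u _](subrK w); apply: ble_add; last exact: ble_supl.
    rewrite -[u - w]addr0; apply: ble_add; last exact: babs_ge0.
    by rewrite addr0; exact: ble_supl.
  rewrite -[v in ble v _](subrK t); apply: ble_add; last exact: ble_supr.
  rewrite -[v - t]add0r; apply: ble_add; first exact: babs_ge0.
  by rewrite add0r; exact: ble_supl.
apply/babsP; split; first exact: half.
by rewrite opprB -(babsN (a - c)) -(babsN (b - d)) !opprB; exact: half.
Qed.

End LatticeBasics.

(** * Finite maxima of linear forms *)

Section Forms.
Variables (R : realType) (n : nat).
Implicit Types (u v w a b c : 'rV[R]_n) (P Q : seq 'rV[R]_n).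

Definition leval (E : banachLatticeType R) (x : 'I_n -> E) a : E :=
  \sum_i a ord0 i *: x i.

Definition bmax (E : banachLatticeType R) (x : 'I_n -> E) P : E :=
  if P is a :: s then foldr (fun b => bsup (leval x b)) (leval x a) s else 0.

Definition coords v : 'I_n -> R^o := fun i => v ord0 i.

(** The sum of two finite maxima of forms is the maximum over the pairwise sums. *)
Definition psum P Q := [seq a + b | a <- P, b <- Q].

Section Eval.
Variables (E : banachLatticeType R) (x : 'I_n -> E).
Implicit Types y z : E.

Lemma leval_lin (k : R) a b : leval x (k *: a + b) = k *: leval x a + leval x b.
Proof.
rewrite /leval scaler_sumr -big_split /=; apply: eq_bigr => i _.
by rewrite !mxE scalerDl scalerA.
Qed.

Lemma levalD a b : leval x (a + b) = leval x a + leval x b.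
Proof. by have := leval_lin 1 a b; rewrite !scale1r. Qed.

Lemma leval0 : leval x 0 = 0.
Proof. by rewrite /leval big1 // => i _; rewrite mxE scale0r. Qed.

Lemma levalZ (k : R) a : leval x (k *: a) = k *: leval x a.
Proof. by have := leval_lin k a 0; rewrite leval0 !addr0. Qed.

Lemma leval_delta i : leval x (delta_mx ord0 i) = x i.
Proof.
rewrite /leval (bigD1 i)//= mxE !eqxx scale1r big1 ?addr0// => j ji.
by rewrite mxE (negPf ji) andbF scale0r.
Qed.

Lemma bmax_leP P z : P != [::] ->
  ble (bmax x P) z <-> forall c, c \in P -> ble (leval x c) z.
Proof.
case: P => // a s _ /=; elim: s => [|b s IH] /=.
  split=> [h c|]; first by rewrite inE => /eqP ->.
  by apply; rewrite inE.
rewrite bsup_leP IH; split=> [[h1 h2] c|h].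
  rewrite !inE => /or3P[/eqP->|/eqP->//|cs].
    by apply: h2; rewrite inE eqxx.
  by apply: h2; rewrite inE cs orbT.
split; first by apply: h; rewrite !inE eqxx orbT.
by move=> c; rewrite inE => /orP[/eqP->|cs]; apply: h; rewrite !inE ?eqxx ?cs ?orbT.
Qed.

Lemma bmax_ge P c : c \in P -> ble (leval x c) (bmax x P).
Proof.
move=> cP; have P0 : P != [::] by case: P cP.
exact: (proj1 (bmax_leP _ P0) (ble_refl _)).
Qed.

Lemma psum_neq0 P Q : P != [::] -> Q != [::] -> psum P Q != [::].
Proof. by case: P => // a s _; case: Q. Qed.

Lemma bmax_psum P Q : P != [::] -> Q != [::] ->
  bmax x (psum P Q) = bmax x P + bmax x Q.
Proof.
move=> P0 Q0; apply: ble_lub => z; rewrite bmax_leP ?psum_neq0//.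
rewrite ble_subr bmax_leP//; split=> [h a aP|h c /allpairsP[[a b] /= [aP bQ ->]]].
  rewrite -ble_subr addrC ble_subr bmax_leP// => b bQ.
  by rewrite -ble_subr addrC -levalD; apply: h; apply: allpairs_f.
rewrite levalD; apply: ble_tr (_ : ble (leval x a + bmax x Q) z).
  by rewrite ![leval x a + _]addrC; apply: ble_addr; exact: bmax_ge.
by rewrite ble_subr; exact: h.
Qed.

Lemma bmax_cat P Q : P != [::] -> Q != [::] ->
  bmax x (P ++ Q) = bsup (bmax x P) (bmax x Q).
Proof.
move=> P0 Q0; apply: ble_lub => z; rewrite bsup_leP !bmax_leP//; last by case: P P0.
split=> [h|[h1 h2] c]; last by rewrite mem_cat => /orP[/h1|/h2].
by split=> c cP; apply: h; rewrite mem_cat cP ?orbT.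
Qed.

Lemma bmax_scale (k : R) P : 0 <= k -> bmax x [seq k *: c | c <- P] = k *: bmax x P.
Proof.
move=> k0; case: P => [|a s] /=; first by rewrite scaler0.
elim: s => [|b s IH] /=; first by rewrite levalZ.
by rewrite IH levalZ bsup_scale.
Qed.

End Eval.

Definition dot u v : R := leval (coords v) u.

Lemma dotE u v : dot u v = \sum_i u ord0 i * v ord0 i. Proof. by []. Qed.

Lemma dotC u v : dot u v = dot v u.
Proof. by rewrite !dotE; apply: eq_bigr => i _; rewrite mulrC. Qed.

Lemma dotDl a b v : dot (a + b) v = dot a v + dot b v.
Proof. exact: (levalD (coords v)). Qed.

Lemma dotZl k a v : dot (k *: a) v = k * dot a v.
Proof. exact: (levalZ (coords v)). Qed.

Lemma dotDr a b v : dot v (a + b) = dot v a + dot v b.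
Proof. by rewrite dotC dotDl !(dotC v). Qed.

Lemma dotZr k a v : dot v (k *: a) = k * dot v a.
Proof. by rewrite dotC dotZl dotC. Qed.

Lemma dot_gt0 a : a != 0 -> 0 < dot a a.
Proof.
move=> a0; rewrite lt_neqAle eq_sym dotE; apply/andP; split; last first.
  by apply: sumr_ge0 => i _; rewrite -expr2 sqr_ge0.
apply: contra a0; rewrite psumr_eq0 => [/allP h|i _]; last by rewrite -expr2 sqr_ge0.
apply/eqP/rowP => i; have := h i (mem_index_enum i).
by rewrite mxE /= mulf_eq0 orbb => /eqP.
Qed.

Lemma perturb_pos (s : seq 'rV[R]_n) u a : (forall b, b \in s -> 0 < dot b u) ->
  exists2 e : R, 0 < e & forall b, b \in s -> 0 < dot b (u + e *: a).
Proof.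
elim: s => [_|b s IH h]; first by exists 1.
have [b1 b1s|e e0 he] := IH; first by apply: h; rewrite inE b1s orbT.
have hb : 0 < dot b u by apply: h; rewrite inE eqxx.
pose d := dot b u / (`|dot b a| + 1).
have N0 : 0 < `|dot b a| + 1 by rewrite ltr_wpDl.
have d0 : 0 < d by rewrite divr_gt0.
exists (Num.min e d); first by rewrite lt_min e0 d0.
move=> c; rewrite inE dotDr dotZr => /predU1P[->|cs].
  have : Num.min e d * `|dot b a| < dot b u.
    apply: le_lt_trans (_ : d * `|dot b a| < _).
      by apply: ler_wpM2r => //; rewrite ge_min lexx orbT.
    by rewrite /d -mulrA gtr_pMr// mulrC ltr_pdivrMr// mul1r ltrDl.
  have : 0 < Num.min e d by rewrite lt_min e0 d0.
  set m := Num.min e d => m0 hm.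
  have : - (m * `|dot b a|) <= m * dot b a.
    by rewrite -mulrN; apply: ler_wpM2l; [exact: ltW|rewrite lerNl -normrN ler_norm].
  lra.
have := he _ cs; rewrite dotDr dotZr => hc.
have hc0 : 0 < dot c u by apply: h; rewrite inE cs orbT.
have m0 : 0 < Num.min e d by rewrite lt_min e0 d0.
have me : Num.min e d <= e by rewrite ge_min lexx.
have [ca|ca] := lerP 0 (dot c a); first by rewrite ltr_wpDr// mulr_ge0// ltW.
by apply: lt_le_trans hc _; rewrite lerD2l; apply: ler_wnM2r => //; exact: ltW.
Qed.

(** A form of Gordan's alternative, for the forms [c] of a finite list: either they are all
    positive at some real vector, or only nonpositive elements of the lattice are dominated by all
    their values at [x].  It plays the part of the representation of finitely generated
    sublattices as function spaces.  The induction eliminates the first form [a]: if the vector [v]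
    found for the remaining ones has [dot a v < 0], each remaining form [b] is replaced by the convex
    combination of [a] and [b] that vanishes at [v], and a solution for these is corrected along [v]
    so as to vanish on [a], then moved slightly in the direction [a]. *)
Lemma gordan (E : banachLatticeType R) (x : 'I_n -> E) (s : seq 'rV[R]_n) :
  (exists v, forall c, c \in s -> 0 < dot c v) \/
  (forall z, (forall c, c \in s -> ble z (leval x c)) -> ble z 0).
Proof.
have [m] := ubnP (size s); elim: m s => // m IH [|a s] /=.
  by move=> _; left; exists 0.
rewrite ltnS => sm.
have [->|a0] := eqVneq a 0.
  by right=> z /(_ 0); rewrite leval0 inE eqxx; apply.
have [[v hv]|h] := IH s sm; last first.
  by right=> z hz; apply: h => c cs; apply: hz; rewrite inE cs orbT.
have pert u : dot a u = 0 -> (forall b, b \in s -> 0 < dot b u) ->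
    exists v, forall c, c \in a :: s -> 0 < dot c v.
  move=> au /(@perturb_pos _ _ a)[e e0 he]; exists (u + e *: a) => c.
  rewrite inE => /predU1P[->|]; last exact: he.
  by rewrite dotDr dotZr au add0r mulr_gt0// dot_gt0.
have [av|av] := ltrP 0 (dot a v).
  by left; exists v => c; rewrite inE => /predU1P[->//|]; exact: hv.
have [/eqP av0|av0] := boolP (dot a v == 0); first by left; exact: pert av0 hv.
pose k := - dot a v.
have k0 : 0 < k by rewrite /k oppr_gt0 lt_neqAle av0.
(* the convex combination of [a] and [b] that vanishes at [v] *)
pose t b := (dot b v + k)^-1 *: (dot b v *: a + k *: b).
have [|[w hw]|h] := IH [seq t b | b <- s]; first by rewrite size_map.
  (* this combination of [w] and [v] is a zero of [a] *)
  left; apply: (pert (k *: w + dot a w *: v)).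
    by rewrite dotDr !dotZr /k; ring.
  move=> b bs; have := hw (t b) (map_f _ bs); have := hv b bs => bv.
  rewrite dotZl pmulr_rgt0 ?invr_gt0 ?addr_gt0// dotDl !dotZl dotDr !dotZr.
  by rewrite addrC (mulrC (dot a w)).
right=> z hz; apply: h => _ /mapP[b bs ->]; have bv := hv b bs.
have sk : 0 < dot b v + k by rewrite addr_gt0.
have -> : z = (dot b v + k)^-1 *: (dot b v *: z + k *: z).
  by rewrite -scalerDl scalerA mulVf ?scale1r// gt_eqF.
rewrite levalZ levalD !levalZ; apply: ble_scale; first by rewrite invr_ge0 ltW.
apply: ble_add; apply: ble_scale; rewrite ?ltW//; apply: hz.
  by rewrite inE eqxx.
by rewrite inE bs orbT.
Qed.

End Forms.

(** * The calculus on differences of maxima *)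

Section Elementary.
Variables (R : realType) (n : nat).
Implicit Types (u v w : 'rV[R]_n) (P Q : seq 'rV[R]_n) (g h : 'rV[R]_n -> R).

Definition diff_max P Q v : R := bmax (coords v) P - bmax (coords v) Q.

Lemma continuous_lin (k : R) g h : continuous g -> continuous h ->
  continuous (fun v => k * g v + h v).
Proof.
move=> gc hc v; apply: (@continuousD R R _ (fun v => k * g v) h); last exact: hc.
by apply: continuousM; [exact: cst_continuous|exact: gc].
Qed.

Lemma bmax_coords_poshom P : pos_homogeneous (fun v => bmax (coords v) P : R).
Proof.
have lc (a : 'rV[R]_n) : continuous (fun v => leval (coords v) a : R).
  suff : continuous (fun v : 'rV[R]_n => \sum_i a ord0 i * v ord0 i) by [].
  elim: (index_enum _) => [|i r IH].
    by under eq_fun do rewrite big_nil; exact: cst_continuous.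
  under eq_fun do rewrite big_cons.
  exact: (@continuous_lin (a ord0 i) (fun v => v ord0 i) _ (@coord_continuous _ _ _ ord0 i) IH).
split.
  case: P => [|a s] /=; first exact: cst_continuous.
  elim: s => [|b s IH] /=; first exact: lc.
  by move=> v; apply: (@continuous_max _ _ (fun v => leval (coords v) b)); [exact: lc|exact: IH].
have lh (a : 'rV[R]_n) (k : R) v : leval (coords (k *: v)) a = k * leval (coords v) a :> R.
  exact: dotZr.
move=> k v k0; case: P => [|a s] /=; first by rewrite mulr0.
elim: s => [|b s IH] /=; first exact: lh.
rewrite IH lh; symmetry.
exact: (bsup_scale (leval (coords v) b) (foldr _ _ s) k0).
Qed.

Lemma pos_homogeneous_lin (k : R) g h : pos_homogeneous g -> pos_homogeneous h ->
  pos_homogeneous (fun v => k * g v + h v).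
Proof.
move=> [gc gh] [hc hh]; split.
  exact: continuous_lin.
by move=> c v c0; rewrite gh// hh//; ring.
Qed.

Lemma pos_homogeneous_max g h : pos_homogeneous g -> pos_homogeneous h ->
  pos_homogeneous (fun v => Num.max (g v) (h v)).
Proof.
move=> [gc gh] [hc hh]; split.
  by move=> v; apply: (@continuous_max _ _ g); [exact: gc|exact: hc].
by move=> c v c0; rewrite gh// hh// maxr_pMr.
Qed.

Lemma pos_homogeneous_coord i : pos_homogeneous (fun v => v ord0 i).
Proof.
by split=> [|c v _]; [exact: coord_continuous|rewrite mxE].
Qed.

Lemma pos_homogeneous0 : pos_homogeneous (fun _ : 'rV[R]_n => 0 : R).
Proof. by split=> [|c v _]; [exact: cst_continuous|rewrite mulr0]. Qed.

Section InLattice.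
Variables (E : banachLatticeType R) (x : 'I_n -> E).
Implicit Types y z : E.

(** The value at [x] of a function that is presented as a difference of two finite maxima.  The
    presentation is hidden by an existential quantifier: by [elementary_le] the value depends on
    the function alone. *)
Definition elementary g y : Prop := exists P Q,
  [/\ P != [::], Q != [::], forall v, g v = diff_max P Q v &
      y = bmax x P - bmax x Q].

Lemma elementary_coord i : elementary (fun v => v ord0 i) (x i).
Proof.
exists [:: delta_mx ord0 i], [:: 0]; split=> //= [v|].
  by rewrite /diff_max /= leval0 subr0 leval_delta.
by rewrite leval0 subr0 leval_delta.
Qed.

Lemma elementaryD g h y z : elementary g y -> elementary h z ->
  elementary (fun v => g v + h v) (y + z).
Proof.
move=> [P [Q [P0 Q0 gE ->]]] [P' [Q' [P'0 Q'0 hE ->]]].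
exists (psum P P'), (psum Q Q'); split=> [||v|]; rewrite ?psum_neq0//.
  by rewrite gE hE /diff_max !bmax_psum//; ring.
by rewrite !bmax_psum// opprD addrACA.
Qed.

Lemma elementaryN g y : elementary g y -> elementary (fun v => - g v) (- y).
Proof.
move=> [P [Q [P0 Q0 gE ->]]]; exists Q, P; split=> // [v|]; last by rewrite opprB.
by rewrite gE /diff_max opprB.
Qed.

Lemma elementaryZ (k : R) g y : elementary g y ->
  elementary (fun v => k * g v) (k *: y).
Proof.
have pos (b : R) : 0 <= b -> elementary g y -> elementary (fun v => b * g v) (b *: y).
  move=> b0 [P [Q [P0 Q0 gE ->]]]; exists [seq b *: c | c <- P], [seq b *: c | c <- Q].
  split=> // [||v|]; [by case: P P0 {gE}|by case: Q Q0 {gE}| |].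
    by rewrite gE /diff_max !bmax_scale// -scalerBr.
  by rewrite !bmax_scale// scalerBr.
have [k0|k0] := lerP 0 k; first exact: pos.
move=> /(pos (- k)); rewrite oppr_ge0 ltW// => /(_ isT) /elementaryN.
rewrite scaleNr opprK; congr elementary; apply/funext => v; ring.
Qed.

Lemma elementary_max g h y z : elementary g y -> elementary h z ->
  elementary (fun v => Num.max (g v) (h v)) (bsup y z).
Proof.
move=> [P [Q [P0 Q0 gE ->]]] [P' [Q' [P'0 Q'0 hE ->]]].
have key (L : banachLatticeType R) (a b c d : L) :
    bsup (a - b) (c - d) = bsup (a + d) (c + b) - (b + d).
  rewrite bsup_addr; congr bsup; last by rewrite opprD addrA addrK.
  by rewrite [b + d]addrC opprD addrA addrK.
exists (psum P Q' ++ psum P' Q), (psum Q Q'); split=> //.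
- by case: (psum P Q') (psum_neq0 P0 Q'0).
- exact: psum_neq0.
- move=> v; rewrite gE hE /diff_max bmax_cat ?psum_neq0// !bmax_psum//.
  exact: (key R^o).
- by rewrite bmax_cat ?psum_neq0// !bmax_psum// key.
Qed.

Lemma elementary0 : elementary (fun=> 0) 0.
Proof.
exists [:: 0], [:: 0]; split=> //= [v|]; last by rewrite subrr.
by rewrite /diff_max subrr.
Qed.

Lemma elementary_abs g y : elementary g y -> elementary (fun v => `|g v|) (babs y).
Proof.
move=> gy; have := elementary_max gy (elementaryN gy); congr elementary.
by apply/funext => v; rewrite maxrN.
Qed.

Lemma elementary_sum (I : Type) (r : seq I) (G : I -> 'rV[R]_n -> R) (y : I -> E) :
  (forall i, elementary (G i) (y i)) ->
  elementary (fun v => \sum_(i <- r) G i v) (\sum_(i <- r) y i).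
Proof.
move=> h; elim: r => [|i r IH].
  by rewrite big_nil; have := elementary0; congr elementary; apply/funext => v; rewrite big_nil.
rewrite big_cons; have := elementaryD (h i) IH; congr elementary.
by apply/funext => v; rewrite big_cons.
Qed.

(** Inequalities between real expressions pass to the lattice.  To bound [bmax x P] by [bmax x Q],
    take one form [a] of [P]; if the forms [a - b] for [b] in [Q] were all positive somewhere, the
    function would be positive there, so Gordan's alternative applies. *)
Lemma elementary_le0 g y : elementary g y -> (forall v, g v <= 0) -> ble y 0.
Proof.
move=> [P [Q [P0 Q0 gE ->]]] g0; rewrite -ble_sub0 bmax_leP// => a aP.
have [[v hv]|h] := gordan x [seq a - b | b <- Q]; last first.
  rewrite ble_sub0; apply: h => _ /mapP[b bQ ->].
  rewrite levalD; apply: ble_add; first exact: ble_refl.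
  rewrite -[- b]scaleN1r levalZ scaleN1r; apply: ble_opp; exact: bmax_ge.
have := g0 v; rewrite gE /diff_max subr_le0 leNgt => /negP[].
apply: (@lt_le_trans _ _ (leval (coords v) a)); last exact: (@bmax_ge _ _ R^o).
have [b bQ ->] : exists2 b, b \in Q & bmax (coords v) Q = leval (coords v) b.
  case: Q Q0 {gE hv} => // b s _ /=; elim: s => [|c s [d ds IH]] /=.
    by exists b; rewrite ?inE.
  rewrite IH /bsup /= /Num.max; case: ifP => _; last first.
    by exists c => //; rewrite !inE eqxx orbT.
  by exists d => //; move: ds; rewrite !inE => /orP[->//|->]; rewrite !orbT.
have := hv _ (map_f (fun b => a - b) bQ).
by rewrite dotDl -[- b]scaleN1r dotZl mulN1r subr_gt0.
Qed.

Lemma elementary_le g h y z : elementary g y -> elementary h z ->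
  (forall v, g v <= h v) -> ble y z.
Proof.
move=> gy hz gh; rewrite ble_sub0.
by apply: elementary_le0 (elementaryD gy (elementaryN hz)) _ => v; rewrite subr_le0.
Qed.

Lemma elementary_poshom g y : elementary g y -> pos_homogeneous g.
Proof.
move=> [P [Q [_ _ gE _]]].
have -> : g = (fun v => -1 * (bmax (coords v) Q : R) + (bmax (coords v) P : R)).
  by apply/funext => v; rewrite gE /diff_max; ring.
by apply: pos_homogeneous_lin; exact: bmax_coords_poshom.
Qed.

(** On elementary functions every calculus is forced by its values on the coordinates. *)
Lemma krivine_elementary tau g y : krivine_calculus x tau ->
  elementary g y -> tau g = y.
Proof.
move=> [tc tl ts] [P [Q [P0 Q0 gE ->]]].
have p0 := @pos_homogeneous0.
have t0 : tau (fun=> 0) = 0.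
  have := tl (-1) _ _ p0 p0; rewrite scaleN1r addNr => <-.
  by congr tau; apply/funext => v; rewrite mulr0 addr0.
have tlev a : pos_homogeneous (fun v => leval (coords v) a : R) /\
    tau (fun v => leval (coords v) a) = leval x a.
  rewrite /leval; elim: (index_enum _) => [|i r [IH1 IH2]].
    rewrite big_nil -t0; split; first by have := p0; congr pos_homogeneous; apply/funext => v; rewrite big_nil.
    by congr tau; apply/funext => v; rewrite big_nil.
  have e : (fun v => \sum_(j <- i :: r) a ord0 j *: coords v j : R) =
    (fun v => a ord0 i * v ord0 i + (\sum_(j <- r) a ord0 j *: coords v j : R)).
    by apply/funext => v; rewrite big_cons.
  rewrite e; split; first by apply: pos_homogeneous_lin => //; exact: pos_homogeneous_coord.
  by rewrite tl ?big_cons ?tc ?IH2//; exact: pos_homogeneous_coord.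
have tmax P' : P' != [::] -> tau (fun v => bmax (coords v) P') = bmax x P'.
  case: P' => // a s _; elim: s => [|b s IH] /=; first by case: (tlev a).
  rewrite ts; first by rewrite IH; case: (tlev b) => _ ->.
    by case: (tlev b).
  exact: (bmax_coords_poshom (a :: s)).
have -> : g = (fun v => -1 * (bmax (coords v) Q : R) + (bmax (coords v) P : R)).
  by apply/funext => v; rewrite gE /diff_max; ring.
by rewrite tl ?tmax ?scaleN1r 1?addrC//; exact: bmax_coords_poshom.
Qed.

End InLattice.
End Elementary.

(** * Density of elementary functions *)

Section Density.
Variables (R : realType) (n : nat).
Implicit Types (u v w : 'rV[R]_n) (g h : 'rV[R]_n -> R).

Definition norm1 v : R := \sum_i `|v ord0 i|.

Lemma norm1_ge0 v : 0 <= norm1 v.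
Proof. by apply: sumr_ge0 => i _. Qed.

Lemma norm_le_norm1 v : `|v| <= norm1 v.
Proof.
change (mx_norm v <= norm1 v); rewrite mx_normrE.
apply: bigmax_le; first exact: norm1_ge0.
move=> [i j] _ /=; rewrite (ord1 i) /norm1 (bigD1 j)//= lerDl.
by apply: sumr_ge0.
Qed.

Variables (E : banachLatticeType R) (x : 'I_n -> E).

Definition elem g := exists y, elementary x g y.

Let S : set 'rV[R]_n := [set v | `|v| = 1].

Lemma sphere_compact : compact S.
Proof.
apply: bounded_closed_compact.
  exists 1; split; first exact: num_real.
  by move=> M M1 v; rewrite /S /= => ->; exact: ltW.
rewrite (_ : S = (fun v => `|v|) @^-1` [set 1])//.
apply: preimage_closed; last exact: closed_eq.
by move=> v _; exact: norm_continuous.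
Qed.

Lemma elem_continuous g : elem g -> continuous g.
Proof. by move=> [y /elementary_poshom[]]. Qed.

(** The local step of the Stone-Weierstrass argument.  The function [h u * t + M * D] is elementary,
    equals [h u] at [u], and its penalty [D] vanishes on the sphere only at [u]; by compactness a
    large [M] pushes it above [h - e] on the whole sphere. *)
Lemma interpolation_point h u (e : R) : continuous h -> S u -> 0 < e ->
  exists2 g, elem g & (forall v, S v -> h v - e < g v) /\ g u = h u.
Proof.
move=> hc Su e0.
have [i0 ui0] : exists i, u ord0 i != 0.
  apply/existsP; rewrite -negb_forall; apply/negP => /forallP u0.
  have : u = 0 by apply/rowP => i; rewrite mxE; have /eqP := u0 i.
  by move=> u00; move: Su; rewrite /S /= u00 normr0 => /esym/eqP; rewrite oner_eq0.
pose t v : R := Num.max (v ord0 i0 / u ord0 i0) 0.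
pose D v : R := \sum_i `|v ord0 i - t v * u ord0 i|.
pose G (M : R) v : R := h u * t v + M * D v.
have elt : exists y, elementary x t y.
  eexists; rewrite /t; apply: elementary_max; last exact: elementary0.
  under eq_fun do rewrite mulrC.
  by apply: elementaryZ; exact: elementary_coord.
have elG M : elem (G M).
  have [y hy] := elt.
  eexists; apply: elementaryD; first exact: elementaryZ hy.
  apply: elementaryZ; apply: (@elementary_sum _ _ _ _ _ _ _ (fun i => babs (x i + - (u ord0 i *: y)))) => i.
  apply: elementary_abs; apply: elementaryD; first exact: elementary_coord.
  apply: elementaryN; under eq_fun do rewrite mulrC; exact: elementaryZ.
have tu : t u = 1 by rewrite /t divff// max_l.
have D0 v : 0 <= D v by apply: sumr_ge0.
have DS v : S v -> D v = 0 -> v = u.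
  move=> Sv /eqP; rewrite psumr_eq0// => /allP h0.
  have vt : v = t v *: u.
    apply/rowP => i; rewrite mxE; apply/eqP; rewrite -subr_eq0 -normr_eq0.
    exact: (h0 i (mem_index_enum i)).
  have t1 : t v = 1.
    have : `|v| = `|t v *: u| by rewrite -vt.
    rewrite normrZ Sv Su mulr1 => ->; rewrite ger0_norm//.
    by rewrite /t le_max lexx orbT.
  by rewrite vt t1 scale1r.
have /compact_near_coveringP nc := sphere_compact.
have [] := nc _ (pinfty_nbhs R) (fun M v => h v - e < G M v) _ _.
  move=> v Sv.
  have [M0 hM0] : exists M0, h v - e < G M0 v.
    have [Dv|Dv] := eqVneq (D v) 0.
      by exists 0; rewrite /G (DS v Sv Dv) tu mulr1 mul0r addr0 ltrBlDr ltrDl.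
    exists ((h v - h u * t v) / D v); rewrite /G mulfVK//.
    by rewrite subrKC ltrBlDr ltrDl.
  have hnear : \forall v' \near v, h v' - e < G M0 v'.
    have fc := @continuous_lin _ _ (-1) _ _ (elem_continuous (elG M0)) hc.
    have := cvgr_lt _ (fc v) e; rewrite /= mulN1r addrC => /(_ _).
    have hlt : h v - G M0 v < e by move: hM0; lra.
    move=> /(_ hlt); apply: filterS => v' /=; lra.
  exists ([set v' | h v' - e < G M0 v'], [set M | M0 <= M]).
    by split; [exact: hnear|apply: nbhs_pinfty_ge; exact: num_real].
  move=> [v' M] /= [h1 h2]; apply: lt_le_trans h1 _.
  by rewrite /G lerD2l; apply: ler_wpM2r.
move=> M0 [_ /(_ (M0 + 1))]; rewrite ltrDl => /(_ ltr01) hM.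
exists (G (M0 + 1)) => //; split; first by move=> v; exact: hM.
rewrite /G tu mulr1 /D big1 ?mulr0 ?addr0// => i _.
by rewrite tu mul1r subrr normr0.
Qed.

Lemma elem_min g h : elem g -> elem h -> elem (fun v => Num.min (g v) (h v)).
Proof.
move=> [y gy] [z hz]; exists (- bsup (- y) (- z)).
rewrite (_ : (fun v => _) = (fun v => - Num.max (- g v) (- h v))).
  exact: elementaryN (elementary_max (elementaryN gy) (elementaryN hz)).
by apply/funext => v; rewrite oppr_max !opprK.
Qed.

Lemma elem_min_seq (I : eqType) (s : seq I) (G : I -> 'rV[R]_n -> R) (A : set 'rV[R]_n) h :
  s != [::] -> (forall i, i \in s -> elem (G i) /\ forall v, A v -> h v < G i v) ->
  exists2 g, elem g & (forall v, A v -> h v < g v) /\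
    forall i v, i \in s -> g v <= G i v.
Proof.
case: s => // i s _; elim: s => [|j s IH] hs.
  have [ei hi] := hs i (mem_head _ _).
  by exists (G i) => //; split=> // j v; rewrite inE => /eqP ->.
have [k|g eg [hg1 hg2]] := IH.
  by rewrite inE => /orP[/eqP->|ks]; apply: hs; rewrite !inE ?eqxx ?ks ?orbT.
have [ej hj] : elem (G j) /\ forall v, A v -> h v < G j v.
  by apply: hs; rewrite !inE eqxx orbT.
exists (fun v => Num.min (g v) (G j v)); first exact: elem_min.
split=> [v Av|k v]; first by rewrite lt_min hg1// hj.
rewrite ge_min !inE => /or3P[/eqP->|/eqP->|ks]; last 2 first.
- by rewrite lexx orbT.
- by rewrite hg2// inE ks orbT.
- by rewrite hg2// inE eqxx.
Qed.

(** The minimum of finitely many functions from [interpolation_point], taken at the centres of a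
    finite cover of the sphere, is within [e] of [h]. *)
Lemma elem_dense_sphere h (e : R) : continuous h -> 0 < e ->
  exists2 g, elem g & forall v, S v -> `|g v - h v| <= e.
Proof.
move=> hc e0.
have /choice[G hG] : forall u, exists g, S u ->
    [/\ elem g, forall v, S v -> h v - e < g v & g u = h u].
  move=> u; have [Su|nSu] := pselect (S u); last by exists h.
  by have [g ? []] := interpolation_point hc Su e0; exists g.
have := sphere_compact; rewrite compact_cover => /(_ 'rV[R]_n S
  (fun u => [set v | G u v - h v < e])) [].
- move=> u Su; have [eg _ _] := hG u Su.
  rewrite openE => v /= hv.
  have fc := @continuous_lin _ _ (-1) _ _ hc (elem_continuous eg).
  have := cvgr_lt _ (fc v) e; rewrite /= mulN1r addrC => /(_ _ hv).
  by rewrite /interior; apply: filterS => v' /=; lra.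
- by move=> v Sv; exists v => //=; have [_ _ ->] := hG v Sv; rewrite subrr.
move=> D DS cov.
have [D0|D0] := eqVneq (finmap.enum_fset D) [::].
  exists (fun=> 0); first by exists 0; exact: elementary0.
  by move=> v Sv; have [u /= uD _] := cov v Sv; have : u \in finmap.enum_fset D by []; rewrite D0.
have [u uD|g eg [hg1 hg2]] := @elem_min_seq _ _ G S (fun v => h v - e) D0.
  by have [] := hG u (set_mem (DS _ uD)).
exists g => // v Sv; have [u /= uD hu] := cov v Sv.
have := hg1 v Sv; have := hg2 u v uD; rewrite ler_norml => h1 h2.
by apply/andP; split; lra.
Qed.

(** By homogeneity an approximation on the sphere is one relative to the norm, which is the form
    that the calculus can use. *)
Lemma elem_dense h (e : R) : pos_homogeneous h -> 0 < e ->
  exists2 g, elem g & forall v, `|g v - h v| <= e * norm1 v.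
Proof.
move=> [hc hh] e0; have [g eg hg] := elem_dense_sphere hc e0.
exists g => // v; have [_ gh] : pos_homogeneous g by have [y /elementary_poshom] := eg.
apply: le_trans (_ : e * `|v| <= _); last first.
  by apply: ler_wpM2l; [exact: ltW|exact: norm_le_norm1].
have [->|v0] := eqVneq v 0.
  have g0 := gh 0 0 (lexx 0); have h0 := hh 0 0 (lexx 0).
  by move: g0 h0; rewrite scaler0 !mul0r => -> ->; rewrite subrr !normr0 mulr0.
have nv : 0 < `|v| by rewrite normr_gt0.
have ve : v = `|v| *: (`|v|^-1 *: v) by rewrite scalerA divff ?scale1r// gt_eqF.
have Sw : S (`|v|^-1 *: v).
  by rewrite /S /= normrZ ger0_norm ?invr_ge0// mulVf// gt_eqF.
rewrite {1 2}ve gh// hh// -mulrBr normrM normr_id mulrC.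
by apply: ler_wpM2r => //; exact: hg.
Qed.

End Density.

(** * Consequences of the calculus axioms *)

Section CalculusProperties.
Variables (R : realType) (E : banachLatticeType R) (n : nat) (x : 'I_n -> E).
Variable tau : ('rV[R]_n -> R) -> E.
Hypothesis tauP : krivine_calculus x tau.
Implicit Types (g h : 'rV[R]_n -> R).

Lemma krivine0 : tau (fun=> 0) = 0.
Proof. exact: krivine_elementary tauP (elementary0 x). Qed.

Lemma krivineZ (a : R) g : pos_homogeneous g -> tau (fun v => a * g v) = a *: tau g.
Proof.
move=> gp; have := krivine_linear tauP a gp (pos_homogeneous0 _ _).
by rewrite krivine0 addr0 => <-; congr tau; apply/funext => v; rewrite addr0.
Qed.

Lemma krivineD g h : pos_homogeneous g -> pos_homogeneous h ->
  tau (fun v => g v + h v) = tau g + tau h.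
Proof.
move=> gp hp; have := krivine_linear tauP 1 gp hp; rewrite scale1r => <-.
by congr tau; apply/funext => v; rewrite mul1r.
Qed.

Lemma pos_homogeneousZ (a : R) g : pos_homogeneous g -> pos_homogeneous (fun v => a * g v).
Proof.
move=> gp; have := pos_homogeneous_lin a gp (pos_homogeneous0 _ _).
by congr pos_homogeneous; apply/funext => v; rewrite addr0.
Qed.

Lemma pos_homogeneousN g : pos_homogeneous g -> pos_homogeneous (fun v => - g v).
Proof.
move=> gp; have := pos_homogeneousZ (-1) gp.
by congr pos_homogeneous; apply/funext => v; rewrite mulN1r.
Qed.

Lemma pos_homogeneousD g h : pos_homogeneous g -> pos_homogeneous h ->
  pos_homogeneous (fun v => g v + h v).
Proof.
move=> gp hp; have := pos_homogeneous_lin 1 gp hp.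
by congr pos_homogeneous; apply/funext => v; rewrite mul1r.
Qed.

Lemma pos_homogeneous_abs g : pos_homogeneous g -> pos_homogeneous (fun v => `|g v|).
Proof.
move=> gp; have := pos_homogeneous_max gp (pos_homogeneousN gp).
by congr pos_homogeneous; apply/funext => v; rewrite maxrN.
Qed.

Lemma krivineN g : pos_homogeneous g -> tau (fun v => - g v) = - tau g.
Proof.
move=> gp; rewrite -scaleN1r -krivineZ//.
by congr tau; apply/funext => v; rewrite mulN1r.
Qed.

Lemma krivine_abs g : pos_homogeneous g -> tau (fun v => `|g v|) = babs (tau g).
Proof.
move=> gp; rewrite /babs -krivineN// -(krivine_sup tauP)//; last exact: pos_homogeneousN.
by congr tau; apply/funext => v; rewrite maxrN.
Qed.

Lemma krivine_le g h : pos_homogeneous g -> pos_homogeneous h ->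
  (forall v, g v <= h v) -> ble (tau g) (tau h).
Proof.
move=> gp hp gh; rewrite (_ : h = fun v => Num.max (g v) (h v)).
  by rewrite (krivine_sup tauP)//; exact: ble_supl.
by apply/funext => v; rewrite max_r.
Qed.

Lemma krivine_norm_le g h : pos_homogeneous g -> pos_homogeneous h ->
  (forall v, `|g v| <= h v) -> `|tau g| <= `|tau h|.
Proof.
move=> gp hp gh; apply: norm_le_of_babs; rewrite -krivine_abs//.
by apply: krivine_le => //; exact: pos_homogeneous_abs.
Qed.

Lemma elementary_norm1 : elementary x (@norm1 R n) (\sum_i babs (x i)).
Proof.
by apply: elementary_sum => i; apply: elementary_abs; exact: elementary_coord.
Qed.

(** Functions that are close relative to [norm1] have close values, so any calculus is continuous. *)
Lemma krivine_close g h (e : R) : pos_homogeneous g -> pos_homogeneous h -> 0 <= e ->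
  (forall v, `|g v - h v| <= e * norm1 v) -> `|tau g - tau h| <= e * \sum_i `|x i|.
Proof.
move=> gp hp e0 gh.
have n1p := elementary_poshom elementary_norm1.
rewrite -krivineN// -krivineD//; last exact: pos_homogeneousN.
apply: le_trans (krivine_norm_le _ (pos_homogeneousZ e n1p) gh) _.
  by apply: pos_homogeneousD => //; exact: pos_homogeneousN.
rewrite krivineZ// normrZ ger0_norm// (krivine_elementary tauP elementary_norm1).
apply: ler_wpM2l => //; apply: le_trans (ler_norm_sum _ _ _) _.
by under eq_bigr do rewrite norm_babs.
Qed.

Lemma row_continuous m (G : 'I_m -> 'rV[R]_n -> R) : (forall i, continuous (G i)) ->
  continuous (fun v => \row_i G i v).
Proof.
move=> Gc v A [P hP PA].
have : \forall v' \near (v : 'rV[R]_n), forall i, P ord0 i (G i v').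
  apply: (@filter_forall _ _ (fun i v' => P ord0 i (G i v')) _ (nbhs_filter v)) => i.
  by have := hP ord0 i; rewrite mxE => /Gc.
apply: filterS => v' hv'; apply: PA => i j.
by rewrite mxE (ord1 i).
Qed.

Lemma pos_homogeneous_comp m (G : 'I_m -> 'rV[R]_n -> R) (h : 'rV[R]_m -> R) :
  (forall i, pos_homogeneous (G i)) -> pos_homogeneous h ->
  pos_homogeneous (fun v => h (\row_i G i v)).
Proof.
move=> Gp [hc hh]; split.
  move=> v; apply: (@continuous_comp _ _ _ (fun v => \row_i G i v)); last exact: hc.
  by apply: row_continuous => i; case: (Gp i).
move=> a v a0; rewrite -hh//; congr h; apply/rowP => i; rewrite !mxE.
by case: (Gp i) => _ ->.
Qed.

(** Substituting homogeneous functions into a homogeneous function is again a calculus; by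
    uniqueness, iterated evaluations can be merged into one. *)
Lemma krivine_comp m (G : 'I_m -> 'rV[R]_n -> R) : (forall i, pos_homogeneous (G i)) ->
  krivine_calculus (fun i => tau (G i)) (fun h : 'rV[R]_m -> R => tau (fun v => h (\row_i G i v))).
Proof.
move=> Gp; split.
- by move=> i; congr tau; apply/funext => v; rewrite mxE.
- by move=> a g h gp hp; rewrite (krivine_linear tauP)//; exact: pos_homogeneous_comp.
- by move=> g h gp hp; rewrite (krivine_sup tauP)//; exact: pos_homogeneous_comp.
Qed.

End CalculusProperties.

(** * Existence and uniqueness of Krivine's calculus *)

Section Existence.
Variables (R : realType) (E : banachLatticeType R) (n : nat) (x : 'I_n -> E).
Implicit Types (g h : 'rV[R]_n -> R) (y z : E).

Lemma elementary_close g h y z (e : R) : 0 <= e -> elementary x g y -> elementary x h z ->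
  (forall v, `|g v - h v| <= e * norm1 v) -> `|y - z| <= e * \sum_i `|x i|.
Proof.
move=> e0 gy hz gh.
have le1 := elementary_le (elementary_abs (elementaryD gy (elementaryN hz)))
  (elementaryZ e (elementary_norm1 x)) gh.
apply: le_trans (norm_le_of_babs le1) _.
rewrite normrZ ger0_norm//; apply: ler_wpM2l => //; apply: le_trans (ler_norm_sum _ _ _) _.
by under eq_bigr do rewrite norm_babs.
Qed.

(** [y] is the limit of the values of elementary functions that converge to [h]. *)
Definition approximable h y := forall e : R, 0 < e -> exists g z,
  [/\ elementary x g z, forall v, `|g v - h v| <= e * norm1 v & `|z - y| <= e].

Lemma approximable_exists h : pos_homogeneous h -> exists y, approximable h y.
Proof.
move=> hp.
have /choice[gz gzP] : forall k : nat, exists gz : ('rV[R]_n -> R) * E,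
    elementary x gz.1 gz.2 /\ forall v, `|gz.1 v - h v| <= k.+1%:R^-1 * norm1 v.
  move=> k; have k0 : 0 < k.+1%:R^-1 :> R by rewrite invr_gt0.
  by have [g [z gz] gh] := elem_dense x hp k0; exists (g, z).
pose C := \sum_i `|x i|; have C0 : 0 <= C by apply: sumr_ge0.
have close k l : (k <= l)%N -> `|(gz k).2 - (gz l).2| <= 2 * k.+1%:R^-1 * C.
  move=> kl; have [ek hk] := gzP k; have [el hl] := gzP l.
  apply: (elementary_close _ ek el); first by rewrite mulr_ge0// invr_ge0.
  move=> v; rewrite -[(gz k).1 v](subrK (h v)) -addrA.
  apply: le_trans (ler_normD _ _) _; rewrite -mulrA mulrDl mul1r; apply: lerD => //.
  rewrite distrC; apply: le_trans (hl v) _; apply: ler_wpM2r; first exact: norm1_ge0.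
  by rewrite lef_pV2 ?posrE// ler_nat.
have small (e : R) : 0 < e -> exists k : nat, 2 * k.+1%:R^-1 * C < e /\ k.+1%:R^-1 <= e.
  move=> e0; pose M := Num.max (2 * C / e) (1 / e).
  exists (Num.truncn M); have := truncnS_gt M.
  set k := (Num.truncn M).+1; rewrite gt_max => /andP[h1 h2].
  have k0 : 0 < k%:R :> R by [].
  split; first by rewrite mulrAC ltr_pdivrMr// [e * _]mulrC -ltr_pdivrMr.
  by rewrite -[_^-1]mul1r ler_pdivrMr// [e * _]mulrC -ler_pdivrMr// ltW.
have : cauchy ((fun k => (gz k).2) @ \oo).
  apply: cauchy_exP => e e0; have [k [hk _]] := small e e0.
  exists (gz k).2; exists k => // l /= kl.
  by rewrite -ball_normE /=; apply: le_lt_trans hk; exact: close.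
move=> /cauchy_cvg /cvg_ex[y hy]; exists y => e e0.
have [k [_ hk]] := small e e0.
have /cvgrPdist_le /(_ e e0) [N _ hN] := hy.
exists (gz (maxn k N)).1, (gz (maxn k N)).2; have [el hl] := gzP (maxn k N); split=> //.
  move=> v; apply: le_trans (hl v) _; apply: ler_wpM2r; first exact: norm1_ge0.
  by apply: le_trans hk; rewrite lef_pV2 ?posrE// ler_nat ltnS leq_maxl.
by rewrite distrC; apply: hN; rewrite /= leq_maxr.
Qed.

Lemma le_eps_le0 (a C : R) : (forall e, 0 < e -> a <= e * C) -> a <= 0.
Proof.
move=> h; rewrite leNgt; apply/negP => a0.
have C0 : 0 < C by rewrite -[C]mul1r; apply: lt_le_trans a0 (h 1 _).
have := h (a / (2 * C)); rewrite divr_gt0 ?mulr_gt0// => /(_ isT).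
by rewrite invfM mulrA -[_ * C]mulrA mulVf ?gt_eqF// mulr1; lra.
Qed.

Lemma approximable_uniq h y y' : approximable h y -> approximable h y' -> y = y'.
Proof.
move=> hy hy'; apply/eqP; rewrite -subr_eq0 -normr_le0.
apply: (@le_eps_le0 _ (2 + 2 * \sum_i `|x i|)) => e e0.
have [g [z [gz gh zy]]] := hy e e0; have [g' [z' [gz' gh' zy']]] := hy' e e0.
have e2 : 0 <= 2 * e by rewrite mulr_ge0// ltW.
have hzz : `|z - z'| <= 2 * e * \sum_i `|x i|.
  apply: elementary_close e2 gz gz' _.
  move=> v; rewrite -[g v](subrK (h v)) -addrA.
  apply: le_trans (ler_normD _ _) _; rewrite -mulrA mulrDl mul1r; apply: lerD => //.
  by rewrite distrC.
have -> : y - y' = (y - z) + ((z - z') + (z' - y')) by rewrite !addrA !subrK.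
apply: le_trans (ler_normD _ _) _; rewrite distrC.
have := ler_normD (z - z') (z' - y'); lra.
Qed.

Lemma approximable_lin (a : R) g h y z : approximable g y -> approximable h z ->
  approximable (fun v => a * g v + h v) (a *: y + z).
Proof.
move=> gy hz e e0.
have a0 : 0 < `|a| + 1 by rewrite ltr_wpDl.
have d0 : 0 < e / (`|a| + 1) by rewrite divr_gt0.
have dE : `|a| * (e / (`|a| + 1)) + e / (`|a| + 1) = e.
  by rewrite -[X in _ + X]mul1r -mulrDl mulrC divfK// gt_eqF.
have [g' [y' [g1 g2 g3]]] := gy _ d0; have [h' [z' [h1 h2 h3]]] := hz _ d0.
exists (fun v => a * g' v + h' v), (a *: y' + z'); split.
- by apply: elementaryD => //; exact: elementaryZ.
- move=> v; have -> : a * g' v + h' v - (a * g v + h v) = a * (g' v - g v) + (h' v - h v) by ring.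
  apply: le_trans (ler_normD _ _) _; rewrite normrM -[X in _ <= X * _]dE mulrDl; apply: lerD => //.
  by rewrite -mulrA; apply: ler_wpM2l.
- have -> : a *: y' + z' - (a *: y + z) = a *: (y' - y) + (z' - z).
    by rewrite scalerBr opprD addrACA.
  apply: le_trans (ler_normD _ _) _; rewrite normrZ -[X in _ <= X]dE; apply: lerD => //.
  by apply: ler_wpM2l.
Qed.

Lemma approximable_max g h y z : approximable g y -> approximable h z ->
  approximable (fun v => Num.max (g v) (h v)) (bsup y z).
Proof.
move=> gy hz e e0; have d0 : 0 < e / 2 by rewrite divr_gt0.
have [g' [y' [g1 g2 g3]]] := gy _ d0; have [h' [z' [h1 h2 h3]]] := hz _ d0.
exists (fun v => Num.max (g' v) (h' v)), (bsup y' z'); split.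
- exact: elementary_max.
- move=> v; apply: le_trans (@norm_bsup_sub _ R^o (g' v) (h' v) (g v) (h v)) _.
  have -> : e * norm1 v = e / 2 * norm1 v + e / 2 * norm1 v by field.
  by apply: lerD.
- apply: le_trans (norm_bsup_sub _ _ _ _) _.
  by have := lerD g3 h3; rewrite -splitr.
Qed.

Lemma approximable_elementary g y : elementary x g y -> approximable g y.
Proof.
move=> gy e e0; exists g, y; split=> // [v|]; last by rewrite subrr normr0 ltW.
by rewrite subrr normr0 mulr_ge0 ?norm1_ge0// ltW.
Qed.

Definition kc h : E := xget 0 [set y | approximable h y].

Lemma kcP h : pos_homogeneous h -> approximable h (kc h).
Proof.
move=> /approximable_exists[y hy]; rewrite /kc.
exact: (@xgetPex _ 0 [set y | approximable h y] (ex_intro _ y hy)).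
Qed.

Lemma kc_eq h y : approximable h y -> kc h = y.
Proof.
move=> hy; apply: (@approximable_uniq h) => //.
exact: (@xgetPex _ 0 [set y | approximable h y] (ex_intro _ y hy)).
Qed.

(** The linear and lattice operations are continuous, so the limits of the elementary values inherit
    them. *)
Theorem krivine_kc : krivine_calculus x kc.
Proof.
split.
- by move=> i; apply: kc_eq; apply: approximable_elementary; exact: elementary_coord.
- by move=> a g h gp hp; apply: kc_eq; apply: approximable_lin; exact: kcP.
- by move=> g h gp hp; apply: kc_eq; apply: approximable_max; exact: kcP.
Qed.

(** Any calculus agrees with [kc] on elementary functions, and both are continuous. *)
Theorem krivine_unique tau h : krivine_calculus x tau -> pos_homogeneous h ->
  tau h = kc h.
Proof.
move=> tauP hp; symmetry; apply: kc_eq => e e0.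
have C0 : 0 <= \sum_i `|x i| by apply: sumr_ge0.
have C1 : 0 < \sum_i `|x i| + 1 by rewrite ltr_wpDl.
pose d := e / (\sum_i `|x i| + 1).
have d0 : 0 < d by rewrite divr_gt0.
have de : d <= e by rewrite /d ler_pdivrMr// ler_pMr// lerDr.
have [g [z gz] gh] := elem_dense x hp d0.
exists g, z; split=> // [v|].
  by apply: le_trans (gh v) _; apply: ler_wpM2r => //; exact: norm1_ge0.
rewrite -(krivine_elementary tauP gz).
apply: le_trans (krivine_close tauP (elementary_poshom gz) hp (ltW d0) gh) _.
by rewrite /d -mulrA ler_piMr ?(ltW e0)// mulrC ler_pdivrMr// mul1r lerDl.
Qed.

End Existence.

(** * Inequalities for real powers *)

Section RealPowers.
Variable R : realType.
Implicit Types (a b p t : R).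

Lemma powR_root p a : 0 < p -> 0 <= a -> (a `^ p) `^ p^-1 = a.
Proof. by move=> p0 a0; rewrite -powRrM divff ?gt_eqF// powRr1. Qed.

Lemma root_powR p a : 0 < p -> 0 <= a -> (a `^ p^-1) `^ p = a.
Proof. by move=> p0 a0; rewrite -powRrM mulVf ?gt_eqF// powRr1. Qed.

Lemma le_powR p a b : 0 < p -> 0 <= a -> a <= b -> a `^ p <= b `^ p.
Proof.
move=> p0 a0 ab; apply: ge0_ler_powR; rewrite ?nnegrE//; first exact: ltW.
exact: le_trans ab.
Qed.

Lemma le_powR_inv p a b : 0 < p -> 0 <= b -> a `^ p <= b `^ p -> a <= b.
Proof.
move=> p0 b0 h; rewrite leNgt; apply/negP => ba; move: h; rewrite leNgt => /negP; apply.
by apply: gt0_ltr_powR; rewrite ?nnegrE// (le_trans b0)// ltW.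
Qed.

Lemma abs_powR_continuous p : 0 < p -> continuous (fun a : R => `|a| `^ p).
Proof.
move=> p0 a; have [->|a0] := eqVneq a 0.
  apply/cvgrPdist_lt => e e0; rewrite normr0 powR0 ?gt_eqF//.
  have d0 : 0 < e `^ p^-1 by rewrite powR_gt0.
  have := @nbhs0_lt _ R _ d0; apply: filterS => b hb; rewrite sub0r normrN.
  rewrite ger0_norm ?powR_ge0// -[X in _ < X](root_powR p0 (ltW e0)).
  by apply: gt0_ltr_powR; rewrite ?nnegrE// powR_ge0.
have na : 0 < `|a| by rewrite normr_gt0.
have near0 : \forall b \near a, 0 < `|b|.
  exact: (cvgr_gt _ (@norm_continuous _ R a) _ na).
rewrite /continuous_at.
suff : expR (p * ln `|b|) @[b --> a] --> `|a| `^ p.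
  apply: cvg_trans; apply: near_eq_cvg; apply: filterS near0 => b b0.
  by rewrite /powR gt_eqF.
rewrite /powR gt_eqF//; apply: continuous_cvg; first exact: continuous_expR.
apply: cvgM; first exact: cvg_cst.
exact: (@cvg_comp _ _ _ (fun b : R => `|b|) (@ln R) _ _ _ (@norm_continuous _ R a) (continuous_ln na)).
Qed.

(** Convexity of the [t]-th power at the points [a / l] and [b / (1 - l)]. *)
Lemma powRD_split t l a b : 1 <= t -> 0 < l -> l < 1 -> 0 <= a -> 0 <= b ->
  (a + b) `^ t <= l `^ (1 - t) * a `^ t + (1 - l) `^ (1 - t) * b `^ t.
Proof.
move=> t1 l0 l1 a0 b0.
have l'0 : 0 < 1 - l by rewrite subr_gt0.
have t0 : 0 < t by exact: lt_le_trans t1.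
have h1l : 0 <= l by exact: ltW.
have h2l : l <= 1 by exact: ltW.
have wE (w c : R) : 0 < w -> 0 <= c -> w `^ (1 - t) * c `^ t = w * (c / w) `^ t.
  move=> w0 c0; rewrite powRM// ?invr_ge0 ?ltW// powRB; last by rewrite (gt_eqF w0) implybT.
  by rewrite powRr1 ?ltW// -[w^-1]powR_inv1 ?ltW// -powRrM mulN1r powRN; ring.
rewrite !wE//.
have := @convex_powR R t t1 (Itv01 h1l h2l) (a / l) (b / (1 - l)).
have al : 0 <= a / l by rewrite divr_ge0// ltW.
have bl : 0 <= b / (1 - l) by rewrite divr_ge0// ltW.
rewrite !inE /= !in_itv /= !andbT => /(_ al bl).
rewrite !convRE /= => h; apply: le_trans h.
rewrite le_eqVlt; apply/orP; left; apply/eqP; congr (_ `^ t).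
transitivity (l * (a / l) + (1 - l) * (b / (1 - l))); last by [].
by rewrite mulrC divfK ?gt_eqF// [(1 - l) * _]mulrC divfK ?gt_eqF.
Qed.

Lemma sum_powR_eq0 (I : eqType) (r : seq I) (f : I -> R) t i : 0 < t ->
  (forall i, 0 <= f i) -> \sum_(i <- r) f i `^ t = 0 -> i \in r -> f i = 0.
Proof.
move=> t0 f0 /eqP; rewrite psumr_eq0; last by move=> *; exact: powR_ge0.
by move=> /allP h ir; have := h i ir; rewrite powR_eq0 => /andP[/eqP].
Qed.

(** The weights [l = a / (a + b)] are the ones for which the convexity bound is sharp, so Minkowski
    follows term by term. *)
Lemma minkowski_seq_aux (I : Type) (r : seq I) (f g : I -> R) t a b : 1 <= t ->
  (forall i, 0 <= f i) -> (forall i, 0 <= g i) -> 0 < a -> 0 < b ->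
  \sum_(i <- r) f i `^ t <= a `^ t -> \sum_(i <- r) g i `^ t <= b `^ t ->
  \sum_(i <- r) (f i + g i) `^ t <= (a + b) `^ t.
Proof.
move=> t1 f0 g0 a0 b0 fa gb.
have ab0 : 0 < a + b by rewrite addr_gt0.
have l0 : 0 < a / (a + b) by rewrite divr_gt0.
have l1 : a / (a + b) < 1 by rewrite ltr_pdivrMr// mul1r ltrDl.
have l'E : 1 - a / (a + b) = b / (a + b) by field; rewrite gt_eqF.
apply: le_trans (_ : \sum_(i <- r) ((a / (a + b)) `^ (1 - t) * f i `^ t +
   (1 - a / (a + b)) `^ (1 - t) * g i `^ t) <= _).
  by apply: ler_sum => i _; exact: powRD_split.
rewrite big_split /= -!mulr_sumr l'E.
have cE (c : R) : 0 < c -> (c / (a + b)) `^ (1 - t) * c `^ t = c * (a + b) `^ (t - 1).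
  move=> c0; rewrite powRM ?invr_ge0 ?(ltW c0) ?(ltW ab0)//.
  rewrite -[(a + b)^-1]powR_inv1 ?(ltW ab0)// -powRrM mulN1r opprB.
  rewrite mulrAC -powRD; last by rewrite subrK oner_eq0.
  by rewrite subrK powRr1// ltW.
rewrite -(mulr_powRB1 (ltW ab0) (lt_le_trans ltr01 t1)) mulrDl -(cE a a0) -(cE b b0).
by apply: lerD; apply: ler_wpM2l => //; exact: powR_ge0.
Qed.

Lemma minkowski_seq (I : eqType) (r : seq I) (f g : I -> R) t : 1 <= t ->
  (forall i, 0 <= f i) -> (forall i, 0 <= g i) ->
  \sum_(i <- r) (f i + g i) `^ t <=
  ((\sum_(i <- r) f i `^ t) `^ t^-1 + (\sum_(i <- r) g i `^ t) `^ t^-1) `^ t.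
Proof.
move=> t1 f0 g0; have t0 : 0 < t by exact: lt_le_trans t1.
set A := \sum_(i <- r) f i `^ t; set B := \sum_(i <- r) g i `^ t.
have A0 : 0 <= A by apply: sumr_ge0 => *; exact: powR_ge0.
have B0 : 0 <= B by apply: sumr_ge0 => *; exact: powR_ge0.
have ti : t^-1 != 0 by rewrite invr_eq0 gt_eqF.
have [A00|An] := eqVneq A 0.
  rewrite A00 powR0// add0r root_powR// le_eqVlt; apply/orP; left; apply/eqP.
  apply: eq_big_seq => i ir.
  by rewrite (@sum_powR_eq0 _ r f t)// add0r.
have [B00|Bn] := eqVneq B 0.
  rewrite B00 powR0// addr0 root_powR// le_eqVlt; apply/orP; left; apply/eqP.
  apply: eq_big_seq => i ir.
  by rewrite (@sum_powR_eq0 _ r g t)// addr0.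
have Ap : 0 < A by rewrite lt_neqAle eq_sym An.
have Bp : 0 < B by rewrite lt_neqAle eq_sym Bn.
apply: minkowski_seq_aux; rewrite ?powR_gt0 ?root_powR//.
Qed.

Lemma hoelder_seq (I : Type) (r : seq I) (l a : I -> R) (h : R) : 0 < h -> h < 1 ->
  (forall i, 0 <= l i) -> (forall i, 0 <= a i) ->
  \sum_(i <- r) l i `^ (1 - h) * a i `^ h <=
  (\sum_(i <- r) l i) `^ (1 - h) * (\sum_(i <- r) a i) `^ h.
Proof.
move=> h0 h1 l0 a0; have h'0 : 0 < 1 - h by rewrite subr_gt0.
elim: r => [|i r IH]; first by rewrite !big_nil !powR0 ?gt_eqF// mul0r.
rewrite !big_cons; apply: le_trans (lerD (lexx _) IH) _.
set L := \sum_(j <- r) l j; set A := \sum_(j <- r) a j.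
have L0 : 0 <= L by apply: sumr_ge0.
have A0 : 0 <= A by apply: sumr_ge0.
have := @hoelder2 R (l i `^ (1 - h)) (L `^ (1 - h)) (a i `^ h) (A `^ h)
   (1 - h)^-1 h^-1; rewrite !powR_ge0 !invr_gt0 !invrK subrK => /(_ isT isT isT isT h'0 h0 erefl).
by rewrite -!powRrM !divff ?gt_eqF// !powRr1// addr_ge0.
Qed.

End RealPowers.

(** Sums of powers are locked: otherwise comparing two of them by conversion unfolds the
    exponential function. *)
Fact lp_key : unit. Proof. exact: tt. Qed.

Definition lp_seq := locked_with lp_key
  (fun (R : realType) (I : Type) (p : R) (r : seq I) (f : I -> R) =>
    (\sum_(i <- r) `|f i| `^ p) `^ p^-1 : R).

Definition lp2 := locked_with lp_key
  (fun (R : realType) (p a b : R) => (`|a| `^ p + `|b| `^ p) `^ p^-1 : R).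

(** * Sums of p-th powers in the lattice *)

Section LpSums.
Variables (R : realType).
Implicit Types (p q : R).

Lemma lp_seqE (I : Type) p (r : seq I) (f : I -> R) :
  lp_seq p r f = (\sum_(i <- r) `|f i| `^ p) `^ p^-1.
Proof. by rewrite /lp_seq unlock. Qed.

Lemma lp2E p (a b : R) : lp2 p a b = (`|a| `^ p + `|b| `^ p) `^ p^-1.
Proof. by rewrite /lp2 unlock. Qed.

Lemma lp_seq_ge0 I p (r : seq I) f : 0 <= lp_seq p r f.
Proof. by rewrite lp_seqE powR_ge0. Qed.

Lemma lp_seq_nil I p (f : I -> R) : 0 < p -> lp_seq p [::] f = 0.
Proof. by move=> p0; rewrite lp_seqE big_nil powR0// invr_eq0 gt_eqF. Qed.

Lemma sum_powR_ge0 I p (r : seq I) (f : I -> R) : 0 <= \sum_(i <- r) f i `^ p.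
Proof. by apply: sumr_ge0 => i _; exact: powR_ge0. Qed.

Lemma lp_seq_pow I p (r : seq I) f : 0 < p ->
  lp_seq p r f `^ p = \sum_(i <- r) `|f i| `^ p.
Proof. by move=> p0; rewrite lp_seqE (root_powR p0)//; exact: sum_powR_ge0. Qed.

Lemma lp2_pow p a b : 0 < p -> lp2 p a b `^ p = `|a| `^ p + `|b| `^ p.
Proof.
by move=> p0; rewrite lp2E (root_powR p0)//; apply: addr_ge0; exact: powR_ge0.
Qed.

Lemma lp_seq_cons I p i (r : seq I) f : 0 < p ->
  lp_seq p (i :: r) f = lp2 p (f i) (lp_seq p r f).
Proof.
move=> p0; rewrite lp2E (ger0_norm (lp_seq_ge0 p r f)) lp_seq_pow//.
by rewrite lp_seqE big_cons.
Qed.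

Lemma le_lp_seq I p (r : seq I) (f g : I -> R) : 0 < p ->
  (forall i, `|f i| <= `|g i|) -> lp_seq p r f <= lp_seq p r g.
Proof.
move=> p0 fg; rewrite !lp_seqE; apply: le_powR; rewrite ?invr_gt0 ?sum_powR_ge0//.
by apply: ler_sum => i _; apply: le_powR.
Qed.

Lemma lp2_ge0 p a b : 0 <= lp2 p a b. Proof. by rewrite lp2E powR_ge0. Qed.

Lemma le_lp2 p a b c d : 0 < p -> `|a| <= `|c| -> `|b| <= `|d| -> lp2 p a b <= lp2 p c d.
Proof.
move=> p0 ac bd; rewrite !lp2E; apply: le_powR; rewrite ?invr_gt0 ?addr_ge0 ?powR_ge0//.
by apply: lerD; apply: le_powR.
Qed.

Lemma lp2_gel p a b : 0 < p -> `|a| <= lp2 p a b.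
Proof.
move=> p0; rewrite lp2E -[X in X <= _](powR_root p0)//; apply: le_powR.
- by rewrite invr_gt0.
- exact: powR_ge0.
- by rewrite lerDl powR_ge0.
Qed.

Lemma lp2_ger p a b : 0 < p -> `|b| <= lp2 p a b.
Proof. by move=> p0; rewrite lp2E addrC -lp2E; exact: lp2_gel. Qed.

Lemma lp2_0r p a : 0 < p -> lp2 p a 0 = `|a|.
Proof. by move=> p0; rewrite !lp2E normr0 powR0 ?gt_eqF// addr0 powR_root. Qed.

Lemma lp2_0l p a : 0 < p -> lp2 p 0 a = `|a|.
Proof. by move=> p0; rewrite lp2E addrC -lp2E; exact: lp2_0r. Qed.

Lemma lp2_abs p a b : lp2 p `|a| `|b| = lp2 p a b.
Proof. by rewrite !lp2E !normr_id. Qed.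

Lemma lp2A p a b c : 0 < p -> lp2 p a (lp2 p b c) = lp2 p (lp2 p a b) c.
Proof.
move=> p0; rewrite [LHS]lp2E [RHS]lp2E; apply: (congr1 (@powR R ^~ p^-1)).
by rewrite (ger0_norm (lp2_ge0 p b c)) (ger0_norm (lp2_ge0 p a b)) !lp2_pow// addrA.
Qed.

Lemma lp2_scale p a b c : 0 < p -> 0 <= c -> lp2 p (c * a) (c * b) = c * lp2 p a b.
Proof.
move=> p0 c0; rewrite !lp2E !normrM (ger0_norm c0).
rewrite (powRM p c0 (normr_ge0 a)) (powRM p c0 (normr_ge0 b)) -mulrDr.
rewrite powRM; [|exact: powR_ge0|by apply: addr_ge0; exact: powR_ge0].
by rewrite (powR_root p0 c0).
Qed.

Lemma lp_seq_scale I p (r : seq I) f c : 0 < p -> 0 <= c ->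
  lp_seq p r (fun i => c * f i) = c * lp_seq p r f.
Proof.
move=> p0 c0; rewrite !lp_seqE.
under eq_bigr do rewrite normrM (powRM p (normr_ge0 c) (normr_ge0 _)).
rewrite -mulr_sumr powRM; [|exact: powR_ge0|exact: sum_powR_ge0].
by rewrite (ger0_norm c0) (powR_root p0 c0).
Qed.

Section PosHom.
Variable n : nat.
Implicit Types (F G : 'rV[R]_n -> R).

Lemma abs_powR_poscont p F : 0 < p -> continuous F -> continuous (fun v => `|F v| `^ p).
Proof.
move=> p0 Fc v.
exact: (@continuous_comp _ _ _ F (fun a : R => `|a| `^ p) v (Fc v) (@abs_powR_continuous R p p0 _)).
Qed.

Lemma pos_homogeneous_lp2 p F G : 0 < p -> pos_homogeneous F -> pos_homogeneous G ->
  pos_homogeneous (fun v => lp2 p (F v) (G v)).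
Proof.
move=> p0 [Fc Fh] [Gc Gh]; split; last first.
  by move=> a v a0; rewrite Fh// Gh// lp2_scale.
have p'0 : 0 < p^-1 by rewrite invr_gt0.
have c1 := abs_powR_poscont p0 Fc; have c2 := abs_powR_poscont p0 Gc.
have c3 := @continuous_lin _ _ 1 _ _ c1 c2.
suff -> : (fun v => lp2 p (F v) (G v)) =
    (fun v => `|1 * `|F v| `^ p + `|G v| `^ p| `^ p^-1) by exact: abs_powR_poscont c3.
apply/funext => v; by rewrite lp2E mul1r [in RHS]ger0_norm.
Qed.

Lemma pos_homogeneous_lp_seq (I : Type) p (r : seq I) (F : I -> 'rV[R]_n -> R) : 0 < p ->
  (forall i, pos_homogeneous (F i)) -> pos_homogeneous (fun v => lp_seq p r (F^~ v)).
Proof.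
move=> p0 Fh; elim: r => [|i r IH].
  by under eq_fun do rewrite lp_seq_nil//; exact: pos_homogeneous0.
under eq_fun do rewrite lp_seq_cons//; exact: pos_homogeneous_lp2.
Qed.

End PosHom.
End LpSums.

Section LatticeLpSums.
Variables (R : realType) (E : banachLatticeType R).
Implicit Types (p q : R) (a b c : E) (s t : seq E).

Lemma kc_sub n m (x : 'I_n -> E) (G : 'I_m -> 'rV[R]_n -> R) (h : 'rV[R]_m -> R) :
  (forall i, pos_homogeneous (G i)) -> pos_homogeneous h ->
  kc (fun i => kc x (G i)) h = kc x (fun v => h (\row_i G i v)).
Proof.
move=> Gh hh; symmetry.
exact: (krivine_unique (krivine_comp (krivine_kc x) Gh) hh).
Qed.

Definition base s : 'I_(size s) -> E := fun i => nth 0 s i.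
Arguments base s _ : clear implicits.

(** The [k]-th coordinate with a natural number as index, zero out of range like [nth]. *)
Definition co n (k : nat) (v : 'rV[R]_n) : R := oapp (v ord0) 0 (insub k).

Lemma pos_homogeneous_co n k : pos_homogeneous (@co n k).
Proof.
rewrite /co; case: (insub k : option 'I_n) => [i|] /=.
  exact: pos_homogeneous_coord.
exact: pos_homogeneous0.
Qed.

Lemma kc_co s k : kc (base s) (co k) = nth 0 s k.
Proof.
rewrite /co; case: insubP => [i _ ik|/=]; rewrite /oapp.
  by rewrite (krivine_coord (krivine_kc _)) /base ik.
by rewrite -leqNgt => /(nth_default 0)->; exact: krivine0 (krivine_kc _).
Qed.

(** The lattice analogue of [(|a|^p + |b|^p)^(1/p)].  Working with a binary operation and folding it
    over a list avoids one calculus per family: by [pl_kc] the result is the value of the expected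
    function in any calculus that contains the elements. *)
Definition pl p a b : E := kc (base [:: a; b]) (fun v => lp2 p (co 0 v) (co 1 v)).

Definition lps p s : E := foldr (pl p) 0 s.

Section Base.
Variables (n : nat) (x : 'I_n -> E).
Implicit Types F G : 'rV[R]_n -> R.
Let kx := krivine_kc x.

Lemma pl_kc p F G : 0 < p -> pos_homogeneous F -> pos_homogeneous G ->
  pl p (kc x F) (kc x G) = kc x (fun v => lp2 p (F v) (G v)).
Proof.
move=> p0 Fh Gh; pose H (i : 'I_2) := if i == ord0 then F else G.
have Hh i : pos_homogeneous (H i) by rewrite /H; case: ifP.
have -> : pl p (kc x F) (kc x G) = kc (fun i => kc x (H i)) (fun v => lp2 p (co 0 v) (co 1 v)).
  rewrite /pl; congr (kc _ _); apply/funext => -[[|[|//]] i2]; rewrite /base /= /H /=; congr kc.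
rewrite kc_sub//; last by apply: pos_homogeneous_lp2 => //; exact: pos_homogeneous_co.
congr kc; apply/funext => v; congr lp2; rewrite /co.
  by case: insubP => //= -[[|//] ?] _ _; rewrite mxE.
by case: insubP => //= -[[|[|//]] ?] _ //=; rewrite mxE.
Qed.

Lemma lps_kc (I : Type) p (r : seq I) (F : I -> 'rV[R]_n -> R) : 0 < p ->
  (forall i, pos_homogeneous (F i)) ->
  lps p [seq kc x (F i) | i <- r] = kc x (fun v => lp_seq p r (F^~ v)).
Proof.
move=> p0 Fh; elim: r => [|i r IH] /=.
  rewrite -(krivine0 kx); congr kc; apply/funext => v.
  by rewrite lp_seq_nil.
rewrite IH pl_kc//; last exact: pos_homogeneous_lp_seq.
by congr kc; apply/funext => v; rewrite lp_seq_cons.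
Qed.

Lemma lps_is_lp_sum m p (F : 'I_m -> 'rV[R]_n -> R) : 0 < p ->
  (forall i, pos_homogeneous (F i)) ->
  is_lp_sum p (fun i => kc x (F i)) (lps p [seq kc x (F i) | i <- index_enum 'I_m]).
Proof.
move=> p0 Fh; exists (kc (fun i => kc x (F i))); first exact: krivine_kc.
have -> : (fun v : 'rV[R]_m => (\sum_(i < m) `|v ord0 i| `^ p) `^ p^-1) =
    (fun v => lp_seq p (index_enum 'I_m) (fun i => v ord0 i)).
  by apply/funext => v; rewrite lp_seqE.
rewrite lps_kc// kc_sub//; last first.
  by apply: (@pos_homogeneous_lp_seq _ _ _ _ _ (fun i v => v ord0 i)) => // i; exact: pos_homogeneous_coord.
congr kc; apply/funext => v; congr lp_seq.
by apply/funext => i; rewrite mxE.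
Qed.

(** The calculus only sees functions modulo its kernel.  An inequality assumed between elements
    of the lattice, rather than between functions, is used by adding to one side the positive part of
    the difference, which lies in the kernel by [kc_pos_part]. *)
Lemma kc_le_mod F G W : pos_homogeneous F -> pos_homogeneous G -> pos_homogeneous W ->
  kc x W = 0 -> (forall v, F v <= G v + W v) -> ble (kc x F) (kc x G).
Proof.
move=> Fh Gh Wh W0 FG; rewrite -[kc x G]addr0 -W0 -(krivineD kx)//.
by apply: (krivine_le kx) => //; exact: pos_homogeneousD.
Qed.

Lemma kc_pos_part F G : pos_homogeneous F -> pos_homogeneous G ->
  ble (kc x F) (kc x G) -> kc x (fun v => Num.max (F v - G v) 0) = 0.
Proof.
move=> Fh Gh FG; rewrite (krivine_sup kx); last exact: pos_homogeneous0.
  rewrite (krivineD kx)//; last exact: pos_homogeneousN.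
  rewrite (krivineN kx)// (krivine0 kx); apply: ble_antisym; last exact: ble_supr.
  by apply: bsup_le; [rewrite -ble_sub0|exact: ble_refl].
by apply: pos_homogeneousD => //; exact: pos_homogeneousN.
Qed.

End Base.

Lemma pos_homogeneous_pos n (F G : 'rV[R]_n -> R) : pos_homogeneous F -> pos_homogeneous G ->
  pos_homogeneous (fun v => Num.max (F v - G v) 0).
Proof.
move=> Fh Gh; apply: pos_homogeneous_max; last exact: pos_homogeneous0.
by apply: pos_homogeneousD => //; exact: pos_homogeneousN.
Qed.

Lemma binf_kc n (x : 'I_n -> E) (F G : 'rV[R]_n -> R) :
  pos_homogeneous F -> pos_homogeneous G -> ble (kc x F) (kc x G) ->
  kc x (fun v => Num.min (F v) (G v)) = kc x F.
Proof.
move=> Fh Gh FG; have kx := krivine_kc x.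
have Wh := pos_homogeneous_pos Fh Gh.
have -> : (fun v => Num.min (F v) (G v)) = (fun v => F v - Num.max (F v - G v) 0).
  by apply/funext => v; case: (lerP (F v) (G v)) => h; [rewrite max_r|rewrite max_l]; lra.
rewrite (krivineD kx)//; last exact: pos_homogeneousN.
by rewrite (krivineN kx)// kc_pos_part// subr0.
Qed.

Lemma pos_homogeneous_min n (F G : 'rV[R]_n -> R) : pos_homogeneous F -> pos_homogeneous G ->
  pos_homogeneous (fun v => Num.min (F v) (G v)).
Proof.
move=> Fh Gh.
have -> : (fun v => Num.min (F v) (G v)) = (fun v => F v - Num.max (F v - G v) 0).
  by apply/funext => v; case: (lerP (F v) (G v)) => h; [rewrite max_r|rewrite max_l]; lra.
by apply: pos_homogeneousD => //; apply: pos_homogeneousN; exact: pos_homogeneous_pos.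
Qed.

Ltac poshom := repeat first [ assumption | exact: pos_homogeneous_co | exact: pos_homogeneous0
  | apply: pos_homogeneous_abs | apply: pos_homogeneous_lp2 | apply: pos_homogeneous_min
  | apply: pos_homogeneous_pos ].

Lemma kc_abs n (x : 'I_n -> E) F : pos_homogeneous F -> kc x (fun v => `|F v|) = babs (kc x F).
Proof. exact: krivine_abs (krivine_kc x) _. Qed.

Lemma pl_mono p a b c d : 0 < p -> ble (babs a) (babs c) -> ble (babs b) (babs d) ->
  ble (pl p a b) (pl p c d).
Proof.
move=> p0 ac bd; pose x := base [:: a; b; c; d].
have kx := krivine_kc x.
pose A := @co (size [:: a; b; c; d]) 0; pose B := @co (size [:: a; b; c; d]) 1.
pose C := @co (size [:: a; b; c; d]) 2; pose D := @co (size [:: a; b; c; d]) 3.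
have hA : pos_homogeneous A by poshom.
have hB : pos_homogeneous B by poshom.
have hC : pos_homogeneous C by poshom.
have hD : pos_homogeneous D by poshom.
have eA : kc x A = a by rewrite kc_co.
have eB : kc x B = b by rewrite kc_co.
have eC : kc x C = c by rewrite kc_co.
have eD : kc x D = d by rewrite kc_co.
have iA : kc x (fun v => Num.min `|A v| `|C v|) = kc x (fun v => `|A v|).
  by apply: binf_kc; rewrite ?kc_abs ?eA ?eC//; poshom.
have iB : kc x (fun v => Num.min `|B v| `|D v|) = kc x (fun v => `|B v|).
  by apply: binf_kc; rewrite ?kc_abs ?eB ?eD//; poshom.
have -> : pl p a b = pl p (kc x (fun v => Num.min `|A v| `|C v|)) (kc x (fun v => Num.min `|B v| `|D v|)).
  rewrite iA iB -eA -eB !pl_kc//; poshom.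
  by congr kc; apply/funext => v; rewrite lp2_abs.
rewrite -eC -eD !pl_kc//; poshom; apply: (krivine_le kx); poshom => // v.
have mn (s t : R) : `|Num.min `|s| `|t| | <= `|t|.
  by rewrite ger0_norm ?ge_min ?lexx ?orbT// le_min !normr_ge0.
by apply: le_lp2.
Qed.

Lemma pl_0r p a : 0 < p -> pl p a 0 = babs a.
Proof.
move=> p0; pose x := base [:: a].
have eA : kc x (co 0) = a by rewrite kc_co.
rewrite -eA -(krivine0 (krivine_kc x)) pl_kc//; poshom.
by rewrite -kc_abs; poshom; congr kc; apply/funext => v; rewrite lp2_0r.
Qed.

Lemma pl_0l p a : 0 < p -> pl p 0 a = babs a.
Proof.
move=> p0; pose x := base [:: a].
have eA : kc x (co 0) = a by rewrite kc_co.
rewrite -eA -(krivine0 (krivine_kc x)) pl_kc//; poshom.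
by rewrite -kc_abs; poshom; congr kc; apply/funext => v; rewrite lp2_0l.
Qed.

Lemma pl_ge0 p a b : 0 < p -> ble 0 (pl p a b).
Proof.
move=> p0; rewrite /pl -(krivine0 (krivine_kc (base [:: a; b]))).
by apply: (krivine_le (krivine_kc _)); poshom => // v; exact: lp2_ge0.
Qed.

Lemma plA p a b c : 0 < p -> pl p a (pl p b c) = pl p (pl p a b) c.
Proof.
move=> p0; pose x := base [:: a; b; c].
have eA : kc x (co 0) = a by rewrite kc_co.
have eB : kc x (co 1) = b by rewrite kc_co.
have eC : kc x (co 2) = c by rewrite kc_co.
rewrite -{}eA -{}eB -{}eC !pl_kc//; poshom => //.
by congr kc; apply/funext => v; rewrite lp2A.
Qed.

Lemma pl_scale p (k : R) a b : 0 < p -> 0 <= k -> pl p (k *: a) (k *: b) = k *: pl p a b.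
Proof.
move=> p0 k0; pose x := base [:: a; b]; have kx := krivine_kc x.
have eA : kc x (co 0) = a by rewrite kc_co.
have eB : kc x (co 1) = b by rewrite kc_co.
rewrite -{}eA -{}eB -!(krivineZ kx); poshom.
rewrite !pl_kc//; poshom; try by apply: pos_homogeneousZ; poshom.
rewrite -(krivineZ kx); poshom => //.
by congr kc; apply/funext => v; rewrite lp2_scale.
Qed.

Lemma lps_ge0 p s : 0 < p -> ble 0 (lps p s).
Proof. by move=> p0; case: s => [|a s] /=; [exact: ble_refl|exact: pl_ge0]. Qed.

Lemma babs_lps p s : 0 < p -> babs (lps p s) = lps p s.
Proof. by move=> p0; apply: babs_id; exact: lps_ge0. Qed.

Lemma lps_cat p s t : 0 < p -> lps p (s ++ t) = pl p (lps p s) (lps p t).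
Proof.
move=> p0; elim: s => [|a s IH] /=; first by rewrite pl_0l// babs_lps.
by rewrite IH plA.
Qed.

Lemma lps_scale p (k : R) s : 0 < p -> 0 <= k -> lps p [seq k *: a | a <- s] = k *: lps p s.
Proof.
by move=> p0 k0; elim: s => [|a s IH] /=; rewrite ?scaler0// IH pl_scale.
Qed.

Lemma lps1 p a : 0 < p -> lps p [:: a] = babs a.
Proof. exact: pl_0r. Qed.

Lemma lps_mem p s a : 0 < p -> a \in s -> ble (babs a) (lps p s).
Proof.
move=> p0; elim: s => // b s IH; rewrite inE => /predU1P[->|/IH h] /=.
  rewrite -(pl_0r b p0); apply: pl_mono => //; first exact: ble_refl.
  by rewrite babs_id; [exact: babs_ge0|exact: ble_refl].
apply: ble_tr h _; rewrite -[X in ble X _](babs_lps _ p0) -(pl_0l _ p0).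
apply: pl_mono => //; last exact: ble_refl.
by rewrite babs_id; [exact: babs_ge0|exact: ble_refl].
Qed.

Lemma lps_neq0 p s : 0 < p -> lps p [seq a <- s | a != 0] = lps p s.
Proof.
move=> p0; elim: s => //= a s <-; case: eqP => //= ->.
by rewrite pl_0l// babs_lps.
Qed.

Lemma lps_base p (s : seq E) : 0 < p ->
  lps p s = lps p [seq kc (base s) (co i) | i <- iota 0 (size s)].
Proof.
move=> p0; congr lps; apply: (@eq_from_nth _ 0); first by rewrite size_map size_iota.
move=> i si.
by rewrite (nth_map 0%N) ?size_iota// nth_iota// add0n kc_co.
Qed.

(** Links the fold to the sums in the definition of Krivine types. *)
Lemma lps_is_lp_sum_seq p s : 0 < p -> is_lp_sum p (base s) (lps p s).
Proof.
move=> p0.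
have -> : lps p s = lps p [seq kc (base s) (fun v => v ord0 i) | i <- index_enum 'I_(size s)].
  rewrite {1}lps_base// -val_enum_ord -map_comp; congr lps.
  rewrite /index_enum -enumT; apply: eq_map => i /=.
  by rewrite kc_co (krivine_coord (krivine_kc _)).
have := lps_is_lp_sum (base s) p0 (fun i : 'I_(size s) => pos_homogeneous_coord R i).
by congr (is_lp_sum _ _ _); apply/funext => i; rewrite (krivine_coord (krivine_kc _)).
Qed.

End LatticeLpSums.
Arguments base {R E} s _.

(** * Splitting a dominated family *)

Section Splitting.
Variables (R : realType).

(** [M * A / Z] is continuous also where [Z] vanishes, since it is dominated by [M]. *)
Lemma pos_homogeneous_ratio n (M A Z : 'rV[R]_n -> R) :
  pos_homogeneous M -> pos_homogeneous A -> pos_homogeneous Z ->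
  (forall v, 0 <= M v <= Z v) -> (forall v, 0 <= A v <= Z v) ->
  pos_homogeneous (fun v => M v * (A v / Z v)).
Proof.
move=> [Mc Mh] [Ac Ah] [Zc Zh] MZ AZ; split; last first.
  move=> a v a0; rewrite Mh// Ah// Zh//.
  have [->|an] := eqVneq a 0; first by rewrite !mul0r.
  have [Z0|Z0] := eqVneq (Z v) 0; last by field; rewrite Z0.
  by rewrite Z0 !(mulr0, invr0).
move=> v; have [Z0|Z0] := eqVneq (Z v) 0; last first.
  apply: (@continuousM _ _ M (fun v => A v / Z v)); first exact: Mc.
  apply: (@continuousM _ _ A (fun v => (Z v)^-1)); first exact: Ac.
  by apply: (@continuousV _ _ Z) => //; exact: Zc.
have M0 : M v = 0 by apply/eqP; rewrite eq_le; have := MZ v; rewrite Z0 => /andP[-> ->].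
rewrite /continuous_at M0 mul0r; apply/(@cvgrPdist_lt _ _ _ _ (nbhs_filter (v : 'rV[R]_n))) => e e0.
have := Mc v; rewrite /continuous_at M0 => /(@cvgrPdist_lt _ _ _ _ (nbhs_filter (v : 'rV[R]_n)))/(_ _ e0).
apply: filterS => w; rewrite !sub0r !normrN => hw; apply: le_lt_trans hw.
have /andP[m0 mz] := MZ w; have /andP[a0 az] := AZ w.
have z0 : 0 <= Z w by exact: le_trans mz.
have r0 : 0 <= A w / Z w by rewrite divr_ge0.
rewrite normrM ler_piMr// ger0_norm//.
have [->|zn] := eqVneq (Z w) 0; first by rewrite invr0 mulr0.
by rewrite ler_pdivrMr ?mul1r// lt_neqAle eq_sym zn.
Qed.

Variable (E : banachLatticeType R).
Implicit Types (s : seq E) (u v w : E).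

(** A Riesz decomposition for power sums.  If the [q]-sum of the [s_i] is below the [p]-sum [Z] of
    [u] and [v], put [M_i = min |s_i| Z]; the parts [M_i |u| / Z] and [M_i |v| / Z] have [p]-sum
    [M_i], while their [q]-sums over [i] are at most [|u|] and [|v|].  The minimum changes nothing in
    the lattice, where [|s_i| <= Z]; it is there to make the quotients continuous. *)
Lemma split_dominated p q s u v : 0 < p -> 0 < q -> ble (lps q s) (pl p u v) ->
  exists su sv : nat -> E,
   [/\ forall i, (i < size s)%N -> ble (babs (nth 0 s i)) (pl p (su i) (sv i)),
       ble (lps q [seq su i | i <- iota 0 (size s)]) (babs u) &
       ble (lps q [seq sv i | i <- iota 0 (size s)]) (babs v)].
Proof.
move=> p0 q0 sz; pose l := u :: v :: s; pose x := base l; have kx := krivine_kc x.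
pose U := @co R (size l) 0; pose V := @co R (size l) 1.
pose X i := @co R (size l) i.+2.
have hU : pos_homogeneous U by exact: pos_homogeneous_co.
have hV : pos_homogeneous V by exact: pos_homogeneous_co.
have hX i : pos_homogeneous (X i) by exact: pos_homogeneous_co.
have eU : kc x U = u by rewrite kc_co.
have eV : kc x V = v by rewrite kc_co.
have eX i : kc x (X i) = nth 0 s i by rewrite kc_co.
(* [u], [v] and the [s_i] are evaluated together in one calculus *)
pose Z z := lp2 p (U z) (V z); have hZ : pos_homogeneous Z by exact: pos_homogeneous_lp2.
have Z0 z : 0 <= Z z by exact: lp2_ge0.
have eZ : kc x Z = pl p u v by rewrite -[in RHS]eU -[in RHS]eV pl_kc.
pose M i z := Num.min `|X i z| (Z z).
have hM i : pos_homogeneous (M i).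
  by apply: pos_homogeneous_min => //; exact: pos_homogeneous_abs.
have MZ i z : 0 <= M i z <= Z z by rewrite le_min normr_ge0 Z0/= ge_min lexx orbT.
have MX i z : `|M i z| <= `|X i z|.
  by have /andP[m0 _] := MZ i z; rewrite ger0_norm// ge_min lexx.
pose L z := lp_seq q (iota 0 (size s)) (X^~ z).
have hL : pos_homogeneous L by exact: pos_homogeneous_lp_seq.
have eL : kc x L = lps q s.
  rewrite -lps_kc//; congr lps; apply: (@eq_from_nth _ 0); first by rewrite size_map size_iota.
  move=> i; rewrite size_map size_iota => si.
  by rewrite (nth_map 0%N) ?size_iota// nth_iota// add0n eX.
have W0 : kc x (fun z => Num.max (L z - Z z) 0) = 0.
  by apply: kc_pos_part => //; rewrite eL eZ.
have part A : pos_homogeneous A -> (forall z, `|A z| <= Z z) ->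
    [/\ forall i, pos_homogeneous (fun z => M i z * (`|A z| / Z z)) &
     ble (lps q [seq kc x (fun z => M i z * (`|A z| / Z z)) | i <- iota 0 (size s)]) (babs (kc x A))].
  move=> hA AZ.
  have hR i : pos_homogeneous (fun z => M i z * (`|A z| / Z z)).
    apply: pos_homogeneous_ratio => //; first exact: pos_homogeneous_abs.
    by move=> z; rewrite normr_ge0 AZ.
  split=> //; rewrite lps_kc// -kc_abs//.
  apply: (@kc_le_mod _ _ _ _ _ _ _ _ _ _ W0).
  - exact: pos_homogeneous_lp_seq.
  - exact: pos_homogeneous_abs.
  - exact: pos_homogeneous_pos.
  - move=> z; have r0 : 0 <= `|A z| / Z z by rewrite divr_ge0.
    rewrite (_ : (fun i => _) = (fun i => (`|A z| / Z z) * M i z)); last first.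
      by apply/funext => i; rewrite mulrC.
    rewrite lp_seq_scale//.
    have LM : lp_seq q (iota 0 (size s)) (M^~ z) <= L z by apply: le_lp_seq.
    have zz := Z0 z; have az := AZ z.
    have [Zn|Zn] := eqVneq (Z z) 0.
      by rewrite Zn invr0 mulr0 mul0r addr_ge0// le_max lexx orbT.
    have Zp : 0 < Z z by rewrite lt_neqAle eq_sym Zn.
    apply: le_trans (ler_wpM2l r0 LM) _.
    have r1 : `|A z| / Z z <= 1 by rewrite ler_pdivrMr// mul1r.
    have e1 : `|A z| / Z z * Z z = `|A z| by rewrite divfK.
    have [LZ|LZ] := lerP (L z) (Z z).
      rewrite max_r ?subr_le0// addr0 -[X in _ <= X]e1.
      exact: ler_wpM2l.
    rewrite max_l ?subr_ge0 ?(ltW LZ)// -[X in _ <= X + _]e1 -lerBlDl -mulrBr.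
    by rewrite ler_piMl// subr_ge0 ltW.
have UZ z : `|U z| <= Z z by exact: lp2_gel.
have VZ z : `|V z| <= Z z by exact: lp2_ger.
have [hRU bU] := part U hU UZ; have [hRV bV] := part V hV VZ.
exists (fun i => kc x (fun z => M i z * (`|U z| / Z z))).
exists (fun i => kc x (fun z => M i z * (`|V z| / Z z))).
rewrite eU in bU; rewrite eV in bV; split=> // i si.
rewrite pl_kc//.
have sX : ble (kc x (fun z => `|X i z|)) (kc x Z).
  rewrite kc_abs// eX eZ; apply: ble_tr sz.
  by apply: lps_mem => //; exact: mem_nth.
rewrite -eX -kc_abs// -(binf_kc _ _ sX)//; last exact: pos_homogeneous_abs.
rewrite (_ : (fun z => lp2 p _ _) = M i); first exact: ble_refl.
apply/funext => z; have /andP[m0 mz] := MZ i z.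
have [Zn|Zn] := eqVneq (Z z) 0.
  rewrite Zn invr0 !mulr0 lp2_0r// normr0.
  by apply/eqP; rewrite eq_le m0 -Zn mz.
have zz := Z0 z.
have mE (w : R) : M i z * (`|w| / Z z) = (M i z / Z z) * `|w| by rewrite mulrA mulrAC.
by rewrite !mE lp2_scale ?divr_ge0// lp2_abs -/(Z z) divfK.
Qed.

End Splitting.

(** * Renorming with convexity and concavity constants one *)

Section Renorming.
Variables (R : realType) (E : banachLatticeType R) (p q C1 C2 : R).
Hypothesis p1 : 1 <= p.
Hypothesis pq : p <= q.
Hypothesis C1_ge0 : 0 < C1.
Hypothesis C2_ge0 : 0 < C2.
Implicit Types (s t : seq E) (u v w : E).
Hypothesis p_convex : forall s w, ble (babs w) (lps p s) ->
  `|w| `^ p <= C1 * \sum_(y <- s) `|y| `^ p.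
Hypothesis q_concave : forall s w, ble (lps q s) (babs w) ->
  \sum_(y <- s) `|y| `^ q <= C2 * `|w| `^ q.

Let p0 : 0 < p. Proof. exact: lt_le_trans p1. Qed.
Let q0 : 0 < q. Proof. exact: lt_le_trans pq. Qed.
Let pq1 : 1 <= q / p. Proof. by rewrite ler_pdivlMr// mul1r. Qed.
Let pq0 : 0 < q / p. Proof. by rewrite divr_gt0. Qed.

Let cost s := \sum_(y <- s) `|y| `^ p.

Let cost_ge0 s : 0 <= cost s. Proof. by apply: sumr_ge0 => *; exact: powR_ge0. Qed.

(** The [p]-th power of the largest functional below the norm that satisfies the [p]-convexity
    inequality with constant one. *)
Definition convexified_pow w : R := inf [set r | exists2 s, ble (babs w) (lps p s) & r = cost s].

Let K := convexified_pow.

Let K_lb w : has_lbound [set r | exists2 s, ble (babs w) (lps p s) & r = cost s].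
Proof. by exists 0 => _ [s _ ->]. Qed.

Let K_le w s : ble (babs w) (lps p s) -> K w <= cost s.
Proof. by move=> ws; apply: ge_inf => //; exists s. Qed.

Let K_ge w (r : R) : (forall s, ble (babs w) (lps p s) -> r <= cost s) -> r <= K w.
Proof.
move=> h; apply: lb_le_inf; last by move=> _ [s ws ->]; exact: h.
by exists (cost [:: w]), [:: w] => //; rewrite lps1//; exact: ble_refl.
Qed.

Lemma convexified_ge0 w : 0 <= K w. Proof. exact: K_ge. Qed.

Lemma convexified_le_norm w : K w <= `|w| `^ p.
Proof.
have := @K_le w [:: w]; rewrite lps1// /cost big_seq1; apply; exact: ble_refl.
Qed.

Lemma norm_le_convexified w : `|w| `^ p <= C1 * K w.
Proof.
by rewrite mulrC -ler_pdivrMr//; apply: K_ge => s ws; rewrite ler_pdivrMr// mulrC; exact: p_convex.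
Qed.

(** Concatenate a decomposition of [u] and one of [v]. *)
Lemma convexified_sub u v w : ble (babs w) (pl p u v) -> K w <= K u + K v.
Proof.
move=> wuv; rewrite -lerBlDr; apply: K_ge => s us; rewrite lerBlDr addrC -lerBlDr.
apply: K_ge => t vt; rewrite lerBlDr addrC -big_cat; apply: K_le.
apply: ble_tr wuv _; rewrite lps_cat//; apply: pl_mono => //.
- by rewrite (babs_lps _ p0).
- by rewrite (babs_lps _ p0).
Qed.

Lemma convexifiedZ (k : R) w : K (k *: w) = `|k| `^ p * K w.
Proof.
have le (c : R) u : K (c *: u) <= `|c| `^ p * K u.
  have [->|c0] := eqVneq c 0.
    rewrite scale0r normr0 powR0 ?gt_eqF// mul0r; apply: le_trans (convexified_le_norm 0) _.
    by rewrite normr0 powR0 ?gt_eqF.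
  have cp : 0 < `|c| `^ p by rewrite powR_gt0// normr_gt0.
  rewrite mulrC -ler_pdivrMr//; apply: K_ge => s us; rewrite ler_pdivrMr//.
  have -> : cost s * `|c| `^ p = cost [seq `|c| *: y | y <- s].
    rewrite /cost big_map mulr_suml; apply: eq_bigr => y _.
    by rewrite normrZ normr_id powRM// mulrC.
  by apply: K_le; rewrite babsZ lps_scale//; exact: ble_scale.
apply/eqP; rewrite eq_le le/=.
have [->|k0] := eqVneq k 0; first by rewrite normr0 powR0 ?gt_eqF// mul0r convexified_ge0.
have kp : 0 < `|k| `^ p by rewrite powR_gt0// normr_gt0.
have := le k^-1 (k *: w); rewrite scalerA mulVf// scale1r.
rewrite -(ler_pM2l kp) mulrA -powRM// -normrM divff// normr1 powR1 mul1r.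
by [].
Qed.

Let val s := \sum_(y <- s) K y `^ (q / p).

(** The [q]-th power of the new norm: now the [q]-concavity inequality with constant one is forced,
    by taking the supremum over all families whose [q]-sum is below [|w|], of the values of the
    [p]-convex functional. *)
Definition renorm_pow w : R := sup [set r | exists2 s, ble (lps q s) (babs w) & r = val s].

Let M := renorm_pow.

Let M_bound w s : ble (lps q s) (babs w) -> val s <= C2 * `|w| `^ q.
Proof.
move=> sw; apply: le_trans (q_concave sw); apply: ler_sum => y _.
have -> : `|y| `^ q = (`|y| `^ p) `^ (q / p) by rewrite -powRrM mulrC divfK// gt_eqF.
by apply: le_powR; [exact: pq0|exact: convexified_ge0|exact: convexified_le_norm].
Qed.

Let M_ge w s : ble (lps q s) (babs w) -> val s <= M w.
Proof.
move=> sw; apply: ub_le_sup; last by exists s.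
by exists (C2 * `|w| `^ q) => _ [t tw ->]; exact: M_bound.
Qed.

Let M_le w (r : R) : (forall s, ble (lps q s) (babs w) -> val s <= r) -> M w <= r.
Proof.
move=> h; apply: ge_sup; last by move=> _ [s ws ->]; exact: h.
by exists (val [::]), [::] => //; exact: babs_ge0.
Qed.

Lemma convexified_le_renorm w : K w `^ (q / p) <= M w.
Proof.
by have := @M_ge w [:: w]; rewrite lps1// /val big_seq1; apply; exact: ble_refl.
Qed.

Lemma renorm_le_norm w : M w <= C2 * `|w| `^ q.
Proof. by apply: M_le => s; exact: M_bound. Qed.

Lemma renorm_pow_ge0 w : 0 <= M w.
Proof. by apply: le_trans (convexified_le_renorm w); exact: powR_ge0. Qed.

(** Concatenating families gives superadditivity, which is [q]-concavity with constant one. *)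
Lemma renorm_super u v w : ble (pl q u v) (babs w) -> M u + M v <= M w.
Proof.
move=> uvw; rewrite -lerBrDr; apply: M_le => s su; rewrite lerBrDr addrC -lerBrDr.
apply: M_le => t tv; rewrite lerBrDr addrC -big_cat; apply: M_ge.
apply: ble_tr uvw; rewrite lps_cat//; apply: pl_mono => //.
- by rewrite (babs_lps _ q0).
- by rewrite (babs_lps _ q0).
Qed.

Lemma renormZ (k : R) w : M (k *: w) = `|k| `^ q * M w.
Proof.
have le (c : R) u : c != 0 -> `|c| `^ q * M u <= M (c *: u).
  move=> c0; have cp : 0 < `|c| `^ q by rewrite powR_gt0// normr_gt0.
  rewrite mulrC -ler_pdivlMr//; apply: M_le => s us; rewrite ler_pdivlMr//.
  have -> : val s * `|c| `^ q = val [seq `|c| *: y | y <- s].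
    rewrite /val big_map mulr_suml; apply: eq_bigr => y _.
    rewrite convexifiedZ normr_id powRM ?powR_ge0 ?convexified_ge0// -powRrM.
    by rewrite [p * _]mulrC divfK ?gt_eqF// mulrC.
  by apply: M_ge; rewrite babsZ lps_scale//; exact: ble_scale.
have [->|k0] := eqVneq k 0.
  rewrite scale0r normr0 powR0 ?gt_eqF// mul0r; apply/eqP.
  rewrite eq_le renorm_pow_ge0 andbT; apply: le_trans (renorm_le_norm 0) _.
  by rewrite normr0 powR0 ?gt_eqF// mulr0.
apply/eqP; rewrite eq_le le// andbT.
have kp : 0 < `|k| `^ q by rewrite powR_gt0// normr_gt0.
have := le k^-1 (k *: w); rewrite invr_eq0 k0 scalerA mulVf// scale1r => /(_ isT).
by rewrite -(ler_pM2l kp) mulrA -powRM// -normrM divff// normr1 powR1 mul1r.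
Qed.

(** Passing to the supremum does not destroy [p]-convexity.  A family below the [p]-sum of [u] and
    [v] splits into families below [u] and below [v]; the convex functional is subadditive along the
    splitting, and Minkowski's inequality with exponent [q / p >= 1] adds up the pieces. *)
Lemma renorm_sub u v w : ble (babs w) (pl p u v) ->
  M w `^ (p / q) <= M u `^ (p / q) + M v `^ (p / q).
Proof.
move=> wuv; have pqi : p / q = (q / p)^-1 by rewrite invf_div.
have A0 : 0 <= M u `^ (p / q) + M v `^ (p / q) by rewrite addr_ge0 ?powR_ge0.
rewrite pqi; apply: (@le_powR_inv _ (q / p)) => //; first by rewrite -pqi.
rewrite root_powR//; last exact: renorm_pow_ge0.
apply: M_le => s sw.
have [su [sv [h1 h2 h3]]] := split_dominated p0 q0 (ble_tr sw wuv).
have -> : val s = \sum_(i <- iota 0 (size s)) K (nth 0 s i) `^ (q / p).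
  by rewrite /val (big_nth 0) /index_iota subn0.
apply: le_trans (_ : \sum_(i <- iota 0 (size s)) (K (su i) + K (sv i)) `^ (q / p) <= _).
  rewrite big_seq [leRHS]big_seq; apply: ler_sum => i; rewrite mem_iota add0n => /andP[_ si].
  apply: le_powR; [exact: pq0|exact: convexified_ge0|].
  exact: convexified_sub (h1 i si).
apply: le_trans (minkowski_seq _ pq1 (fun i => convexified_ge0 _) (fun i => convexified_ge0 _)) _.
have pqi0 : 0 < (q / p)^-1 by rewrite invr_gt0.
have sub (f : nat -> E) u' : ble (lps q [seq f i | i <- iota 0 (size s)]) (babs u') ->
    (\sum_(i <- iota 0 (size s)) K (f i) `^ (q / p)) `^ (q / p)^-1 <= M u' `^ (q / p)^-1.
  move=> h; apply: le_powR => //; first by apply: sumr_ge0 => *; exact: powR_ge0.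
  by have := M_ge h; rewrite /val big_map.
apply: le_powR => //; first by rewrite addr_ge0 ?powR_ge0.
by apply: lerD; exact: sub.
Qed.

Definition renorm w : R := M w `^ q^-1.

Lemma renorm_ge0 w : 0 <= renorm w. Proof. exact: powR_ge0. Qed.

Lemma renorm_powq w : renorm w `^ q = M w.
Proof. by rewrite /renorm root_powR// renorm_pow_ge0. Qed.

Lemma renorm_powp w : renorm w `^ p = M w `^ (p / q).
Proof. by rewrite /renorm -powRrM mulrC. Qed.

Lemma renorm_homog (k : R) w : renorm (k *: w) = `|k| * renorm w.
Proof. by rewrite /renorm renormZ powRM ?powR_ge0 ?renorm_pow_ge0// powR_root. Qed.

Lemma renorm_ub w : renorm w <= C2 `^ q^-1 * `|w|.
Proof.
have qi : 0 < q^-1 by rewrite invr_gt0.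
apply: le_trans (le_powR qi (renorm_pow_ge0 w) (renorm_le_norm w)) _.
by rewrite powRM ?powR_ge0 ?(ltW C2_ge0)// powR_root.
Qed.

Lemma renorm_lb w : (C1 `^ p^-1)^-1 * `|w| <= renorm w.
Proof.
have pi : 0 < p^-1 by rewrite invr_gt0.
have Cp : 0 < C1 `^ p^-1 by rewrite powR_gt0.
rewrite mulrC ler_pdivrMr//.
have := le_powR pi (powR_ge0 _ _) (norm_le_convexified w); rewrite powR_root// => h.
apply: le_trans h _; rewrite powRM ?(ltW C1_ge0) ?convexified_ge0// mulrC.
apply: ler_wpM2r; first exact: ltW.
have qi : 0 < q^-1 by rewrite invr_gt0.
have := le_powR qi (powR_ge0 _ _) (convexified_le_renorm w).
by rewrite -powRrM mulrAC divff ?gt_eqF// mul1r.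
Qed.

End Renorming.

(** * Monotonicity of convexity and concavity in the exponent *)

Section ChangeOfExponent.
Variables (R : realType) (E : banachLatticeType R).
Implicit Types (s : seq E) (w : E) (p q : R).

Lemma lps_weight_le p q s (m n : E -> R) : 0 < p -> 0 < q ->
  (forall v : nat -> R, lp_seq p (iota 0 (size s)) (fun i => m (nth 0 s i) * v i) <=
                 lp_seq q (iota 0 (size s)) (fun i => n (nth 0 s i) * v i)) ->
  ble (lps p [seq m x *: x | x <- s]) (lps q [seq n x *: x | x <- s]).
Proof.
move=> p0 q0 h; have kx := krivine_kc (base s).
have mE (k : E -> R) : [seq k x *: x | x <- s] =
    [seq kc (base s) (fun z => k (nth 0 s i) * co i z) | i <- iota 0 (size s)].
  apply: (@eq_from_nth _ 0); first by rewrite !size_map size_iota.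
  rewrite size_map => i si.
  rewrite (nth_map 0)// (nth_map 0%N) ?size_iota// nth_iota// add0n.
  by rewrite (krivineZ kx) ?kc_co//; exact: pos_homogeneous_co.
have hh (k : E -> R) i : pos_homogeneous (fun z : 'rV[R]_(size s) => k (nth 0 s i) * co i z).
  by apply: pos_homogeneousZ; exact: pos_homogeneous_co.
rewrite !mE !lps_kc//; apply: (krivine_le kx).
- by apply: pos_homogeneous_lp_seq.
- by apply: pos_homogeneous_lp_seq.
- by move=> v; exact: (h (fun i => co i v)).
Qed.

(** With weights of total mass one, [l_p]-norms increase with [p], after the change of density that
    turns the counting measure into the measure [l]. *)
Lemma weighted_power_le (r : seq nat) (l v : nat -> R) p q : 0 < p -> p < q ->
  (forall i, 0 <= l i) -> \sum_(i <- r) l i = 1 ->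
  lp_seq p r (fun i => l i `^ (p^-1 - q^-1) * v i) <= lp_seq q r v.
Proof.
move=> p0 pq l0 l1; have q0 : 0 < q by exact: lt_trans pq.
apply: (@le_powR_inv _ p) => //; first exact: lp_seq_ge0.
rewrite lp_seq_pow// lp_seqE -powRrM.
have th0 : 0 < p / q by rewrite divr_gt0.
have th1 : p / q < 1 by rewrite ltr_pdivrMr// mul1r.
have := @hoelder_seq R _ r l (fun i => `|v i| `^ q) _ th0 th1 l0 (fun i => powR_ge0 _ _).
rewrite l1 powR1 mul1r [q^-1 * p]mulrC; apply: le_trans.
rewrite le_eqVlt; apply/orP; left; apply/eqP; apply: eq_bigr => i _.
rewrite normrM ger0_norm ?powR_ge0// powRM ?powR_ge0// -!powRrM.
congr (_ * _); last by congr (_ `^ _); field; rewrite gt_eqF.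
by congr (_ `^ _); field; rewrite !gt_eqF.
Qed.

(** Apply the inequality with exponent [q] to the family [l_i^(1/q - 1/q') x_i], whose [q]-sum is
    below the [q']-sum of the [x_i].  The weights [l_i] proportional to [F x_i ^ q'] make Hoelder's
    inequality an equality on the scalar side, so the constant stays one. *)
Lemma concave_exponent (F G : E -> R) q q' : 0 < q -> q <= q' ->
  (forall x, 0 <= F x) -> (forall x, 0 <= G x) ->
  (forall (k : R) x, F (k *: x) = `|k| * F x) ->
  (forall s w, ble (lps q s) (babs w) -> \sum_(x <- s) F x `^ q <= G w `^ q) ->
  forall s w, ble (lps q' s) (babs w) -> \sum_(x <- s) F x `^ q' <= G w `^ q'.
Proof.
rewrite le_eqVlt => q0 /predU1P[<-//|qq'] F0 G0 FZ h s w sw.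
have q'0 : 0 < q' by exact: lt_trans qq'.
set S := \sum_(x <- s) F x `^ q'.
have S0 : 0 <= S by apply: sumr_ge0 => *; exact: powR_ge0.
have [->|Sn] := eqVneq S 0; first exact: powR_ge0.
have Sp : 0 < S by rewrite lt_neqAle eq_sym Sn.
pose l x := F x `^ q' / S.
have l0 x : 0 <= l x by rewrite divr_ge0// powR_ge0.
have lS : \sum_(i <- iota 0 (size s)) l (nth 0 s i) = 1.
  have -> : \sum_(i <- iota 0 (size s)) l (nth 0 s i) = \sum_(x <- s) l x.
    by rewrite [RHS](big_nth 0) /index_iota subn0.
  by rewrite -mulr_suml divff.
have le1 : ble (lps q [seq l x `^ (q^-1 - q'^-1) *: x | x <- s]) (lps q' s).
  have mapE : [seq 1 *: x | x <- s] = s.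
    by rewrite -[RHS]map_id; apply: eq_map => x; rewrite scale1r.
  rewrite -[X in ble _ (lps _ X)]mapE.
  apply: lps_weight_le => // v; under [X in _ <= lp_seq _ _ X]eq_fun do rewrite mul1r.
  exact: (@weighted_power_le _ (fun i => l (nth 0 s i))).
have := h _ _ (ble_tr le1 sw); rewrite big_map.
under eq_bigr do rewrite FZ ger0_norm ?powR_ge0// powRM ?powR_ge0// -powRrM.
have e1 : (q^-1 - q'^-1) * q = 1 - q / q' by field; rewrite !gt_eqF.
rewrite e1.
have th0 : 0 < q / q' by rewrite divr_gt0.
have e2 x : l x `^ (1 - q / q') * F x `^ q = F x `^ q' * S `^ (q / q' - 1).
  have [Fx|Fx] := eqVneq (F x) 0; first by rewrite Fx !powR0 ?gt_eqF// mul0r mulr0.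
  have Fp : 0 < F x by rewrite lt_neqAle eq_sym Fx F0.
  rewrite /l powRM ?powR_ge0 ?invr_ge0// -[S^-1]powR_inv1// -!powRrM mulN1r opprB.
  rewrite mulrAC -powRD; last by rewrite Fx implybT.
  by congr (_ `^ _ * _); field; rewrite gt_eqF.
under eq_bigr do rewrite e2.
rewrite -mulr_suml -/S [S * _]mulr_powRB1// => hS.
have := le_powR (_ : 0 < q' / q) (powR_ge0 _ _) hS; rewrite divr_gt0// => /(_ isT).
rewrite -!powRrM (_ : q / q' * (q' / q) = 1) ?powRr1//; last by field; rewrite !gt_eqF.
by rewrite (_ : q * (q' / q) = q')//; field; rewrite gt_eqF.
Qed.

(** Dual to [concave_exponent]: here the weights enter with a negative exponent, so vanishing elements
    are discarded first. *)
Lemma convex_exponent (F G : E -> R) p p' : 0 < p' -> p' <= p ->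
  (forall x, 0 <= F x) -> (forall x, 0 <= G x) -> (forall x, F x = 0 -> x = 0) ->
  (forall (k : R) x, F (k *: x) = `|k| * F x) ->
  (forall s w, ble (babs w) (lps p s) -> G w `^ p <= \sum_(x <- s) F x `^ p) ->
  forall s w, ble (babs w) (lps p' s) -> G w `^ p' <= \sum_(x <- s) F x `^ p'.
Proof.
rewrite le_eqVlt => p'0 /predU1P[->//|pp] F0 G0 Fdef FZ h s' w; rewrite -lps_neq0// => sw.
have p0 : 0 < p by exact: lt_trans pp.
set s := [seq x <- s' | x != 0] in sw.
apply: (@le_trans _ _ (\sum_(x <- s) F x `^ p')); last first.
  by rewrite big_filter big_mkcond; apply: ler_sum => x _; case: ifP; rewrite ?powR_ge0.
have Fs x : x \in s -> 0 < F x.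
  rewrite mem_filter => /andP[x0 _]; rewrite lt_neqAle F0 andbT eq_sym.
  by apply: contra x0 => /eqP/Fdef/eqP.
set S := \sum_(x <- s) F x `^ p'.
have S0 : 0 <= S by apply: sumr_ge0 => *; exact: powR_ge0.
have [SE|Sn] := eqVneq S 0.
  have s0 : s = [::].
    move: Fs SE; rewrite /S; case: (s) => // x t ht /eqP.
    rewrite psumr_eq0; last by move=> *; exact: powR_ge0.
    move=> /andP[/= + _]; rewrite powR_eq0 => /andP[/eqP F00 _].
    by have := ht x (mem_head _ _); rewrite F00 ltxx.
  have := h _ _ (_ : ble (babs w) (lps p [::])).
  move: sw; rewrite s0 => sw /(_ sw); rewrite big_nil SE.
  move=> G00; have /powR_eq0_eq0 -> : G w `^ p = 0.
    by apply/eqP; rewrite eq_le G00 powR_ge0.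
  by rewrite powR0// gt_eqF.
have Sp : 0 < S by rewrite lt_neqAle eq_sym Sn.
pose l x := F x `^ p' / S.
have l0 x : 0 <= l x by rewrite divr_ge0// powR_ge0.
have lS : \sum_(i <- iota 0 (size s)) l (nth 0 s i) = 1.
  have -> : \sum_(i <- iota 0 (size s)) l (nth 0 s i) = \sum_(x <- s) l x.
    by rewrite [RHS](big_nth 0) /index_iota subn0.
  by rewrite -mulr_suml divff.
have le1 : ble (lps p' s) (lps p [seq l x `^ (p^-1 - p'^-1) *: x | x <- s]).
  have mapE : [seq 1 *: x | x <- s] = s.
    by rewrite -[RHS]map_id; apply: eq_map => x; rewrite scale1r.
  rewrite -[X in ble (lps _ X)]mapE.
  apply: lps_weight_le => // v.
  pose u (i : nat) := l (nth 0 s i) `^ (p^-1 - p'^-1) * v i.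
  have := @weighted_power_le (iota 0 (size s)) (fun i => l (nth 0 s i)) u p' p p'0 pp (fun=> l0 _) lS.
  apply: le_trans; rewrite le_eqVlt; apply/orP; left; apply/eqP; rewrite !lp_seqE.
  congr (_ `^ _); apply: eq_big_seq => i; rewrite mem_iota add0n => /andP[_ si].
  rewrite mul1r /u mulrA -powRD ?addrA ?subrK ?subrr ?powRr0 ?mul1r//.
  rewrite implybE orbC gt_eqF//.
  by rewrite divr_gt0// powR_gt0// Fs// mem_nth.
have := h _ _ (ble_tr sw le1); rewrite big_map.
under eq_bigr do rewrite FZ ger0_norm ?powR_ge0// powRM ?powR_ge0// -powRrM.
have e1 : (p^-1 - p'^-1) * p = 1 - p / p' by field; rewrite !gt_eqF.
rewrite e1.
have e2 x : x \in s -> l x `^ (1 - p / p') * F x `^ p = F x `^ p' * S `^ (p / p' - 1).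
  move=> /Fs Fp.
  rewrite /l powRM ?powR_ge0 ?invr_ge0// -[S^-1]powR_inv1// -!powRrM mulN1r opprB.
  rewrite mulrAC -powRD; last by rewrite (gt_eqF Fp) implybT.
  by congr (_ `^ _ * _); field; rewrite gt_eqF.
have -> : \sum_(x <- s) l x `^ (1 - p / p') * F x `^ p = \sum_(x <- s) F x `^ p' * S `^ (p / p' - 1).
  by apply: eq_big_seq => x /e2.
rewrite -mulr_suml -/S [S * _]mulr_powRB1//; last by rewrite divr_gt0.
move=> hS.
have := le_powR (_ : 0 < p' / p) (powR_ge0 _ _) hS; rewrite divr_gt0// => /(_ isT).
rewrite -!powRrM (_ : p / p' * (p' / p) = 1) ?powRr1//; last by field; rewrite !gt_eqF.
by rewrite (_ : p * (p' / p) = p')//; field; rewrite gt_eqF.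
Qed.

End ChangeOfExponent.

(** * The renorming theorem *)

Section RenormingTheorem.
Variables (R : realType) (E : banachLatticeType R).
Implicit Types (s : seq E) (u v w x : E) (p q : R).

Lemma abs_le0 w : ble (babs w) 0 -> w = 0.
Proof.
move=> w0; apply/eqP; rewrite -normr_le0; apply: le_trans (norm_le_of_babs w0) _.
by rewrite normr0.
Qed.

Lemma convex_seq (N : E -> R) p : 0 < p -> N 0 = 0 ->
  (forall u v w, ble (babs w) (pl p u v) -> N w `^ p <= N u `^ p + N v `^ p) ->
  forall s w, ble (babs w) (lps p s) -> N w `^ p <= \sum_(x <- s) N x `^ p.
Proof.
move=> p0 N0 h; elim=> [|a s IH] w /= hw.
  by rewrite (abs_le0 hw) N0 big_nil powR0// gt_eqF.
rewrite big_cons; apply: le_trans (h _ _ _ hw) _; rewrite lerD2l; apply: IH.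
by rewrite babs_lps//; exact: ble_refl.
Qed.

Lemma concave_seq (N : E -> R) q : 0 < q ->
  (forall u v w, ble (pl q u v) (babs w) -> N u `^ q + N v `^ q <= N w `^ q) ->
  forall s w, ble (lps q s) (babs w) -> \sum_(x <- s) N x `^ q <= N w `^ q.
Proof.
move=> q0 h; elim=> [|a s IH] w /= hw; first by rewrite big_nil powR_ge0.
rewrite big_cons; apply: le_trans (h _ _ _ hw); rewrite lerD2l; apply: IH.
by rewrite babs_lps//; exact: ble_refl.
Qed.

(** The weighted form of [|u + v|] bounded by a [p]-sum that is optimal for one value of [l]. *)
Lemma abs_add_le_pl p (l : R) u v : 1 <= p -> 0 < l -> l < 1 ->
  ble (babs (u + v)) (pl p (l `^ ((1 - p) / p) *: u) ((1 - l) `^ ((1 - p) / p) *: v)).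
Proof.
move=> p1 l0 l1; have p0 : 0 < p by exact: lt_le_trans p1.
pose x := base [:: u; v]; have kx := krivine_kc x.
have hco k : pos_homogeneous (@co R (size [:: u; v]) k) by exact: pos_homogeneous_co.
have eU : kc x (co 0) = u by rewrite kc_co.
have eV : kc x (co 1) = v by rewrite kc_co.
have hZ (a : R) k : pos_homogeneous (fun z : 'rV[R]_(size [:: u; v]) => a * co k z).
  exact: pos_homogeneousZ.
rewrite -{}eU -{}eV -(krivineD kx)// -!(krivineZ kx)// pl_kc// -kc_abs//; last first.
  exact: pos_homogeneousD.
apply: (krivine_le kx).
- by apply: pos_homogeneous_abs; exact: pos_homogeneousD.
- exact: pos_homogeneous_lp2.
move=> z; apply: (@le_powR_inv _ p) => //; first exact: lp2_ge0.
rewrite lp2_pow// !normrM.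
have h : `|co 0 z + co 1 z| `^ p <= (`|co 0 z| + `|co 1 z|) `^ p.
  by apply: le_powR => //; exact: ler_normD.
apply: le_trans h _; apply: le_trans (powRD_split p1 l0 l1 (normr_ge0 _) (normr_ge0 _)) _.
rewrite !(ger0_norm (powR_ge0 _ _)) !(powRM _ (powR_ge0 _ _) (normr_ge0 _)) -!powRrM.
by rewrite divfK ?gt_eqF.
Qed.

(** Convexity with constant one, homogeneity and the optimal weights [N u : N v] give the triangle
    inequality. *)
Lemma triangle_of_convex (N : E -> R) p : 1 <= p ->
  (forall x, 0 <= N x) -> (forall x, N x = 0 -> x = 0) ->
  (forall (k : R) x, N (k *: x) = `|k| * N x) ->
  (forall u v w, ble (babs w) (pl p u v) -> N w `^ p <= N u `^ p + N v `^ p) ->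
  forall u v, N (u + v) <= N u + N v.
Proof.
move=> p1 N0 Ndef NZ h u v; have p0 : 0 < p by exact: lt_le_trans p1.
have [/Ndef->|un] := eqVneq (N u) 0; first by rewrite add0r lerDr.
have [/Ndef->|vn] := eqVneq (N v) 0; first by rewrite addr0 lerDl.
have Nu : 0 < N u by rewrite lt_neqAle eq_sym un N0.
have Nv : 0 < N v by rewrite lt_neqAle eq_sym vn N0.
have S0 : 0 < N u + N v by rewrite addr_gt0.
(* the optimal weight *)
pose l := N u / (N u + N v).
have l0 : 0 < l by rewrite divr_gt0.
have l1 : l < 1 by rewrite ltr_pdivrMr// mul1r ltrDl.
have l' : 1 - l = N v / (N u + N v) by rewrite /l; field; rewrite gt_eqF.
have := h _ _ _ (abs_add_le_pl u v p1 l0 l1).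
rewrite !NZ !(ger0_norm (powR_ge0 _ _)) !(powRM _ (powR_ge0 _ _) (N0 _)) -!powRrM divfK ?gt_eqF//.
rewrite l' => hle; apply: (@le_powR_inv _ p) => //; first exact: ltW.
apply: le_trans hle _; rewrite /l.
have cE (c : R) : 0 < c -> (c / (N u + N v)) `^ (1 - p) * c `^ p = c * (N u + N v) `^ (p - 1).
  move=> c0; rewrite (powRM _ (ltW c0)) ?invr_ge0 ?(ltW S0)//.
  rewrite -[(N u + N v)^-1]powR_inv1 ?(ltW S0)// -powRrM mulN1r opprB.
  rewrite mulrAC -powRD; last by rewrite subrK oner_eq0.
  by rewrite subrK powRr1// ltW.
by rewrite (cE _ Nu) (cE _ Nv) -mulrDl (mulr_powRB1 (ltW S0)).
Qed.

Lemma sum_base (F : E -> R) s : \sum_(i < size s) F (base s i) = \sum_(x <- s) F x.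
Proof. by rewrite [RHS](big_nth 0) big_mkord. Qed.

(** The concavity exponent is first raised above [p], so that the supremum in the renorming keeps the
    convexity. *)
Theorem convex_concave_renorming p q : 1 < p -> 0 < q ->
  krivine_type_ge E p -> krivine_type_le E q ->
  exists2 N : E -> R, equivalent_norm N &
  exists2 q1 : R, 0 < q1 &
   (forall p', 0 < p' -> p' <= p -> forall s w, ble (babs w) (lps p' s) ->
       N w `^ p' <= \sum_(x <- s) N x `^ p') /\
   (forall q', q1 <= q' -> forall s w, ble (lps q' s) (babs w) ->
       \sum_(x <- s) N x `^ q' <= N w `^ q').
Proof.
move=> p1 q0 [Cp hCp] [Cq hCq]; have p0 : 0 < p by exact: lt_trans p1.
pose C1 := Num.max Cp 1; pose C2 := Num.max Cq 1; pose q1 := Num.max p q.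
have C1p : 0 < C1 by rewrite lt_max ltr01 orbT.
have C2p : 0 < C2 by rewrite lt_max ltr01 orbT.
have pq1 : p <= q1 by rewrite le_max lexx.
have qq1 : q <= q1 by rewrite le_max lexx orbT.
have q10 : 0 < q1 by exact: lt_le_trans pq1.
have hconv s w : ble (babs w) (lps p s) -> `|w| `^ p <= C1 `^ p * \sum_(y <- s) `|y| `^ p.
  move=> ws; have := hCp _ _ _ (lps_is_lp_sum_seq s p0).
  rewrite (sum_base (fun y => `|y| `^ p)) => hs.
  set S := \sum_(y <- s) _ in hs *.
  have S0 : 0 <= S by apply: sumr_ge0 => *; exact: powR_ge0.
  have h : `|w| <= C1 * S `^ p^-1.
    apply: le_trans (norm_le_of_babs ws) _; apply: le_trans hs _.
    by apply: ler_wpM2r; rewrite ?powR_ge0// le_max lexx.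
  apply: le_trans (le_powR p0 (normr_ge0 _) h) _.
  by rewrite (powRM _ (ltW C1p) (powR_ge0 _ _)) (root_powR p0 S0).
have hconc0 s w : ble (lps q s) (babs w) -> \sum_(y <- s) `|y| `^ q <= (C2 * `|w|) `^ q.
  move=> sw; have := hCq _ _ _ (lps_is_lp_sum_seq s q0).
  rewrite (sum_base (fun y => `|y| `^ q)) => hs.
  set S := \sum_(y <- s) _ in hs *.
  have S0 : 0 <= S by apply: sumr_ge0 => *; exact: powR_ge0.
  rewrite -(root_powR q0 S0); apply: le_powR => //; first exact: powR_ge0.
  apply: le_trans hs _; apply: le_trans (_ : C2 * `|lps q s| <= _).
    by apply: ler_wpM2r; rewrite // le_max lexx.
  apply: ler_wpM2l; first exact: ltW.
  by rewrite -[`|w|]norm_babs; apply: norm_le_of_babs; rewrite babs_lps.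
have hconc s w : ble (lps q1 s) (babs w) -> \sum_(y <- s) `|y| `^ q1 <= C2 `^ q1 * `|w| `^ q1.
  rewrite -(powRM _ (ltW C2p) (normr_ge0 w)).
  apply: (@concave_exponent _ _ (fun y => `|y|) (fun w => C2 * `|w|) q q1) => //.
  - by move=> x; rewrite mulr_ge0// ltW.
  - by move=> k x; rewrite normrZ.
have C1pp : 0 < C1 `^ p by rewrite powR_gt0.
have C2pp : 0 < C2 `^ q1 by rewrite powR_gt0.
have p1' : 1 <= p by exact: ltW.
pose N := renorm (E := E) p q1.
have N0 x : 0 <= N x by exact: renorm_ge0.
have NZ (k : R) x : N (k *: x) = `|k| * N x by apply: (renorm_homog (C2 := C2 `^ q1)).
have Nub x := renorm_ub p1' pq1 C2pp hconc x.
have Nlb x := renorm_lb p1' pq1 C1pp hconv hconc x.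
have a0 : 0 < ((C1 `^ p) `^ p^-1)^-1 by rewrite invr_gt0 powR_gt0.
have b0 : 0 < (C2 `^ q1) `^ q1^-1 by rewrite powR_gt0.
have Ndef x : N x = 0 -> x = 0.
  move=> Nx; apply/eqP; rewrite -normr_le0 -(pmulr_rle0 _ a0); apply: le_trans (Nlb x) _.
  by rewrite -/N Nx.
have N00 : N 0 = 0 by have := NZ 0 0; rewrite scaler0 normr0 mul0r.
have Nconv u v w : ble (babs w) (pl p u v) -> N w `^ p <= N u `^ p + N v `^ p.
  by move=> h; rewrite !(renorm_powp p q1); exact: (renorm_sub p1' pq1 hconc).
have Nconc u v w : ble (pl q1 u v) (babs w) -> N u `^ q1 + N v `^ q1 <= N w `^ q1.
  by move=> h; rewrite !(renorm_powq p1' pq1 hconc); exact: (renorm_super p1' pq1 hconc).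
exists N.
  split; [exact: (triangle_of_convex p1' N0 Ndef NZ Nconv)|exact: NZ|exact: Ndef|].
  exists (((C1 `^ p) `^ p^-1)^-1, (C2 `^ q1) `^ q1^-1); first by split; [exact: a0|exact: b0].
  by move=> x; apply/andP; split; [exact: Nlb|exact: Nub].
exists q1; [exact: q10|split=> [p' p'0 p'p|q' qq']].
  exact: (convex_exponent p'0 p'p N0 N0 Ndef NZ (convex_seq p0 N00 Nconv)).
exact: (concave_exponent q10 qq' N0 N0 NZ (concave_seq q10 Nconc)).
Qed.

End RenormingTheorem.

(** * L^q norms of real random variables *)

Section LqNorm.
Import HBSimple.
Import HBNNSimple.
Context {R : realType} {d : measure_display} {T : measurableType d}.
Variable P : probability T R.
Implicit Types (X Y : T -> R) (q : R).

(** [LN] may be infinite and carries the inequalities; [nq] is its real value, used where [fin] holds,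
    since the functional calculus takes real functions. *)
Definition LN q X : \bar R := 'N[P]_q%:E[EFin \o X].

Definition nq q X : R := fine (LN q X).

Definition fin q X : Prop := measurable_fun setT X /\ (LN q X < +oo)%E.

Lemma measurable_abs_powR q X : measurable_fun setT X ->
  measurable_fun setT (EFin \o (fun w => `|X w| `^ q)).
Proof.
move=> mX; apply/measurable_EFinP.
apply: (@measurableT_comp _ _ _ _ _ _ (@powR R ^~ q)); first exact: measurable_powR.
exact: measurableT_comp.
Qed.

Lemma LNE q X : LN q X = ((\int[P]_w (`|X w| `^ q)%:E) `^ q^-1)%E.
Proof. by rewrite /LN unlock; congr poweR; apply: eq_integral => w _. Qed.

Lemma LN_ge0 q X : (0 <= LN q X)%E. Proof. exact: Lnorm_ge0. Qed.

Lemma nq_ge0 q X : 0 <= nq q X. Proof. by rewrite fine_ge0// LN_ge0. Qed.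

Lemma LN_pow q X : q != 0 -> ((LN q X) `^ q = \int[P]_w (`|X w| `^ q)%:E)%E.
Proof.
move=> q0; rewrite LNE -poweRrM mulVf// poweRe1//.
by apply: integral_ge0 => w _; rewrite lee_fin powR_ge0.
Qed.

Lemma le_LN q X Y : 0 < q -> measurable_fun setT X -> measurable_fun setT Y ->
  (forall w, `|X w| <= `|Y w|) -> (LN q X <= LN q Y)%E.
Proof.
move=> q0 mX mY XY; rewrite !LNE; apply: gt0_ler_poweR; first by rewrite invr_ge0 ltW.
- by rewrite in_itv/= leey andbT integral_ge0// => w _; rewrite lee_fin powR_ge0.
- by rewrite in_itv/= leey andbT integral_ge0// => w _; rewrite lee_fin powR_ge0.
apply: ge0_le_integral => //; try exact: measurable_abs_powR.
by move=> w _; rewrite lee_fin; exact: le_powR.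
Qed.

Lemma eq_LN q X Y : X =1 Y -> LN q X = LN q Y.
Proof. by move=> /funext->. Qed.

Lemma LNZ q (a : R) X : 0 < q -> measurable_fun setT X ->
  LN q (fun w => a * X w) = (`|a|%:E * LN q X)%E.
Proof.
move=> q0 mX; rewrite !LNE.
under eq_integral do rewrite normrM powRM// EFinM.
rewrite (@ge0_integralZl _ _ _ P setT measurableT (fun w => (`|X w| `^ q)%:E)); first last.
- by rewrite lee_fin powR_ge0.
- by move=> w _; rewrite lee_fin powR_ge0.
- exact: measurable_abs_powR.
rewrite poweRM; [|by rewrite lee_fin powR_ge0|by apply: integral_ge0 => w _; rewrite lee_fin powR_ge0].
by rewrite poweR_EFin powR_root.
Qed.

Lemma LND q X Y : 1 <= q -> measurable_fun setT X -> measurable_fun setT Y ->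
  (LN q (fun w => (X w + Y w)%R) <= LN q X + LN q Y)%E.
Proof. by move=> q1 mX mY; exact: (minkowski_EFin P mX mY q1). Qed.

Lemma finE q X : fin q X -> LN q X = (nq q X)%:E.
Proof. by move=> [_ h]; rewrite /nq fineK// ge0_fin_numE// LN_ge0. Qed.

Lemma finZ q (a : R) X : 0 < q -> fin q X -> fin q (fun w => a * X w).
Proof.
move=> q0 fX; split; first by apply: measurable_funM => //; case: fX.
by rewrite LNZ//; [rewrite (finE fX) -EFinM ltry|case: fX].
Qed.

Lemma nqZ q (a : R) X : 0 < q -> fin q X -> nq q (fun w => a * X w) = `|a| * nq q X.
Proof. by move=> q0 fX; rewrite /nq LNZ//; [rewrite (finE fX) -EFinM|case: fX]. Qed.

Lemma finD q X Y : 1 <= q -> fin q X -> fin q Y -> fin q (fun w => X w + Y w).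
Proof.
move=> q1 fX fY; split; first by apply: measurable_funD; [case: fX|case: fY].
apply: le_lt_trans (LND q1 _ _) _; [by case: fX|by case: fY|].
by rewrite (finE fX) (finE fY) -EFinD ltry.
Qed.

Lemma nqD q X Y : 1 <= q -> fin q X -> fin q Y -> nq q (fun w => X w + Y w) <= nq q X + nq q Y.
Proof.
move=> q1 fX fY; rewrite -lee_fin EFinD -!finE//; last exact: finD.
by apply: LND => //; [case: fX|case: fY].
Qed.

Lemma LN_0 q : 0 < q -> LN q (fun=> 0) = 0%E.
Proof.
move=> q0; have -> : LN q (fun=> 0) = LN q (fun w => 0 * (0 : R)) by apply: eq_LN => w; rewrite mulr0.
by rewrite LNZ// normr0 mul0e.
Qed.

Lemma fin0 q : 0 < q -> fin q (fun=> 0).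
Proof. by move=> q0; split; rewrite ?LN_0. Qed.

Lemma fin_sum (I : Type) (r : seq I) q (X : I -> T -> R) : 1 <= q ->
  (forall i, fin q (X i)) -> fin q (fun w => \sum_(i <- r) X i w).
Proof.
move=> q1 fX; elim: r => [|i r IH].
  by under eq_fun do rewrite big_nil; apply: fin0; exact: lt_le_trans q1.
by under eq_fun do rewrite big_cons; exact: finD.
Qed.

Lemma nq_sum (I : Type) (r : seq I) q (X : I -> T -> R) : 1 <= q ->
  (forall i, fin q (X i)) -> nq q (fun w => \sum_(i <- r) X i w) <= \sum_(i <- r) nq q (X i).
Proof.
move=> q1 fX; elim: r => [|i r IH].
  by under eq_fun do rewrite big_nil; rewrite /nq LN_0 ?big_nil//; exact: lt_le_trans q1.
under eq_fun do rewrite big_cons; rewrite big_cons.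
apply: le_trans (nqD q1 (fX i) (fin_sum _ q1 fX)) _.
by rewrite lerD2l.
Qed.

Lemma fin_le q X Y : 0 < q -> measurable_fun setT X -> fin q Y ->
  (forall w, `|X w| <= `|Y w|) -> fin q X.
Proof.
move=> q0 mX fY XY; split=> //; apply: le_lt_trans (proj2 fY).
by apply: le_LN => //; case: fY.
Qed.

Lemma fin_abs q X : fin q X -> fin q (fun w => `|X w|).
Proof.
move=> [mX h]; split; first exact: measurableT_comp.
by rewrite LNE; under eq_integral do rewrite normr_id; rewrite -LNE.
Qed.

Lemma nq_abs q X : nq q (fun w => `|X w|) = nq q X.
Proof. by rewrite /nq !LNE; under eq_integral do rewrite normr_id. Qed.

Lemma fin_integrable q X : 0 < q -> fin q X -> P.-integrable setT (fun w => (`|X w| `^ q)%:E).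
Proof.
move=> q0 [mX h]; apply/integrableP; split; first exact: measurable_abs_powR.
under eq_integral do rewrite gee0_abs ?lee_fin ?powR_ge0//.
by apply: (@lty_poweRy _ _ q^-1); rewrite ?invr_eq0 ?gt_eqF// -LNE.
Qed.

(** The positive and the negative part have increasing simple approximations; dominated convergence
    makes the error small in [L^q]. *)
Lemma simple_approximation q X (e : R) : 1 <= q -> fin q X -> 0 < e ->
  exists Y, [/\ measurable_fun setT Y, finite_set (range Y), fin q Y &
                nq q (fun w => X w - Y w) <= e].
Proof.
move=> q1 fX e0; have q0 : 0 < q by exact: lt_le_trans q1.
have mX : measurable_fun setT X by case: fX.
pose Xp w := Num.max (X w) 0; pose Xn w := Num.max (- X w) 0.
have Xpn w : (0 <= X w /\ Xp w = X w /\ Xn w = 0) \/ (X w < 0 /\ Xp w = 0 /\ Xn w = - X w).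
  rewrite /Xp /Xn; have [x0|x0'] := boolP (0 <= X w).
  by left; split=> //; split; [exact: max_l|apply: max_r; rewrite oppr_le0].
  have x0 : X w < 0 by rewrite ltNge.
  by right; split=> //; split; [apply: max_r; exact: ltW|apply: max_l; rewrite oppr_ge0 ltW].
have mXp : measurable_fun setT (EFin \o Xp).
  by apply/measurable_EFinP; apply: measurable_maxr.
have mXn : measurable_fun setT (EFin \o Xn).
  by apply/measurable_EFinP; apply: measurable_maxr => //; exact: measurableT_comp.
have Xp0 w : setT w -> (0 <= (EFin \o Xp) w)%E by rewrite /= lee_fin le_max lexx orbT.
have Xn0 w : setT w -> (0 <= (EFin \o Xn) w)%E by rewrite /= lee_fin le_max lexx orbT.
pose gp := nnsfun_approx measurableT mXp; pose gn := nnsfun_approx measurableT mXn.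
pose Y k w := gp k w - gn k w.
have gpX k w : 0 <= gp k w <= Xp w.
  apply/andP; split; first exact: fun_ge0.
  by have := @le_approx _ _ _ _ _ k w Xp0 I; rewrite -(nnsfun_approxE measurableT mXp) lee_fin.
have gnX k w : 0 <= gn k w <= Xn w.
  apply/andP; split; first exact: fun_ge0.
  by have := @le_approx _ _ _ _ _ k w Xn0 I; rewrite -(nnsfun_approxE measurableT mXn) lee_fin.
have mY k : measurable_fun setT (Y k) by apply: measurable_funB.
have XYle k w : `|X w - Y k w| <= `|X w|.
  have /andP[a1 a2] := gpX k w; have /andP[b1 b2] := gnX k w.
  rewrite /Y; have [[x0 [e1 e2]]|[x0 [e1 e2]]] := Xpn w; rewrite e1 e2 in a2 b2 *.
    by rewrite [X in _ <= X]ger0_norm// ger0_norm; lra.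
  by rewrite [X in _ <= X]ler0_norm ?ler0_norm; lra.
have Yle k w : `|Y k w| <= `|X w + X w|.
  have -> : Y k w = X w - (X w - Y k w) by ring.
  apply: le_trans (ler_normB _ _) _; apply: le_trans (lerD (lexx _) (XYle k w)) _.
  by rewrite -mulr2n -mulr2n normrMn.
have Ycvg w : Y k w @[k --> \oo] --> X w.
  have e1 : X w = Xp w - Xn w.
    by have [[x0 [-> ->]]|[x0 [-> ->]]] := Xpn w; lra.
  rewrite e1; apply: cvgB.
    by have /fine_cvgP[] := @cvg_nnsfun_approx _ _ _ _ measurableT _ mXp Xp0 w I.
  by have /fine_cvgP[] := @cvg_nnsfun_approx _ _ _ _ measurableT _ mXn Xn0 w I.
have mXY k : measurable_fun setT (fun w => X w - Y k w) by exact: measurable_funB.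
have [] := @dominated_convergence _ _ _ P setT measurableT
  (fun k w => (`|X w - Y k w| `^ q)%:E) (fun=> 0%E) (fun w => (`|X w| `^ q)%:E).
- by move=> k; exact: measurable_abs_powR.
- exact: measurable_cst.
- apply: aeW => w _; apply: cvg_EFin; first by apply: nearW => k.
  have c0 : X w - Y k w @[k --> \oo] --> (0 : R).
    by rewrite -(subrr (X w)); apply: cvgB => //; exact: cvg_cst.
  have := cvg_comp _ _ c0 (@abs_powR_continuous R q q0 0).
  by rewrite normr0 powR0 ?gt_eqF.
- exact: fin_integrable.
- apply: aeW => w k _; rewrite gee0_abs ?lee_fin ?powR_ge0//.
  exact: le_powR.
move=> _ _; rewrite integral0 => /fine_cvgP[_ /cvgrPdist_lt/(_ (e `^ q))].
rewrite powR_gt0// => /(_ isT)[k _ /(_ k (leqnn k))] /=.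
rewrite sub0r normrN => hk.
have fXY : fin q (fun w => X w - Y k w) by exact: fin_le fX (XYle k).
exists (Y k); split=> //.
- by have := fimfunP [the {fimfun T >-> R} of gp k \- gn k].
- by apply: fin_le (finD q1 fX fX) (Yle k).
apply: (@le_powR_inv _ q) => //; first exact: ltW.
rewrite -lee_fin -poweR_EFin -finE// LN_pow ?gt_eqF//.
have fi : (\int[P]_w (`|X w - Y k w| `^ q)%:E)%E \is a fin_num.
  by rewrite -LN_pow ?gt_eqF// (finE fXY) poweR_EFin.
rewrite -(fineK fi) lee_fin; apply: le_trans (ltW hk); exact: ler_norm.
Qed.

End LqNorm.

(** * Simple random families *)

Section SimpleFamilies.
Context {R : realType} {d : measure_display} {T : measurableType d}.
Variable P : probability T R.
Variable n : nat.
Implicit Types (A : 'I_n -> T -> R) (q : R).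

(** Finitely many simple random variables take their values jointly along one finite partition; the
    index of the cell is [key w]. *)
Definition simple_family A := exists (K : finType) (key : T -> K) (a : K -> 'I_n -> R),
  (forall k, measurable [set w | key w = k]) /\ forall i w, A i w = a (key w) i.

Lemma simple_familyP A :
  (forall i, measurable_fun setT (A i) /\ finite_set (range (A i))) -> simple_family A.
Proof.
move=> hA.
have /choice[L hL] : forall i, exists L : seq R, range (A i) = [set` L].
  by move=> i; have [_ /finite_seqP] := hA i.
pose LL := flatten [seq L i | i <- enum 'I_n].
have inLL i w : A i w \in LL.
  apply/flattenP; exists (L i); first by apply/mapP; exists i; rewrite ?mem_enum.
  have : range (A i) (A i w) by exists w.
  by rewrite hL.
pose K := {ffun 'I_n -> seq_sub LL}.
exists K, (fun w => [ffun i => SeqSub (inLL i w)]), (fun (k : K) i => ssval (k i)).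
split; last by move=> i w; rewrite ffunE.
move=> k.
have -> : [set w | [ffun i => SeqSub (inLL i w)] = k] =
    \bigcap_(i in [set: 'I_n]) (A i @^-1` [set ssval (k i)]).
  apply/seteqP; split=> w /=.
    by move=> <- i _ /=; rewrite ffunE.
  by move=> h; apply/ffunP => i; rewrite ffunE; apply: val_inj; rewrite /=; exact: h.
apply: fin_bigcap_measurable; first exact: finite_finset.
move=> i _; have [mA _] := hA i.
by rewrite -[X in measurable X]setTI; apply: mA => //; exact: measurable_set1.
Qed.

Section Keyed.
Variables (K : finType) (key : T -> K).
Hypothesis mkey : forall k, measurable [set w | key w = k].

Definition kprob k : R := fine (P [set w | key w = k]).

Lemma kprob_ge0 k : 0 <= kprob k.
Proof. by rewrite fine_ge0. Qed.

Lemma integral_keyed (g : K -> R) : (forall k, 0 <= g k) ->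
  (\int[P]_w (g (key w))%:E)%E = (\sum_k g k * kprob k)%:E.
Proof.
move=> g0.
have -> : (\int[P]_w (g (key w))%:E)%E =
    (\int[P]_w \sum_(k <- index_enum K) ((g k)%:E * (\1_[set w | key w = k] w)%:E))%E.
  apply: eq_integral => w _; rewrite (bigD1 (key w))//= big1 ?adde0.
    by rewrite indicE mem_set// mule1.
  move=> k kw; rewrite indicE memNset ?mule0//=.
  by move=> e; move: kw; rewrite e eqxx.
have mI k : measurable_fun setT (fun w => (\1_[set w | key w = k] w)%:E : \bar R).
  by apply/measurable_EFinP; exact: measurable_indic.
rewrite ge0_integral_sum//; last 2 first.
- by move=> k; apply: emeasurable_funM => //; exact: measurable_cst.
- by move=> k w _; rewrite mule_ge0// lee_fin// indicE.
rewrite -sumEFin; apply: eq_bigr => k _.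
rewrite (@ge0_integralZl _ _ _ P setT measurableT (fun w => (\1_[set w | key w = k] w)%:E)); first last.
- by rewrite lee_fin.
- by move=> w _; rewrite lee_fin indicE.
- exact: mI.
rewrite integral_indic// setIT EFinM /kprob fineK//.
exact: fin_num_measure.
Qed.

Lemma LN_keyed q (g : K -> R) : 0 < q ->
  LN P q (fun w => g (key w)) = ((\sum_k `|g k| `^ q * kprob k) `^ q^-1)%:E.
Proof.
move=> q0; rewrite LNE (integral_keyed (g := fun k => `|g k| `^ q)) ?poweR_EFin//.
Qed.

Lemma measurable_keyed (g : K -> R) : measurable_fun setT (fun w => g (key w)).
Proof.
move=> _ B mB; rewrite setTI.
have -> : (fun w => g (key w)) @^-1` B =
    \bigcup_(k in [set k | B (g k)]) [set w | key w = k].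
  apply/seteqP; split=> w /=; first by move=> h; exists (key w).
  by move=> [k /= hk ->].
by apply: fin_bigcup_measurable => //; exact: finite_finset.
Qed.

End Keyed.
End SimpleFamilies.

(** * From lattice norms to scalar norms *)

Section Transfer.
Context {R : realType} (E : banachLatticeType R).
Context {d : measure_display} {T : measurableType d}.
Variable P : probability T R.
Variable N : E -> R.
Variables al be : R.
Hypothesis al0 : 0 < al.
Hypothesis be0 : 0 < be.
Hypothesis ND : forall x y, N (x + y) <= N x + N y.
Hypothesis NZ : forall (a : R) x, N (a *: x) = `|a| * N x.
Hypothesis Nlb : forall x, al * `|x| <= N x.
Hypothesis Nub : forall x, N x <= be * `|x|.
Variables (n : nat) (f : 'I_n -> E).
Implicit Types (A B : 'I_n -> T -> R) (q : R).

Lemma equiv_ge0 x : 0 <= N x.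
Proof. by apply: le_trans (Nlb x); rewrite mulr_ge0// ltW. Qed.

Definition comb A w : E := \sum_i A i w *: f i.

(** The [L^q]-norm of a combination of the [A i] as a function of its coefficients.  Its value at [f] in
    the calculus is what a lattice-valued [L^q]-norm taken inside the lattice would be. *)
Definition scal A q (v : 'rV[R]_n) : R := nq P q (fun w => \sum_i A i w * v ord0 i).

Lemma kc_comb (a : 'I_n -> R) :
  kc f (fun v => \sum_i a i * v ord0 i) = \sum_i a i *: f i.
Proof.
apply: (krivine_elementary (krivine_kc f)).
by apply: elementary_sum => i; apply: elementaryZ; exact: elementary_coord.
Qed.

Lemma pos_homogeneous_comb (a : 'I_n -> R) :
  pos_homogeneous (fun v : 'rV[R]_n => \sum_i a i * v ord0 i).
Proof.
have h : elementary f (fun v : 'rV[R]_n => \sum_i a i * v ord0 i) (\sum_i a i *: f i).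
  by apply: elementary_sum => i; apply: elementaryZ; exact: elementary_coord.
exact: elementary_poshom h.
Qed.

Lemma fin_comb A q (v : 'rV[R]_n) : 1 <= q -> (forall i, fin P q (A i)) ->
  fin P q (fun w => \sum_i A i w * v ord0 i).
Proof.
move=> q1 fA; apply: fin_sum => // i.
under eq_fun do rewrite mulrC; apply: finZ => //; exact: lt_le_trans q1.
Qed.

Lemma scal_diff A B q (v : 'rV[R]_n) : 1 <= q -> (forall i, fin P q (A i)) -> (forall i, fin P q (B i)) ->
  scal A q v <= scal B q v + (\sum_i nq P q (fun w => A i w - B i w)) * norm1 v.
Proof.
move=> q1 fA fB; have q0 : 0 < q by exact: lt_le_trans q1.
have fAB i : fin P q (fun w => A i w - B i w).
  under eq_fun do rewrite -mulN1r.
  by apply: finD => //; exact: finZ.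
have fABv i : fin P q (fun w => (A i w - B i w) * v ord0 i).
  by under eq_fun do rewrite mulrC; exact: finZ.
rewrite /scal.
have -> : (fun w => \sum_i A i w * v ord0 i) =
   (fun w => \sum_i B i w * v ord0 i + \sum_i (A i w - B i w) * v ord0 i).
  by apply/funext => w; rewrite -big_split/=; apply: eq_bigr => i _; ring.
apply: le_trans (nqD q1 _ _) _; [exact: fin_comb|exact: fin_sum|].
rewrite lerD2l; apply: le_trans (nq_sum _ q1 fABv) _.
rewrite mulr_suml; apply: ler_sum => i _.
have -> : nq P q (fun w => (A i w - B i w) * v ord0 i) = `|v ord0 i| * nq P q (fun w => A i w - B i w).
  by rewrite -nqZ//; congr nq; apply/funext => w; rewrite mulrC.
rewrite mulrC; apply: ler_wpM2l; first exact: nq_ge0.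
by rewrite /norm1 (bigD1 i)//= lerDl sumr_ge0.
Qed.

Lemma norm1_sub_continuous (v : 'rV[R]_n) : continuous (fun u : 'rV[R]_n => norm1 (u - v)).
Proof.
rewrite /norm1; elim: (index_enum _) => [|i r IH].
  by under eq_fun do rewrite big_nil; exact: cst_continuous.
have ci : continuous (fun u : 'rV[R]_n => `|(u - v) ord0 i|).
  have -> : (fun u : 'rV[R]_n => `|(u - v) ord0 i|) =
      (fun u => `|1 * u ord0 i + (- v ord0 i)|).
    by apply/funext => u; rewrite !mxE mul1r.
  have c2 := @continuous_lin R n 1 (fun u => u ord0 i) (fun=> - v ord0 i)
    (@coord_continuous _ _ _ ord0 i) (@cst_continuous _ _ _).
  move=> u; exact: (@continuous_comp _ _ _ _ (fun a : R => `|a|) u (c2 u) (@norm_continuous _ R _)).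
have -> : (fun u : 'rV[R]_n => \sum_(j <- i :: r) `|(u - v) ord0 j|) =
    (fun u => 1 * `|(u - v) ord0 i| + \sum_(j <- r) `|(u - v) ord0 j|).
  by apply/funext => u; rewrite big_cons mul1r.
exact: continuous_lin ci IH.
Qed.

Lemma scal_poshom A q : 1 <= q -> (forall i, fin P q (A i)) -> pos_homogeneous (scal A q).
Proof.
move=> q1 fA; have q0 : 0 < q by exact: lt_le_trans q1.
split; last first.
  move=> a v a0; rewrite /scal -{2}(ger0_norm a0) -nqZ//; last exact: fin_comb.
  congr nq; apply/funext => w; rewrite mulr_sumr; apply: eq_bigr => i _.
  by rewrite mxE mulrCA.
pose C := \sum_i nq P q (A i) + 1.
have C0 : 0 < C by rewrite ltr_wpDl// sumr_ge0// => i _; exact: nq_ge0.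
have lip u v : scal A q u <= scal A q v + C * norm1 (u - v).
  rewrite /scal.
  have -> : (fun w => \sum_i A i w * u ord0 i) =
     (fun w => \sum_i A i w * v ord0 i + \sum_i A i w * (u - v) ord0 i).
    apply/funext => w; rewrite -big_split/=; apply: eq_bigr => i _.
    by rewrite !mxE; ring.
  apply: le_trans (nqD q1 _ _) _; try exact: fin_comb.
  rewrite lerD2l; apply: le_trans (nq_sum _ q1 _) _ => [i|].
    by under eq_fun do rewrite mulrC; exact: finZ.
  rewrite /C /norm1 mulr_sumr; apply: ler_sum => i _.
  have -> : nq P q (fun w => A i w * (u - v) ord0 i) = `|(u - v) ord0 i| * nq P q (A i).
    by rewrite -nqZ//; congr nq; apply/funext => w; rewrite mulrC.
  rewrite mulrC; apply: ler_wpM2r => //.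
  rewrite (bigD1 i)//= -addrA lerDl addr_ge0// sumr_ge0// => j _; exact: nq_ge0.
have n1c : continuous (@norm1 R n) by have [] := elementary_poshom (elementary_norm1 f).
move=> v.
have cc := @norm1_sub_continuous v.
have c1 : C * norm1 (u - (v : 'rV[R]_n)) @[u --> v] --> (0 : R).
  have := @continuous_lin _ _ C _ _ cc (@cst_continuous _ _ 0) v.
  rewrite /continuous_at subrr (_ : norm1 0 = 0) ?mulr0 ?addr0//; last first.
    by rewrite /norm1 big1// => i _; rewrite mxE normr0.
  by under eq_fun do rewrite addr0.
apply/(@cvgrPdist_lt _ _ _ _ (nbhs_filter (v : 'rV[R]_n))) => e e0.
move: c1 => /(@cvgrPdist_lt _ _ _ _ (nbhs_filter (v : 'rV[R]_n)))/(_ _ e0).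
apply: filterS => u; rewrite sub0r normrN => hu.
have hu' : C * norm1 (u - v) < e by apply: le_lt_trans hu; exact: ler_norm.
have e1 : norm1 (v - u) = norm1 (u - v).
  by apply: eq_bigr => i _; rewrite !mxE distrC.
have := lip u v; have := lip v u; rewrite e1 ltr_norml => h1 h2.
by apply/andP; split; lra.
Qed.

Section Simple.
Variables (K : finType) (key : T -> K) (a : K -> 'I_n -> R).
Hypothesis mkey : forall k, measurable [set w | key w = k].
Let A i w := a (key w) i.

(** For simple coefficients the function [scal] is a finite [q]-sum of linear forms, one per cell of
    the partition, weighted by the [q]-th root of its probability. *)
Lemma kc_scal_simple q : 1 <= q ->
  kc f (scal A q) =
  lps q [seq kprob P key k `^ q^-1 *: \sum_i a k i *: f i | k <- index_enum K].
Proof.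
move=> q1; have q0 : 0 < q by exact: lt_le_trans q1.
pose F k (v : 'rV[R]_n) := kprob P key k `^ q^-1 * \sum_i a k i * v ord0 i.
have FE k : kprob P key k `^ q^-1 *: \sum_i a k i *: f i = kc f (F k).
  by rewrite /F (krivineZ (krivine_kc f)) ?kc_comb//; exact: pos_homogeneous_comb.
under eq_map do rewrite FE.
rewrite lps_kc//; last by move=> k; apply: pos_homogeneousZ; exact: pos_homogeneous_comb.
congr kc; apply/funext => v.
rewrite /scal /nq (LN_keyed P mkey (fun k => \sum_i a k i * v ord0 i))// /= lp_seqE.
congr (_ `^ _); apply: eq_bigr => k _; rewrite /F normrM powRM//.
by rewrite ger0_norm ?powR_ge0// root_powR ?kprob_ge0// mulrC.
Qed.

(** The [L^q(N)]-norm is the [q]-sum of the norms of the same weighted values that occur in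
    [kc_scal_simple]; hence concavity and convexity compare the two sides. *)
Lemma LN_comb_simple q : 0 < q ->
  LN P q (fun w => N (comb A w)) =
  ((\sum_(k : K) N (kprob P key k `^ q^-1 *: \sum_i a k i *: f i) `^ q) `^ q^-1)%:E.
Proof.
move=> q0; rewrite (LN_keyed P mkey (fun k => N (\sum_i a k i *: f i)))//.
congr ((_ `^ _)%:E); apply: eq_bigr => k _; rewrite NZ powRM ?equiv_ge0//.
rewrite !ger0_norm ?powR_ge0 ?equiv_ge0// root_powR ?kprob_ge0//.
exact: mulrC.
Qed.

Lemma kc_scal_ge0 q : 1 <= q -> babs (kc f (scal A q)) = kc f (scal A q).
Proof. by move=> q1; rewrite kc_scal_simple// babs_lps//; exact: lt_le_trans q1. Qed.

Lemma concave_simple q : 1 <= q ->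
  (forall s w, ble (lps q s) (babs w) -> \sum_(x <- s) N x `^ q <= N w `^ q) ->
  (LN P q (fun w => N (comb A w)) <= (N (kc f (scal A q)))%:E)%E.
Proof.
move=> q1 hN; have q0 : 0 < q by exact: lt_le_trans q1.
rewrite LN_comb_simple// lee_fin; apply: (@le_powR_inv _ q) => //; first exact: equiv_ge0.
rewrite root_powR//; last by apply: sumr_ge0 => *; exact: powR_ge0.
have := hN [seq kprob P key k `^ q^-1 *: \sum_i a k i *: f i | k <- index_enum K] (kc f (scal A q)).
rewrite big_map; apply; rewrite kc_scal_ge0// kc_scal_simple//; exact: ble_refl.
Qed.

Lemma convex_simple q : 1 <= q ->
  (forall s w, ble (babs w) (lps q s) -> N w `^ q <= \sum_(x <- s) N x `^ q) ->
  ((N (kc f (scal A q)))%:E <= LN P q (fun w => N (comb A w)))%E.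
Proof.
move=> q1 hN; have q0 : 0 < q by exact: lt_le_trans q1.
rewrite LN_comb_simple// lee_fin; apply: (@le_powR_inv _ q) => //; first exact: powR_ge0.
rewrite root_powR//; last by apply: sumr_ge0 => *; exact: powR_ge0.
have := hN [seq kprob P key k `^ q^-1 *: \sum_i a k i *: f i | k <- index_enum K] (kc f (scal A q)).
rewrite big_map; apply; rewrite kc_scal_ge0// kc_scal_simple//; exact: ble_refl.
Qed.

End Simple.
End Transfer.

(** * Transfer for arbitrary coefficients *)

Section GeneralTransfer.
Import HBSimple.
Import HBNNSimple.
Context {R : realType} (E : banachLatticeType R).
Context {d : measure_display} {T : measurableType d}.
Variable P : probability T R.
Variable N : E -> R.
Variables al be : R.
Hypothesis al0 : 0 < al.
Hypothesis be0 : 0 < be.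
Hypothesis ND : forall x y, N (x + y) <= N x + N y.
Hypothesis NZ : forall (a : R) x, N (a *: x) = `|a| * N x.
Hypothesis Nlb : forall x, al * `|x| <= N x.
Hypothesis Nub : forall x, N x <= be * `|x|.
Variables (n : nat) (f : 'I_n -> E).
Implicit Types (A B : 'I_n -> T -> R) (q : R).

Let N0 := equiv_ge0 al0 Nlb.

Lemma equiv_sub x y : N x <= N y + be * `|x - y|.
Proof.
rewrite -{1}(subrKC y x); apply: le_trans (ND _ _) _.
by rewrite lerD2l.
Qed.

Lemma comb_sub A B w :
  N (comb f A w) <= N (comb f B w) + \sum_i (be * `|f i|) * `|A i w - B i w|.
Proof.
apply: le_trans (equiv_sub _ (comb f B w)) _; rewrite lerD2l /comb -sumrB.
apply: le_trans (ler_wpM2l (ltW be0) (ler_norm_sum _ _ _)) _.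
rewrite mulr_sumr; apply: ler_sum => i _.
by rewrite -scalerBl normrZ -mulrA [`|f i| * _]mulrC.
Qed.

Lemma measurable_comb_simple A :
  (forall i, measurable_fun setT (A i) /\ finite_set (range (A i))) ->
  measurable_fun setT (fun w => N (comb f A w)).
Proof.
move=> /simple_familyP[K [key [a [mkey aE]]]].
have -> : (fun w => N (comb f A w)) = (fun w => N (\sum_i a (key w) i *: f i)).
  by apply/funext => w; congr N; apply: eq_bigr => i _; rewrite aE.
exact: (measurable_keyed mkey (fun k => N (\sum_i a k i *: f i))).
Qed.

Lemma measurable_comb A : (forall i, measurable_fun setT (A i)) ->
  measurable_fun setT (fun w => N (comb f A w)).
Proof.
move=> mA.
have /choice[g hg] : forall i, exists g : nat -> T -> R,
    (forall k, measurable_fun setT (g k) /\ finite_set (range (g k))) /\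
    forall w, g k w @[k --> \oo] --> A i w.
  move=> i; have mAi : measurable_fun setT (EFin \o A i) by exact/measurable_EFinP.
  have [g hg] := approximation_sfun measurableT mAi.
  exists (fun k => g k : T -> R); split.
    by move=> k; split; [exact: measurable_funPT|exact: fimfunP].
  by move=> w; have /fine_cvgP[] := hg w I.
apply: (@measurable_fun_cvg _ _ _ _ (fun k w => N (comb f (fun i => g i k) w))).
  move=> k; apply: measurable_comb_simple => i; by case: (hg i).
move=> w _; apply/cvgrPdist_lt => e e0.
have cS : \sum_i (be * `|f i|) * `|A i w - g i k w| @[k --> \oo] --> (0 : R).
  elim: (index_enum _) => [|i r IH].
    by under eq_fun do rewrite big_nil; exact: cvg_cst.
  have ci : be * `|f i| * `|A i w - g i k w| @[k --> \oo] --> (0 : R).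
    have c1 : A i w - g i k w @[k --> \oo] --> A i w - A i w.
      by apply: (@cvgB R R); [exact: cvg_cst|case: (hg i) => _].
    have c2 : `|A i w - g i k w| @[k --> \oo] --> (0 : R).
      have -> : (0 : R) = `|A i w - A i w| by rewrite subrr normr0.
      exact: cvg_norm c1.
    have c3 : be * `|f i| @[k --> \oo] --> be * `|f i| by exact: cvg_cst.
    have c4 := cvgM c3 c2; rewrite mulr0 in c4; exact: c4.
  have c5 := cvgD ci IH; rewrite addr0 in c5.
  by under eq_fun do rewrite big_cons; exact: c5.
have /cvgrPdist_lt/(_ _ e0) := cS; apply: filterS => k; rewrite sub0r normrN => h.
have {}h := le_lt_trans (ler_norm _) h.
have h1 := comb_sub A (fun i => g i k) w; have h2 := comb_sub (fun i => g i k) A w.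
have hs : \sum_i be * `|f i| * `|g i k w - A i w| = \sum_i be * `|f i| * `|A i w - g i k w|.
  by apply: eq_bigr => i _; rewrite distrC.
rewrite hs in h2.
by rewrite ltr_norml; apply/andP; split; lra.
Qed.

Section Approximation.
Variables (A B : 'I_n -> T -> R) (q e : R).
Hypothesis q1 : 1 <= q.
Hypothesis fA : forall i, fin P q (A i).
Hypothesis fB : forall i, fin P q (B i).
Hypothesis hAB : forall i, nq P q (fun w => A i w - B i w) <= e.

(** A common Lipschitz constant of the two sides of the transfer, as functions of the coefficients. *)
Definition approx_const : R := be * (n.+1%:R * \sum_i `|f i|).

Let q0 : 0 < q. Proof. exact: lt_le_trans q1. Qed.

Let fAB i : fin P q (fun w => A i w - B i w).
Proof.
under eq_fun do rewrite -mulN1r.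
by apply: finD => //; exact: finZ.
Qed.

Let e0 : (0 < n)%N -> 0 <= e.
Proof. by case: n A B hAB => // k A' B' h _; apply: le_trans (h ord0); exact: nq_ge0. Qed.

Lemma LN_comb_approx :
  (LN P q (fun w => N (comb f A w)) <=
   LN P q (fun w => N (comb f B w)) + (e * approx_const)%:E)%E.
Proof.
pose D w := \sum_i (be * `|f i|) * `|A i w - B i w|.
have fD : fin P q D.
  by apply: fin_sum => // i; apply: finZ => //; exact: fin_abs.
have mA : measurable_fun setT (fun w => N (comb f A w)).
  by apply: measurable_comb => i; case: (fA i).
have mB : measurable_fun setT (fun w => N (comb f B w)).
  by apply: measurable_comb => i; case: (fB i).
have D0 w : 0 <= D w by apply: sumr_ge0 => i _; rewrite !mulr_ge0// ltW.
apply: (@le_trans _ _ (LN P q (fun w => N (comb f B w) + D w))).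
  apply: le_LN => //; first by apply: measurable_funD => //; case: fD.
  move=> w; rewrite !ger0_norm ?addr_ge0//; exact: comb_sub.
apply: le_trans (LND P q1 mB (proj1 fD)) _; rewrite leeD2l// (finE fD) lee_fin.
have fi i : fin P q (fun w => (be * `|f i|) * `|A i w - B i w|).
  by apply: finZ => //; exact: fin_abs.
apply: le_trans (nq_sum _ q1 fi) _.
apply: (@le_trans _ _ (\sum_i (be * `|f i|) * e)).
  apply: ler_sum => i _; rewrite nqZ//; last exact: fin_abs.
  rewrite ger0_norm ?mulr_ge0 ?(ltW be0)//; apply: ler_wpM2l; first by rewrite mulr_ge0// ltW.
  by rewrite nq_abs.
rewrite -mulr_suml mulrC -mulr_sumr /approx_const.
case: (posnP n) => [n0|n0].
  have -> : \sum_i `|f i| = 0 by apply: big1 => i _; have := ltn_ord i; rewrite [X in (_ < X)%N]n0.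
  by rewrite !mulr0.
apply: ler_wpM2l; first exact: e0.
apply: ler_wpM2l; first exact: ltW.
by apply: ler_peMl; [exact: sumr_ge0|rewrite ler1n].
Qed.

Lemma kc_scal_approx : N (kc f (scal P A q)) <= N (kc f (scal P B q)) + e * approx_const.
Proof.
apply: le_trans (equiv_sub _ (kc f (scal P B q))) _; rewrite lerD2l.
rewrite /approx_const mulrCA; apply: ler_wpM2l; first exact: ltW.
rewrite mulrA; case: (posnP n) => [n0|n0].
  have -> : \sum_i `|f i| = 0 by apply: big1 => i _; have := ltn_ord i; rewrite [X in (_ < X)%N]n0.
  rewrite mulr0; have := @krivine_close _ _ _ f _ (krivine_kc f) _ _ 0
    (scal_poshom f q1 fA) (scal_poshom f q1 fB) (lexx 0).
  rewrite mul0r; apply => v; rewrite mul0r.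
  have -> : scal P A q v = scal P B q v.
    by congr nq; apply/funext => w; rewrite !big1// => i; have := ltn_ord i; rewrite [X in (_ < X)%N]n0.
  by rewrite subrr normr0.
apply: (krivine_close (krivine_kc f)).
- exact: (scal_poshom f).
- exact: (scal_poshom f).
- by rewrite mulr_ge0// e0.
move=> v.
have S1 : \sum_i nq P q (fun w => A i w - B i w) <= e * n.+1%:R.
  apply: (@le_trans _ _ (\sum_(i < n) e)); first exact: ler_sum.
  rewrite sumr_const card_ord -[e *+ n]mulr_natr; by apply: ler_wpM2l; [exact: e0|rewrite ler_nat].
have S2 : \sum_i nq P q (fun w => B i w - A i w) <= e * n.+1%:R.
  apply: le_trans S1; apply: ler_sum => i _.
  by rewrite -[leRHS]nq_abs -[leLHS]nq_abs; under eq_fun do rewrite distrC.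
have h1 := scal_diff v q1 fA fB; have h2 := scal_diff v q1 fB fA.
have n0' := norm1_ge0 v.
have := ler_wpM2r n0' S1; have := ler_wpM2r n0' S2; rewrite ler_norml => h3 h4.
by apply/andP; split; lra.
Qed.

End Approximation.

Lemma simple_approximations A q (e : R) : 1 <= q -> (forall i, fin P q (A i)) -> 0 < e ->
  exists B, [/\ (forall i, measurable_fun setT (B i) /\ finite_set (range (B i))),
    forall i, fin P q (B i), forall i, nq P q (fun w => A i w - B i w) <= e &
    forall i, nq P q (fun w => B i w - A i w) <= e].
Proof.
move=> q1 fA e0.
have /choice[B hB] : forall i, exists Y, [/\ measurable_fun setT Y, finite_set (range Y),
    fin P q Y & nq P q (fun w => A i w - Y w) <= e].
  by move=> i; exact: simple_approximation.
exists B; split=> i; have [h1 h2 h3 h4] := hB i => //.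
by apply: le_trans h4; rewrite -[leRHS]nq_abs -[leLHS]nq_abs; under eq_fun do rewrite distrC.
Qed.

Lemma lee_eps (x : \bar R) (y C : R) : (forall e : R, 0 < e -> (x <= (y + e * C)%:E)%E) ->
  (x <= y%:E)%E.
Proof.
move=> h; apply/lee_addgt0Pr => e e0.
have C0 : 0 < `|C| + 1 by rewrite ltr_wpDl.
apply: le_trans (h (e / (`|C| + 1)) _) _; first by rewrite divr_gt0.
rewrite -EFinD lee_fin lerD2l mulrAC ler_pdivrMr//; apply: ler_wpM2l; first exact: ltW.
by apply: le_trans (ler_norm _) _; rewrite lerDl.
Qed.

(** Taking the [L^q]-norm inside the lattice increases the norm, for a [q]-concave norm.  Both sides
    are continuous in the coefficients for the [L^q]-norm, so simple coefficients suffice. *)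
Theorem concave_transfer A q : 1 <= q -> (forall i, fin P q (A i)) ->
  (forall s w, ble (lps q s) (babs w) -> \sum_(x <- s) N x `^ q <= N w `^ q) ->
  (LN P q (fun w => N (comb f A w)) <= (N (kc f (scal P A q)))%:E)%E.
Proof.
move=> q1 fA hN; apply: (@lee_eps _ _ (approx_const + approx_const)) => e e0.
have [B [sB fB hAB hBA]] := simple_approximations q1 fA e0.
apply: le_trans (LN_comb_approx q1 fA fB hAB) _.
have [K [key [a [mkey aE]]]] := simple_familyP sB.
have BE : B = (fun i w => a (key w) i) by apply/funext => i; apply/funext => w.
have h : (LN P q (fun w => N (comb f B w)) <= (N (kc f (scal P B q)))%:E)%E.
  by rewrite BE; exact: (concave_simple P al0 NZ Nlb f a mkey q1 hN).
have h' := kc_scal_approx q1 fB fA hBA.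
rewrite mulrDr addrA EFinD; apply: leeD => //; apply: le_trans h _.
by rewrite lee_fin.
Qed.

(** The opposite inequality for a convex norm; finiteness of the right-hand side is needed before
    passing to the limit. *)
Theorem convex_transfer A q : 1 <= q -> (forall i, fin P q (A i)) ->
  (forall s w, ble (babs w) (lps q s) -> N w `^ q <= \sum_(x <- s) N x `^ q) ->
  ((N (kc f (scal P A q)))%:E <= LN P q (fun w => N (comb f A w)))%E.
Proof.
move=> q1 fA hN.
have fNA : (LN P q (fun w => N (comb f A w)) < +oo)%E.
  have [B [sB fB hAB hBA]] := simple_approximations q1 fA (ltr01 : 0 < (1 : R)).
  apply: le_lt_trans (LN_comb_approx q1 fA fB hAB) _.
  have [K [key [a [mkey aE]]]] := simple_familyP sB.
  have BE : B = (fun i w => a (key w) i) by apply/funext => i; apply/funext => w.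
  by rewrite BE (LN_comb_simple P al0 NZ Nlb f a mkey (lt_le_trans ltr01 q1)) -EFinD ltry.
have LE : LN P q (fun w => N (comb f A w)) = (nq P q (fun w => N (comb f A w)))%:E.
  by rewrite /nq fineK// ge0_fin_numE// LN_ge0.
rewrite LE; apply: (@lee_eps _ _ (approx_const + approx_const)) => e e0.
have [B [sB fB hAB hBA]] := simple_approximations q1 fA e0.
rewrite mulrDr addrA EFinD.
have h' := kc_scal_approx q1 fA fB hAB.
apply: le_trans (_ : ((N (kc f (scal P B q)) + e * approx_const)%:E <= _)%E).
  by rewrite lee_fin.
rewrite EFinD leeD2r//.
have [K [key [a [mkey aE]]]] := simple_familyP sB.
have BE : B = (fun i w => a (key w) i) by apply/funext => i; apply/funext => w.
apply: (@le_trans _ _ (LN P q (fun w => N (comb f B w)))).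
  by rewrite BE; exact: (convex_simple P al0 NZ Nlb f a mkey q1 hN).
by rewrite EFinD -LE; exact: LN_comb_approx.
Qed.

End GeneralTransfer.

(** * Integrals against a law *)

Section ChangeOfVariables.
Context {R : realType}.
Import HBSimple.
Import HBNNSimple.

(** Weighted laws that are proportional on all Borel sets are proportional against all nonnegative
    functions, by monotone approximation with simple functions.  Independence, densities and equality
    in law are instances. *)
Lemma integral_weighted d (T : measurableType d) (mu : {measure set T -> \bar R})
    d' (T' : measurableType d') (nu : {measure set T' -> \bar R})
    (X W : T -> R) (X' W' : T' -> R) (K : \bar R) (phi : R -> R) :
  measurable_fun setT X -> measurable_fun setT W ->
  measurable_fun setT X' -> measurable_fun setT W' -> measurable_fun setT phi ->
  (forall w, 0 <= W w) -> (forall w, 0 <= W' w) -> (forall x, 0 <= phi x) ->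
  (0 <= K)%E -> K \is a fin_num ->
  (forall B, measurable B -> (\int[mu]_w (\1_B (X w) * W w)%:E =
    (\int[nu]_w (\1_B (X' w) * W' w)%:E) * K)%E) ->
  (\int[mu]_w (phi (X w) * W w)%:E = (\int[nu]_w (phi (X' w) * W' w)%:E) * K)%E.
Proof.
move=> mX mW mX' mW' mphi W0 W'0 phi0 K0 Kfin hB.
have mphiE : measurable_fun setT (EFin \o phi) by exact/measurable_EFinP.
have phiE0 x : setT x -> (0 <= (EFin \o phi) x)%E by rewrite /= lee_fin.
pose g := nnsfun_approx measurableT mphiE.
have simple k : (\int[mu]_w (g k (X w) * W w)%:E = (\int[nu]_w (g k (X' w) * W' w)%:E) * K)%E.
  have [|Q [key [a0 [mkey aE]]]] := @simple_familyP R _ R 1 (fun=> g k : R -> R).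
    by move=> _; split; [exact: measurable_funPT|exact: fimfunP].
  pose a q : R := Num.max (a0 q ord0) 0.
  have a_ge0 q : 0 <= a q by rewrite le_max lexx orbT.
  have gE x : g k x = a (key x) by rewrite /a -(aE ord0) max_l// fun_ge0.
  pose B q := [set x | key x = q].
  have key1 d1 (T1 : measurableType d1) (mu1 : {measure set T1 -> \bar R}) (X1 Z : T1 -> R) :
      measurable_fun setT X1 -> measurable_fun setT Z -> (forall w, 0 <= Z w) ->
      (\int[mu1]_w (g k (X1 w) * Z w)%:E =
       \sum_(q <- index_enum Q) (a q)%:E * \int[mu1]_w (\1_(B q) (X1 w) * Z w)%:E)%E.
    move=> mX1 mZ Z0.
    have sumB w : ((g k (X1 w) * Z w)%:E =
        \sum_(q <- index_enum Q) (a q)%:E * (\1_(B q) (X1 w) * Z w)%:E)%E.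
      rewrite (bigD1 (key (X1 w)))//= big1 ?adde0 => [|q qw].
        by rewrite indicE mem_set//= mul1r gE -EFinM.
      rewrite indicE memNset ?mul0r ?mule0//= => e; by move: qw; rewrite e eqxx.
    have mI q : measurable_fun setT (fun w => \1_(B q) (X1 w) : R).
      have m1 : measurable_fun setT (\1_(B q) : R -> R) by apply: measurable_indic; exact: mkey.
      exact: (measurableT_comp m1 mX1).
    have I0 q w : 0 <= \1_(B q) (X1 w) :> R by rewrite indicE.
    under eq_integral do rewrite sumB.
    have mIZ q : measurable_fun setT (fun w => (\1_(B q) (X1 w) * Z w)%:E : \bar R).
      by apply/measurable_EFinP; exact: measurable_funM.
    have IZ0 q w : (0 <= (\1_(B q) (X1 w) * Z w)%:E)%E by rewrite lee_fin mulr_ge0.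
    rewrite ge0_integral_sum//; last 2 first.
    - by move=> q; apply: emeasurable_funM; [exact: measurable_cst|exact: mIZ].
    - by move=> q w _; rewrite mule_ge0// lee_fin.
    apply: eq_bigr => q _.
    rewrite (@ge0_integralZl _ _ _ mu1 setT measurableT (fun w => (\1_(B q) (X1 w) * Z w)%:E)) ?lee_fin//.
  rewrite (key1 _ _ mu X W mX mW W0).
  rewrite (key1 _ _ nu X' W' mX' mW' W'0).
  have I0 q w : 0 <= \1_(B q) (X' w) * W' w by rewrite indicE mulr_ge0.
  rewrite [RHS]muleC ge0_sume_distrr; last first.
    by move=> q _; rewrite mule_ge0 ?lee_fin//; apply: integral_ge0 => w _; rewrite lee_fin.
  apply: eq_bigr => q _; rewrite hB//; last exact: mkey.
  by rewrite [RHS]muleC muleA.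
have ndg : nondecreasing_seq (g : (R -> R)^nat) := nd_nnsfun_approx measurableT mphiE.
have cvgg x : (g k x)%:E @[k --> \oo] --> (phi x)%:E.
  exact: (@cvg_nnsfun_approx _ _ _ _ measurableT _ mphiE phiE0 x I).
have conv d1 (T1 : measurableType d1) (mu1 : {measure set T1 -> \bar R}) (X1 W1 : T1 -> R) :
    measurable_fun setT X1 -> measurable_fun setT W1 -> (forall w, 0 <= W1 w) ->
    (\int[mu1]_w (g k (X1 w) * W1 w)%:E)%E @[k --> \oo] -->
    (\int[mu1]_w (phi (X1 w) * W1 w)%:E)%E.
  move=> mX1 mW1 W10.
  have mg k : measurable_fun setT (fun w => g k (X1 w) : R).
    by apply: (@measurableT_comp _ _ _ _ _ _ (g k)).
  rewrite (_ : (\int[mu1]_w (phi (X1 w) * W1 w)%:E)%E =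
     (\int[mu1]_w limn (fun k => (g k (X1 w) * W1 w)%:E))%E); last first.
    apply: eq_integral => w _; apply/esym/cvg_lim => //.
    under eq_fun do rewrite EFinM; rewrite EFinM; apply: cvgeM => //; last exact: cvg_cst.
  apply: cvg_monotone_convergence => //.
  - by move=> k; apply/measurable_EFinP; apply: measurable_funM.
  - by move=> k w _; rewrite lee_fin mulr_ge0// fun_ge0.
  - by move=> w _ k l kl; rewrite lee_fin ler_wpM2r//; have /lefP := ndg _ _ kl; apply.
have c1 := conv _ _ mu X W mX mW W0.
have c3 : ((\int[nu]_w (g k (X' w) * W' w)%:E) * K)%E @[k --> \oo] --> ((\int[nu]_w (phi (X' w) * W' w)%:E) * K)%E.
  exact: cvgeZr (conv _ _ nu X' W' mX' mW' W'0).
have e : (fun k => \int[mu]_w (g k (X w) * W w)%:E)%E =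
    (fun k => (\int[nu]_w (g k (X' w) * W' w)%:E) * K)%E by apply/funext => k; exact: simple.
by rewrite e in c1; exact: (cvg_unique _ c1 c3).
Qed.

End ChangeOfVariables.

(** * Independence and moments *)

Section Independence.
Context {R : realType} {d : measure_display} {T : measurableType d}.
Variable P : probability T R.

Lemma integral_factor (X W : T -> R) (K : \bar R) (phi : R -> R) :
  measurable_fun setT X -> measurable_fun setT W -> measurable_fun setT phi ->
  (forall w, 0 <= W w) -> (forall x, 0 <= phi x) -> (0 <= K)%E -> K \is a fin_num ->
  (forall B, measurable B -> (\int[P]_w (\1_B (X w) * W w)%:E = P (X @^-1` B) * K)%E) ->
  (\int[P]_w (phi (X w) * W w)%:E = (\int[P]_w (phi (X w))%:E) * K)%E.
Proof.
move=> mX mW mphi W0 phi0 K0 Kfin hB.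
under [in RHS]eq_integral do rewrite -[phi _]mulr1.
apply: integral_weighted => // B mB; rewrite hB//; congr (_ * _)%E.
under eq_integral do rewrite mulr1.
have mpre : measurable (X @^-1` B) by rewrite -[X in measurable X]setTI; exact: mX.
rewrite (_ : (fun w => _) = (fun w => (\1_(X @^-1` B) w)%:E))//.
by rewrite integral_indic// setIT.
Qed.

Section Family.
Variables (I : eqType) (Y : I -> T -> R).
Hypothesis mY : forall i, measurable_fun setT (Y i).

Definition indep_family : Prop := forall (s : seq I) (B : I -> set R), uniq s ->
  (forall i, measurable (B i)) ->
  P (\bigcap_(i in [set` s]) Y i @^-1` B i) = (\prod_(i <- s) P (Y i @^-1` B i))%E.

Hypothesis Yind : indep_family.

Definition mean (X : T -> R) : \bar R := (\int[P]_w (X w)%:E)%E.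

Lemma prod_indicators (s : seq I) (B : I -> set R) w :
  \prod_(i <- s) \1_(B i) (Y i w) = \1_(\bigcap_(i in [set` s]) Y i @^-1` B i) w :> R.
Proof.
elim: s => [|i s IH].
  by rewrite big_nil indicE mem_set//= => i; rewrite /= in_nil.
rewrite big_cons IH !indicE -natrM mulnb; congr ((nat_of_bool _)%:R).
apply/andP/idP.
  move=> [/set_mem h1 /set_mem h2]; apply/mem_set => j /=; rewrite inE => /predU1P[->//|js].
  exact: h2.
move=> /set_mem h; split; apply/mem_set; first by apply: h; rewrite /= inE eqxx.
by move=> j js; apply: h; rewrite /= inE (js : j \in s) orbT.
Qed.

Lemma measurable_prod_family (s : seq I) (phi : I -> R -> R) :
  (forall i, measurable_fun setT (phi i)) ->
  measurable_fun setT (fun w => \prod_(i <- s) phi i (Y i w) : R).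
Proof.
move=> mphi; apply: measurable_prod => i _.
exact: (measurableT_comp (mphi i) (mY i)).
Qed.

(** The functions are general on [s] and indicators on [t].  The induction moves one variable at
    a time from the second list to the first: the product formula for indicators of one more variable
    is the hypothesis of [integral_factor]. *)
Lemma mean_prod_nonneg (s t : seq I) (phi : I -> R -> R) : uniq (s ++ t) ->
  (forall i, measurable_fun setT (phi i)) -> (forall i x, 0 <= phi i x) ->
  (forall i, i \in s -> mean (fun w => phi i (Y i w)) \is a fin_num) ->
  (forall i, i \in t -> exists2 B, measurable B & phi i = \1_B) ->
  mean (fun w => \prod_(i <- s ++ t) phi i (Y i w)) =
  (\prod_(i <- s ++ t) mean (fun w => phi i (Y i w)))%E.
Proof.
elim: s t phi => [|j s IH] t phi /= ust mphi phi0 fphi hB.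
  have /choice[B0 hB0] : forall i, exists B, measurable B /\ (i \in t -> phi i = \1_B).
    move=> i; have [it|it] := boolP (i \in t); last by exists setT.
    by have [B mB eB] := hB i it; exists B.
  have eB i : i \in t -> phi i = \1_(B0 i) by case: (hB0 i).
  have mB0 i : measurable (B0 i) by case: (hB0 i).
  have mpre i : measurable (Y i @^-1` B0 i).
    by rewrite -[X in measurable X]setTI; exact: mY.
  transitivity (mean (fun w => \1_(\bigcap_(i in [set` t]) Y i @^-1` B0 i) w)).
    apply: eq_integral => w _; rewrite -prod_indicators; congr EFin.
    by apply: eq_big_seq => i it; rewrite eB.
  rewrite /mean integral_indic//; last first.
    by apply: fin_bigcap_measurable => //; exact: finite_seq.
  rewrite setIT; apply: (etrans (Yind ust mB0)); apply: eq_big_seq => i it; rewrite eB//.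
  by rewrite -[in LHS](setIT (Y i @^-1` B0 i)) -integral_indic.
move: ust => /andP[jst ust]; rewrite !big_cons.
have jP i : i \in s ++ t -> (i == j) = false.
  by move=> ist; apply/negbTE; apply: contraNneq jst => <-.
have fin_t i : i \in s ++ t -> mean (fun w => phi i (Y i w)) \is a fin_num.
  rewrite mem_cat => /orP[is1|it]; first by apply: fphi; rewrite inE is1 orbT.
  have [B mB ->] := hB i it; rewrite /mean.
  have mpre : measurable (Y i @^-1` B) by rewrite -[X in measurable X]setTI; exact: mY.
  rewrite (_ : (fun w => _) = (fun w => (\1_(Y i @^-1` B) w)%:E))//.
  by rewrite integral_indic// setIT; exact: fin_num_measure.
have -> : mean (fun w => \prod_(i <- j :: s ++ t) phi i (Y i w)) =
    mean (fun w => phi j (Y j w) * \prod_(i <- s ++ t) phi i (Y i w)).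
  by apply: eq_integral => w _; rewrite big_cons.
apply: integral_factor => //.
- exact: measurable_prod_family.
- by move=> w; apply: prodr_ge0.
- by apply: prode_ge0 => i _; apply: integral_ge0 => w _; rewrite lee_fin.
- rewrite big_seq; apply: (big_ind (fun x : \bar R => x \is a fin_num)); [by []| |exact: fin_t].
  by move=> x y; exact: fin_numM.
move=> B mB; pose psi i := if i == j then \1_B else phi i.
have perm : perm_eq (s ++ j :: t) (j :: s ++ t) by rewrite -cat_rcons -cats1 -catA perm_catCA.
have := IH (j :: t) psi.
rewrite (perm_uniq perm) /= jst ust => /(_ isT).
have mpre : measurable (Y j @^-1` B) by rewrite -[X in measurable X]setTI; exact: mY.
have e1 : mean (fun w => \prod_(i <- s ++ j :: t) psi i (Y i w)) =
   mean (fun w => \1_B (Y j w) * \prod_(i <- s ++ t) phi i (Y i w)).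
  apply: eq_integral => w _; congr EFin; rewrite (perm_big _ perm) big_cons /psi eqxx.
  by congr (_ * _); apply: eq_big_seq => i ist; rewrite jP.
have e2 : (\prod_(i <- s ++ j :: t) mean (fun w => psi i (Y i w)) =
   P (Y j @^-1` B) * \prod_(i <- s ++ t) mean (fun w => phi i (Y i w)))%E.
  rewrite (perm_big _ perm) big_cons /psi eqxx; congr (_ * _)%E; last first.
    by apply: eq_big_seq => i ist; rewrite jP.
  rewrite /mean (_ : (fun w => _) = (fun w => (\1_(Y j @^-1` B) w)%:E))//.
  by rewrite integral_indic// setIT.
rewrite e1 e2; apply.
- by move=> i; rewrite /psi; case: ifP => _ //; exact: measurable_indic.
- by move=> i x; rewrite /psi; case: ifP => _ //; rewrite indicE.
- move=> i is1; rewrite /psi jP ?mem_cat ?is1//; apply: fphi.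
  by rewrite inE is1 orbT.
- move=> i; rewrite inE /psi => /predU1P[->|it]; first by rewrite eqxx; exists B.
  by rewrite jP ?mem_cat ?it ?orbT//; exact: hB.
Qed.

End Family.

End Independence.

Section Moments.
Context {R : realType} {d : measure_display} {T : measurableType d}.
Variable P : probability T R.

Definition integ (X : T -> R) := P.-integrable setT (EFin \o X).

Definition Ex (X : T -> R) : R := fine (mean P X).

Lemma integ_meanE X : integ X -> mean P X = (Ex X)%:E.
Proof. by move=> iX; rewrite /Ex fineK//; exact: integrable_fin_num. Qed.

Lemma integ_meas X : integ X -> measurable_fun setT X.
Proof. by move=> /integrableP[/measurable_EFinP]. Qed.

Lemma integD X Z : integ X -> integ Z -> integ (fun w => X w + Z w).
Proof. by move=> iX iZ; exact: (integrableD measurableT iX iZ). Qed.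

Lemma ExD X Z : integ X -> integ Z -> Ex (fun w => X w + Z w) = Ex X + Ex Z.
Proof.
move=> iX iZ; apply: EFin_inj; rewrite EFinD -!integ_meanE//; last exact: integD.
exact: (integralD measurableT iX iZ).
Qed.

Lemma integZ (a : R) X : integ X -> integ (fun w => a * X w).
Proof. by move=> iX; exact: (integrableZl measurableT a iX). Qed.

Lemma ExZ (a : R) X : integ X -> Ex (fun w => a * X w) = a * Ex X.
Proof.
move=> iX; apply: EFin_inj; rewrite EFinM -!integ_meanE//; last exact: integZ.
exact: (integralZl measurableT iX a).
Qed.

Lemma integ0 : integ (fun=> 0). Proof. exact: integrable0. Qed.

Lemma Ex0 : Ex (fun=> 0) = 0. Proof. by rewrite /Ex /mean integral0. Qed.

Lemma integ_cst (c : R) : integ (fun=> c).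
Proof. exact: finite_measure_integrable_cst. Qed.

Lemma Ex_cst (c : R) : Ex (fun=> c) = c.
Proof.
rewrite /Ex /mean integral_cst//= (_ : _ setT = 1%E) ?mule1//.
exact: probability_setT.
Qed.

Lemma integ_sum (J : Type) (r : seq J) (X : J -> T -> R) : (forall j, integ (X j)) ->
  integ (fun w => \sum_(j <- r) X j w).
Proof.
move=> iX; elim: r => [|j r IH]; first by under eq_fun do rewrite big_nil; exact: integ0.
by under eq_fun do rewrite big_cons; exact: integD.
Qed.

Lemma Ex_sum (J : Type) (r : seq J) (X : J -> T -> R) : (forall j, integ (X j)) ->
  Ex (fun w => \sum_(j <- r) X j w) = \sum_(j <- r) Ex (X j).
Proof.
move=> iX; elim: r => [|j r IH]; first by under eq_fun do rewrite big_nil; rewrite big_nil Ex0.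
under eq_fun do rewrite big_cons; rewrite big_cons ExD ?IH//; exact: integ_sum.
Qed.

Lemma le_Ex X Z : integ X -> integ Z -> (forall w, X w <= Z w) -> Ex X <= Ex Z.
Proof.
move=> iX iZ XZ; rewrite -lee_fin -!integ_meanE//.
by apply: le_integral => // w _; rewrite lee_fin.
Qed.

Lemma Ex_ge0 X : (forall w, 0 <= X w) -> 0 <= Ex X.
Proof. by move=> X0; rewrite /Ex fine_ge0// integral_ge0// => w _; rewrite lee_fin. Qed.

Section Family.
Variables (I : eqType) (Y : I -> T -> R).
Hypothesis mY : forall i, measurable_fun setT (Y i).
Hypothesis Yind : indep_family P Y.

(** As in [mean_prod_nonneg], variables are moved one at a time from the nonnegative list [t] to the
    list [s]; the signed function of the moved variable is split into its two parts. *)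
Lemma mean_prod (s t : seq I) (phi : I -> R -> R) : uniq (s ++ t) ->
  (forall i, measurable_fun setT (phi i)) ->
  (forall i, i \in s ++ t -> integ (fun w => phi i (Y i w))) ->
  (forall i x, i \in t -> 0 <= phi i x) ->
  integ (fun w => \prod_(i <- s ++ t) phi i (Y i w)) /\
  Ex (fun w => \prod_(i <- s ++ t) phi i (Y i w)) = \prod_(i <- s ++ t) Ex (fun w => phi i (Y i w)).
Proof.
elim: s t phi => [|j s IH] t phi /= ust mphi iphi phi0.
  pose psi (i : I) (x : R) : R := `|phi i x|.
  have psiE i x : i \in t -> psi i x = phi i x by move=> it; rewrite /psi ger0_norm// phi0.
  have prodE w : \prod_(i <- t) psi i (Y i w) = \prod_(i <- t) phi i (Y i w).
    by apply: eq_big_seq => i it; rewrite psiE.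
  have mpsi i : measurable_fun setT (psi i) by exact: measurableT_comp.
  have fpsi i : i \in t -> mean P (fun w => psi i (Y i w)) \is a fin_num.
    move=> it; rewrite /mean; under eq_integral do rewrite psiE//.
    by rewrite -/(mean _ _) (integ_meanE (iphi i it)).
  have ust0 : uniq (t ++ [::]) by rewrite cats0.
  have noB i : i \in [::] -> exists2 B, measurable B & psi i = \1_B :> (R -> R) by [].
  have := mean_prod_nonneg mY Yind ust0 mpsi (fun i x => normr_ge0 (phi i x)) fpsi noB.
  rewrite cats0 => e.
  have e' : mean P (fun w => \prod_(i <- t) phi i (Y i w)) =
      (\prod_(i <- t) Ex (fun w => phi i (Y i w)))%:E.
    transitivity (mean P (fun w => \prod_(i <- t) psi i (Y i w))).
      by apply: eq_integral => w _; rewrite prodE.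
    rewrite e -prodEFin; apply: eq_big_seq => i it; rewrite -(integ_meanE (iphi i it)).
    by apply: eq_integral => w _; rewrite psiE.
  split; last by rewrite /Ex e'.
  apply/integrableP; split.
    by apply/measurable_EFinP; exact: measurable_prod_family.
  have <- : mean P (fun w => \prod_(i <- t) phi i (Y i w)) =
      (\int[P]_w `|(EFin \o (fun w => (\prod_(i <- t) phi i (Y i w))%R)) w|)%E.
    apply: eq_integral => w _; rewrite /= ger0_norm//.
    by rewrite -prodE; apply: prodr_ge0 => i _; exact: normr_ge0.
  by rewrite e' ltry.
move: (ust) => /andP[jst ust'].
have jP i : i \in s ++ t -> (i == j) = false.
  by move=> ist; apply/negbTE; apply: contraNneq jst => <-.
have perm : perm_eq (s ++ j :: t) (j :: s ++ t) by rewrite -cat_rcons -cats1 -catA perm_catCA.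
have part (h : R -> R) : measurable_fun setT h -> (forall x, 0 <= h x) ->
    integ (fun w => h (Y j w)) ->
    integ (fun w => h (Y j w) * \prod_(i <- s ++ t) phi i (Y i w)) /\
    Ex (fun w => h (Y j w) * \prod_(i <- s ++ t) phi i (Y i w)) =
      Ex (fun w => h (Y j w)) * \prod_(i <- s ++ t) Ex (fun w => phi i (Y i w)).
  move=> mh h0 ih; pose psi i := if i == j then h else phi i.
  have := IH (j :: t) psi; rewrite (perm_uniq perm) /= jst ust' => /(_ isT).
  have pE w : \prod_(i <- s ++ j :: t) psi i (Y i w) =
     h (Y j w) * \prod_(i <- s ++ t) phi i (Y i w).
    rewrite (perm_big _ perm) big_cons /psi eqxx.
    by congr (_ * _); apply: eq_big_seq => i ist; rewrite jP.
  have pE2 : \prod_(i <- s ++ j :: t) Ex (fun w => psi i (Y i w)) =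
     Ex (fun w => h (Y j w)) * \prod_(i <- s ++ t) Ex (fun w => phi i (Y i w)).
    rewrite (perm_big _ perm) big_cons /psi eqxx.
    by congr (_ * _); apply: eq_big_seq => i ist; rewrite jP.
  rewrite pE2; under eq_fun do rewrite pE; apply.
  - by move=> i; rewrite /psi; case: ifP.
  - move=> i; rewrite (perm_mem perm) inE /psi => /predU1P[->|ist]; first by rewrite eqxx.
    by rewrite jP//; apply: iphi; rewrite inE ist orbT.
  - move=> i x; rewrite inE /psi => /predU1P[->|it]; first by rewrite eqxx.
    by rewrite jP ?mem_cat ?it ?orbT//; exact: phi0.
pose hp x := Num.max (phi j x) 0; pose hn x := Num.max (- phi j x) 0.
have hE x : phi j x = hp x + -1 * hn x.
  rewrite /hp /hn mulN1r; have [x0|x0] := boolP (0 <= phi j x).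
    by rewrite (max_l x0) max_r ?subr0// oppr_le0.
  have x1 : phi j x < 0 by rewrite ltNge.
  by rewrite (max_r (ltW x1)) max_l ?oppr_ge0 ?ltW// opprK add0r.
have mhp : measurable_fun setT hp by apply: measurable_maxr.
have mhn : measurable_fun setT hn.
  by apply: measurable_maxr => //; exact: measurableT_comp.
have ij : integ (fun w => phi j (Y j w)) by apply: iphi; rewrite inE eqxx.
have le_int (h : R -> R) : measurable_fun setT h -> (forall x, `|h x| <= `|phi j x|) ->
    integ (fun w => h (Y j w)).
  move=> mh hle; apply: (le_integrable measurableT _ _ ij) => [|w _].
    by apply/measurable_EFinP; exact: measurableT_comp mh (mY j).
  by rewrite /= lee_fin.
have hp0 x : 0 <= hp x by rewrite le_max lexx orbT.
have hn0 x : 0 <= hn x by rewrite le_max lexx orbT.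
have hpi : integ (fun w => hp (Y j w)).
  by apply: le_int => // x; rewrite ger0_norm// /hp ge_max ler_norm normr_ge0.
have hni : integ (fun w => hn (Y j w)).
  by apply: le_int => // x; rewrite ger0_norm// /hn ge_max -[`|phi j x|]normrN ler_norm normr_ge0.
have [ip ep] := part hp mhp hp0 hpi; have [inn en] := part hn mhn hn0 hni.
have pE w : \prod_(i <- j :: s ++ t) phi i (Y i w) =
    hp (Y j w) * \prod_(i <- s ++ t) phi i (Y i w) +
    -1 * (hn (Y j w) * \prod_(i <- s ++ t) phi i (Y i w)).
  by rewrite big_cons {1}hE; ring.
under eq_fun do rewrite pE.
split; first by apply: integD => //; exact: integZ.
rewrite ExD//; last exact: integZ.
rewrite ExZ// ep en big_cons.
have -> : Ex (fun w => phi j (Y j w)) = Ex (fun w => hp (Y j w)) + -1 * Ex (fun w => hn (Y j w)).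
  under eq_fun do rewrite hE.
  by rewrite ExD ?ExZ//; exact: integZ.
ring.
Qed.

Hypothesis Ymom : forall i k, integ (fun w => Y i w ^+ k).

Definition mu i k : R := Ex (fun w => Y i w ^+ k).

Lemma mu0 i : mu i 0 = 1.
Proof. by rewrite /mu; under eq_fun do rewrite expr0; exact: Ex_cst. Qed.

Lemma mean_monomial (s : seq I) (a : I -> nat) : uniq s ->
  integ (fun w => \prod_(i <- s) Y i w ^+ a i) /\
  Ex (fun w => \prod_(i <- s) Y i w ^+ a i) = \prod_(i <- s) mu i (a i).
Proof.
move=> us; have := @mean_prod s [::] (fun i x => x ^+ a i); rewrite cats0; apply=> // i.
Qed.

Implicit Types (s : seq I) (G H : (I -> R) -> R).

(** Polynomials as explicit finite sums of monomials with variables in [s]: the class is closed under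
    the ring operations and every member is integrable. *)
Definition pol s G := exists l : seq (R * (I -> nat)), forall y,
  G y = \sum_(t <- l) t.1 * \prod_(i <- s) y i ^+ t.2 i.

Definition at_Y G w := G (fun i => Y i w).

Lemma pol_integ s G : uniq s -> pol s G -> integ (at_Y G).
Proof.
move=> us [l GE]; rewrite /at_Y; under eq_fun do rewrite GE.
by apply: integ_sum => t; apply: integZ; case: (mean_monomial t.2 us).
Qed.

Lemma pol_cst s (c : R) : pol s (fun=> c).
Proof.
exists [:: (c, fun=> 0%N)] => y; by rewrite big_seq1 /= big1 ?mulr1.
Qed.

Lemma polD s G H : pol s G -> pol s H -> pol s (fun y => G y + H y).
Proof. by move=> [l GE] [l' HE]; exists (l ++ l') => y; rewrite big_cat GE HE. Qed.

Lemma polM s G H : pol s G -> pol s H -> pol s (fun y => G y * H y).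
Proof.
move=> [l GE] [l' HE].
exists [seq (t.1 * t'.1, fun i => (t.2 i + t'.2 i)%N) | t <- l, t' <- l'] => y.
rewrite GE HE big_allpairs_dep /= mulr_suml; apply: eq_bigr => t _.
rewrite mulr_sumr; apply: eq_bigr => t' _.
rewrite mulrACA; congr (_ * _); rewrite -big_split /=; apply: eq_bigr => i _.
by rewrite exprD.
Qed.

Lemma polX s G k : pol s G -> pol s (fun y => G y ^+ k).
Proof.
move=> pG; elim: k => [|k IH].
  by under eq_fun do rewrite expr0; exact: pol_cst.
by under eq_fun do rewrite exprS; exact: polM.
Qed.

Lemma polZ s (c : R) G : pol s G -> pol s (fun y => c * G y).
Proof. by move=> pG; apply: polM => //; exact: pol_cst. Qed.

Lemma pol_var s i : i \in s -> uniq s -> pol s (fun y => y i).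
Proof.
move=> is1 us; exists [:: (1, fun j => (j == i) : nat)] => y.
rewrite big_seq1 /= mul1r (bigD1_seq i)//= eqxx expr1 big1 ?mulr1// => j /negPf->.
by rewrite expr0.
Qed.

Lemma pol_cons s j G : j \notin s -> pol s G -> pol (j :: s) G.
Proof.
move=> js [l GE]; exists [seq (t.1, fun i => if i == j then 0%N else t.2 i) | t <- l] => y.
rewrite GE big_map; apply: eq_bigr => t _ /=; rewrite big_cons eqxx expr0 mul1r.
congr (_ * _); apply: eq_big_seq => i is1.
by rewrite ifN//; apply: contraNneq js => <-.
Qed.

Lemma Ex_indep s j k G : uniq s -> j \notin s -> pol s G ->
  integ (at_Y (fun y => y j ^+ k * G y)) /\
  Ex (at_Y (fun y => y j ^+ k * G y)) = mu j k * Ex (at_Y G).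
Proof.
move=> us js [l GE]; rewrite /at_Y; pose b (t : R * (I -> nat)) i := if i == j then k else t.2 i.
have ujs : uniq (j :: s) by rewrite /= js.
have bs t i : i \in s -> b t i = t.2 i.
  by move=> is1; rewrite /b ifN//; apply: contraNneq js => <-.
have e w : Y j w ^+ k * G (fun i => Y i w) =
    \sum_(t <- l) t.1 * \prod_(i <- j :: s) Y i w ^+ b t i.
  rewrite GE mulr_sumr; apply: eq_bigr => t _; rewrite big_cons {1}/b eqxx mulrCA.
  by congr (_ * (_ * _)); apply: eq_big_seq => i /bs->.
under eq_fun do rewrite e.
have it t : integ (fun w => t.1 * \prod_(i <- j :: s) Y i w ^+ b t i).
  by apply: integZ; case: (mean_monomial (b t) ujs).
split; first exact: integ_sum.
rewrite Ex_sum//; under [X in _ = _ * Ex X]eq_fun do rewrite GE.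
rewrite Ex_sum; last by move=> t; apply: integZ; case: (mean_monomial t.2 us).
rewrite mulr_sumr; apply: eq_bigr => t _.
have [i1 e1] := mean_monomial (b t) ujs; have [i2 e2] := mean_monomial t.2 us.
rewrite !ExZ// e1 e2 big_cons {1}/b eqxx mulrCA; congr (_ * (_ * _)).
by apply: eq_big_seq => i /bs->.
Qed.

End Family.
End Moments.

Lemma half_index i h l m : i = h.*2 -> (l <= m - i)%N -> (i <= m)%N ->
  (h + l <= m)%N /\ (m - (h + l) = (m - i - l) + h)%N.
Proof. by move=> ->; rewrite -muln2 => h1 h2; split; lia. Qed.

(** * The one-variable inequality behind hypercontractivity *)

Section Numeric.
Variable R : realType.
Implicit Types (a b g r v : R).

Lemma binomial_gap m j a b : 0 <= a -> 0 <= b -> (0 < j <= m)%N ->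
  a ^+ (m - j) * b ^+ j <= (a + b) ^+ m - a ^+ m.
Proof.
move=> a0 b0 /andP[j0 jm]; rewrite exprDn big_ord_recl /= subn0 expr0 mulr1 bin0 mulr1n.
rewrite addrC addKr.
have j1 : (j.-1 < m)%N by rewrite prednK.
rewrite (bigD1 (Ordinal j1))//= /bump /= add1n prednK//.
apply: le_trans (_ : a ^+ (m - j) * b ^+ j *+ 'C(m, j) <= _).
  by rewrite -[leRHS]mulr_natr ler_peMr ?mulr_ge0 ?exprn_ge0// ler1n bin_gt0.
rewrite lerDl sumr_ge0// => i _.
by rewrite mulrn_wge0// mulr_ge0// exprn_ge0.
Qed.

Lemma bin_le_exp2 m k : ('C(m, k) <= 2 ^ m)%N.
Proof.
have [km|km] := leqP k m; last by rewrite bin_small.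
change (2 ^ m)%N with ((1 + 1) ^ m)%N; rewrite expnDn.
rewrite (bigD1 (Ordinal (km : (k < m.+1)%N)))//= !exp1n !muln1.
exact: leq_addr.
Qed.

(** The left-hand side is the expansion of the mean of [(a + 2 r g Y + r^2 b Y^2)^m].  Odd powers of
    [Y] drop out, and by [g^2 <= a b] each remaining term except the first is at most
    [8^m r^2 mu_(2j) a^(m-j) b^j] for some [0 < j <= m]; here [8^m] covers the two binomial
    coefficients and the power of two.  If [r] is small, each is at most the [(m+1)^2]-th part of
    [(a + v b)^m - a^m], and there are at most [(m+1)^2] of them. *)
Lemma trinomial_bound m a b g r v (mu : nat -> R) :
  0 <= a -> 0 <= b -> g ^+ 2 <= a * b -> mu 0%N = 1 -> (forall k, odd k -> mu k = 0) ->
  (forall k, 0 <= mu k.*2) -> 0 < r -> r <= 1 -> 0 <= v ->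
  (forall j, (0 < j <= m)%N -> (m.+1 ^ 2 * 8 ^ m)%:R * r ^+ 2 * mu j.*2 <= v ^+ j) ->
  \sum_(i < m.+1) \sum_(l < (m - i).+1)
    ('C(m, i) * 'C(m - i, l))%:R * (2 * r) ^+ i * r ^+ l.*2 * (mu (i + l.*2)%N *
      (a ^+ (m - i - l) * b ^+ l * g ^+ i)) <= (a + v * b) ^+ m.
Proof.
move=> a0 b0 gab mu0 muodd mupos r0 r1 v0 hmu.
pose D := (a + v * b) ^+ m - a ^+ m.
have vb0 : 0 <= v * b by rewrite mulr_ge0.
have D0 : 0 <= D.
  by rewrite /D subr_ge0; apply: lerXn2r; rewrite ?nnegrE ?addr_ge0// lerDl.
have m0 : (0 : R) < (m.+1 ^ 2)%:R by rewrite ltr0n expn_gt0.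
pose e := D / (m.+1 ^ 2)%:R.
have e0 : 0 <= e by rewrite divr_ge0// ltW.
have term (i l : nat) : (i <= m)%N -> (l <= m - i)%N ->
   ('C(m, i) * 'C(m - i, l))%:R * (2 * r) ^+ i * r ^+ l.*2 * (mu (i + l.*2)%N *
      (a ^+ (m - i - l) * b ^+ l * g ^+ i)) <= (if (i == 0%N) && (l == 0%N) then a ^+ m else 0) + e.
  move=> im lmi.
  have [/andP[/eqP-> /eqP->]|il] := boolP ((i == 0%N) && (l == 0%N)).
    by rewrite !bin0 !subn0 !expr0 !mulr1 mul1r mu0 mul1r lerDl.
  rewrite add0r.
  have [oi|ei] := boolP (odd i).
    by rewrite muodd ?mul0r ?mulr0// oddD odd_double oi.
  pose h := i./2; have ih : i = h.*2 by rewrite -[LHS](odd_double_half i) (negPf ei).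
  have hl : (0 < h + l)%N.
    by move: il; rewrite ih double_eq0 addn_gt0 !lt0n -negb_and.
  have hlm : (h + l <= m)%N.
    by have [] := half_index ih lmi im.
  have gpow : 0 <= g ^+ i <= (a * b) ^+ h.
    rewrite ih -muln2 mulnC exprM exprn_ge0 ?sqr_ge0//=.
    by apply: lerXn2r; rewrite ?nnegrE ?sqr_ge0 ?mulr_ge0.
  have ge1 : a ^+ (m - i - l) * b ^+ l * g ^+ i <= a ^+ (m - (h + l)) * b ^+ (h + l).
    have -> : (m - (h + l) = (m - i - l) + h)%N.
      by have [] := half_index ih lmi im.
    rewrite exprD [b ^+ (h + l)]exprD.
    have -> : a ^+ (m - i - l) * a ^+ h * (b ^+ h * b ^+ l) =
      a ^+ (m - i - l) * b ^+ l * (a * b) ^+ h by rewrite exprMn; ring.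
    apply: ler_wpM2l; first by rewrite mulr_ge0// exprn_ge0.
    by case/andP: gpow.
  have ge2 : 0 <= a ^+ (m - i - l) * b ^+ l * g ^+ i.
    by apply: mulr_ge0; [rewrite mulr_ge0// exprn_ge0|case/andP: gpow].
  have idx : (i + l.*2 = (h + l).*2)%N by rewrite ih doubleD.
  rewrite idx.
  have mu1 := mupos (h + l)%N.
  have coef : ('C(m, i) * 'C(m - i, l))%:R * (2 * r) ^+ i * r ^+ l.*2 <= (8 ^ m)%:R * r ^+ 2.
    have rr : r ^+ i * r ^+ l.*2 <= r ^+ 2.
      rewrite -exprD idx -muln2 mulnC exprM.
      have r20 : 0 <= r ^+ 2 <= 1 by rewrite sqr_ge0 expr_le1// ltW.
      by case/andP: r20 => r20 r21; exact: ler_iXnr.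
    have -> : ('C(m, i) * 'C(m - i, l))%:R * (2 * r) ^+ i * r ^+ l.*2 =
       ('C(m, i) * 'C(m - i, l) * 2 ^ i)%:R * (r ^+ i * r ^+ l.*2).
      by rewrite exprMn !natrM natrX; ring.
    apply: ler_pM => //; first by rewrite mulr_ge0// exprn_ge0// ltW.
    rewrite ler_nat (_ : 8 = 2 * 2 * 2)%N// !expnMn; apply: leq_mul; last by rewrite leq_exp2l.
    apply: leq_mul; first exact: bin_le_exp2.
    by apply: leq_trans (bin_le_exp2 _ _) _; rewrite leq_exp2l// leq_subr.
  apply: le_trans (_ : (8 ^ m)%:R * r ^+ 2 * (mu (h + l).*2 * (a ^+ (m - (h + l)) * b ^+ (h + l))) <= _).
    apply: ler_pM => //; first by rewrite !mulr_ge0// exprn_ge0// ?mulr_ge0// ltW.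
      by rewrite mulr_ge0.
    exact: ler_wpM2l.
  rewrite /e ler_pdivlMr//.
  apply: le_trans (binomial_gap a0 vb0 (_ : (0 < h + l <= m)%N)); last by rewrite hl.
  have hj := hmu (h + l)%N; rewrite hl hlm in hj; have {}hj := hj isT.
  rewrite exprMn.
  have ab0 : 0 <= a ^+ (m - (h + l)) * b ^+ (h + l) by rewrite mulr_ge0// exprn_ge0.
  have := ler_wpM2r ab0 hj; rewrite natrM => h'.
  have -> : (8 ^ m)%:R * r ^+ 2 * (mu (h + l).*2 * (a ^+ (m - (h + l)) * b ^+ (h + l))) *
     (m.+1 ^ 2)%:R = (m.+1 ^ 2)%:R * (8 ^ m)%:R * r ^+ 2 * mu (h + l).*2 *
      (a ^+ (m - (h + l)) * b ^+ (h + l)) by ring.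
  by apply: le_trans h' _; rewrite le_eqVlt; apply/orP; left; apply/eqP; ring.
apply: (@le_trans _ _ (\sum_(i < m.+1) ((if i == 0 :> nat then a ^+ m else 0) + e * m.+1%:R))).
  apply: ler_sum => i _.
  apply: (@le_trans _ _ (\sum_(l < (m - i).+1)
     ((if (i == 0 :> nat) && (l == 0 :> nat) then a ^+ m else 0) + e))).
    by apply: ler_sum => l _; apply: term; rewrite -ltnS ltn_ord.
  rewrite big_split /= sumr_const card_ord -[e *+ _]mulr_natr; apply: lerD.
    rewrite big_ord_recl /= andbT big1 ?addr0// => l _.
    by rewrite andbF.
  by apply: ler_wpM2l => //; rewrite ler_nat ltnS leq_subr.
rewrite big_split /= sumr_const card_ord -[_ *+ m.+1]mulr_natr.
rewrite big_ord_recl /= big1 ?addr0 => [|i _]; last by [].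
rewrite /e -mulrA -natrM mulnn divfK ?gt_eqF// /D.
by rewrite addrC subrK.
Qed.

Lemma cauchy_schwarz_seq (J : Type) (s : seq J) (f g : J -> R) :
  (\sum_(j <- s) f j * g j) ^+ 2 <= (\sum_(j <- s) f j ^+ 2) * (\sum_(j <- s) g j ^+ 2).
Proof.
elim: s => [|j s IH]; first by rewrite !big_nil expr0n mulr0.
rewrite !big_cons.
set A := \sum_(j <- s) f j ^+ 2 in IH *; set B := \sum_(j <- s) g j ^+ 2 in IH *.
set C := \sum_(j <- s) f j * g j in IH *.
have A0 : 0 <= A by apply: sumr_ge0 => *; exact: sqr_ge0.
have B0 : 0 <= B by apply: sumr_ge0 => *; exact: sqr_ge0.
have h : 2 * (f j * g j * C) <= f j ^+ 2 * B + g j ^+ 2 * A.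
  have [A1|A1] := eqVneq A 0.
    have C0 : C = 0 by move: IH; rewrite A1 mul0r => C2; apply/eqP; rewrite -sqrf_eq0 eq_le C2 sqr_ge0.
    by rewrite C0 A1 !mulr0 addr0 mulr_ge0// sqr_ge0.
  have Ap : 0 < A by rewrite lt_neqAle eq_sym A1.
  have h1 : f j ^+ 2 * C ^+ 2 <= f j ^+ 2 * (A * B) by apply: ler_wpM2l => //; exact: sqr_ge0.
  have h2 : 0 <= (g j * A - f j * C) ^+ 2 by exact: sqr_ge0.
  rewrite -(ler_pM2r Ap); nra.
nra.
Qed.

End Numeric.

(** * Multi-affine forms *)

Section MultiAffine.
Context {R : realType} {I : eqType}.
Implicit Types (s S : seq I) (F G : (I -> R) -> R) (y : I -> R).

(** Affine in each of the listed variables separately, by recursion on the list: this is the shape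
    on which the induction for hypercontractivity runs. *)
Fixpoint multiaffine s F : Prop :=
  if s is j :: s' then
    exists A B, [/\ multiaffine s' A, multiaffine s' B & forall y, F y = A y + y j * B y]
  else exists a, forall y, F y = a.

Definition dilate (r : R) F : (I -> R) -> R := fun y => F (fun i => r * y i).

Lemma multiaffine_lin s (c : R) F G : multiaffine s F -> multiaffine s G ->
  multiaffine s (fun y => c * F y + G y).
Proof.
elim: s F G => [|j s IH] F G /=.
  by move=> [a FE] [b GE]; exists (c * a + b) => y; rewrite FE GE.
move=> [A [B [mA mB FE]]] [A' [B' [mA' mB' GE]]].
exists (fun y => c * A y + A' y), (fun y => c * B y + B' y); split.
- exact: IH.
- exact: IH.
- by move=> y; rewrite FE GE; ring.
Qed.

Lemma multiaffine_cst s (a : R) : multiaffine s (fun=> a).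
Proof.
elim: s a => [|j s IH] a /=; first by exists a.
by exists (fun=> a), (fun=> 0); split=> // y; rewrite mulr0 addr0.
Qed.

Lemma multiaffineZ s (c : R) F : multiaffine s F -> multiaffine s (fun y => c * F y).
Proof.
move=> mF; have := multiaffine_lin c mF (multiaffine_cst s 0).
by congr multiaffine; apply/funext => y; rewrite addr0.
Qed.

Lemma multiaffine_monomial s S : uniq S -> {subset S <= s} ->
  multiaffine s (fun y => \prod_(i <- S) y i).
Proof.
elim: s S => [|j s IH] S uS Ss /=.
  exists 1 => y; rewrite big_seq big1// => i /Ss; rewrite in_nil//.
have [jS|jS] := boolP (j \in S).
  exists (fun=> 0), (fun y => \prod_(i <- rem j S) y i); split.
  - exact: multiaffine_cst.
  - apply: IH; first exact: rem_uniq.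
    by move=> i; rewrite mem_rem_uniq// inE => /andP[ij /Ss]; rewrite inE (negPf ij).
  - by move=> y; rewrite add0r (perm_big _ (perm_to_rem jS)) big_cons.
exists (fun y => \prod_(i <- S) y i), (fun=> 0); split.
- apply: IH => // i iS; have := Ss i iS; rewrite inE => /predU1P[ij|//].
  by rewrite ij (negPf jS) in iS.
- exact: multiaffine_cst.
- by move=> y; rewrite mulr0 addr0.
Qed.

Lemma multiaffine_dilate s (r : R) F : multiaffine s F -> multiaffine s (dilate r F).
Proof.
elim: s F => [|j s IH] F /=; first by move=> [a FE]; exists a => y; rewrite /dilate FE.
move=> [A [B [mA mB FE]]]; exists (dilate r A), (fun y => r * dilate r B y); split.
- exact: IH.
- by apply: multiaffineZ; exact: IH.
- by move=> y; rewrite /dilate FE; ring.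
Qed.

Lemma multiaffine_pol s F : uniq s -> multiaffine s F -> pol s F.
Proof.
elim: s F => [|j s IH] F /= us.
  by move=> [a FE]; rewrite (funext FE); exact: pol_cst.
move: (us) => /andP[js us'] [A [B [mA mB FE]]]; rewrite (funext FE).
apply: polD; first by apply: pol_cons => //; exact: IH.
apply: polM; last by apply: pol_cons => //; exact: IH.
by apply: pol_var; rewrite ?inE ?eqxx.
Qed.

End MultiAffine.

(** * Hypercontractivity of dilations *)

Section Hypercontractivity.
Context {R : realType} {d : measure_display} {T : measurableType d}.
Variable P : probability T R.
Variables (I : eqType) (Y : I -> T -> R).
Hypothesis mY : forall i, measurable_fun setT (Y i).
Hypothesis Yind : indep_family P Y.
Hypothesis Ymom : forall i k, integ P (fun w => Y i w ^+ k).
Variable v : R.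
Hypothesis v0 : 0 <= v.
Hypothesis Yvar : forall i, mu P Y i 2 = v.
Hypothesis Yodd : forall i k, odd k -> mu P Y i k = 0.
Implicit Types (s : seq I) (F G : (I -> R) -> R).

Let E G := Ex P (at_Y Y G).

Lemma E_integ s G : uniq s -> pol s G -> integ P (at_Y Y G).
Proof. exact: pol_integ. Qed.

Lemma E_D s F G : uniq s -> pol s F -> pol s G -> E (fun y => F y + G y) = E F + E G.
Proof. by move=> us pF pG; rewrite /E /at_Y ExD//; exact: E_integ us _. Qed.

Lemma E_Z s (c : R) F : uniq s -> pol s F -> E (fun y => c * F y) = c * E F.
Proof. by move=> us pF; rewrite /E /at_Y ExZ//; exact: E_integ us _. Qed.

Lemma E_affine_sq s j A B : uniq s -> j \notin s -> pol s A -> pol s B ->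
  E (fun y => (A y + y j * B y) ^+ 2) = E (fun y => A y ^+ 2 + v * B y ^+ 2).
Proof.
move=> us js pA pB.
have pAB : pol s (fun y => A y * B y) by exact: polM.
have pA2 : pol s (fun y => A y ^+ 2) by exact: polX.
have pB2 : pol s (fun y => B y ^+ 2) by exact: polX.
have [i1 e1] := Ex_indep mY Yind Ymom 1 us js pAB.
have [i2 e2] := Ex_indep mY Yind Ymom 2 us js pB2.
have -> : (fun y : I -> R => (A y + y j * B y) ^+ 2) =
   (fun y => (A y ^+ 2 + 2 * (y j ^+ 1 * (A y * B y))) + y j ^+ 2 * B y ^+ 2).
  by apply/funext => y; ring.
have iA := E_integ us pA2; have iB := E_integ us pB2.
rewrite /E /at_Y ExD//; last by apply: integD => //; exact: integZ.
rewrite ExD//; last exact: integZ.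
rewrite ExZ// [X in _ + 2 * X]e1 [X in _ + X]e2 Yodd// Yvar mul0r mulr0 addr0.
by rewrite ExD ?ExZ//; exact: integZ.
Qed.

Variables (m : nat) (r : R).
Hypothesis r0 : 0 < r.
Hypothesis r1 : r <= 1.
Hypothesis hmu : forall i j, (0 < j <= m)%N ->
  (m.+1 ^ 2 * 8 ^ m)%:R * r ^+ 2 * mu P Y i j.*2 <= v ^+ j.

Let mu_even i k : 0 <= mu P Y i k.*2.
Proof. by apply: Ex_ge0 => w; rewrite -muln2 mulnC exprM exprn_ge0// sqr_ge0. Qed.

Lemma multiaffine_cons_seq s j (Fs : seq ((I -> R) -> R)) :
  (forall F, List.In F Fs -> multiaffine (j :: s) F) ->
  exists ABs : seq (((I -> R) -> R) * ((I -> R) -> R)),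
    (forall AB, List.In AB ABs -> multiaffine s AB.1 /\ multiaffine s AB.2) /\
    Fs = [seq (fun y => AB.1 y + y j * AB.2 y) | AB <- ABs].
Proof.
elim: Fs => [|F Fs IH] hF; first by exists [::].
have [ABs [h1 h2]] : exists ABs : seq (((I -> R) -> R) * ((I -> R) -> R)),
    (forall AB, List.In AB ABs -> multiaffine s AB.1 /\ multiaffine s AB.2) /\
    Fs = [seq (fun y => AB.1 y + y j * AB.2 y) | AB <- ABs].
  by apply: IH => G GFs; apply: hF; right.
have [A [B [mA mB FE]]] := hF F (or_introl erefl).
exists ((A, B) :: ABs); split; first by move=> AB /= [<-//|]; exact: h1.
by rewrite /= -h2; congr (_ :: _); exact: funext.
Qed.

Lemma pol_sum_In (J : Type) (l : seq J) s (G : J -> (I -> R) -> R) :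
  (forall x, List.In x l -> pol s (G x)) -> pol s (fun y => \sum_(x <- l) G x y).
Proof.
elim: l => [|x l IH] h; first by under eq_fun do rewrite big_nil; exact: pol_cst.
under eq_fun do rewrite big_cons; apply: polD; first by apply: h; left.
by apply: IH => z zl; apply: h; right.
Qed.

Lemma E_sum_In (J : Type) (l : seq J) s (G : J -> (I -> R) -> R) : uniq s ->
  (forall x, List.In x l -> pol s (G x)) ->
  E (fun y => \sum_(x <- l) G x y) = \sum_(x <- l) E (G x).
Proof.
move=> us; elim: l => [|x l IH] h.
  by rewrite big_nil /E /at_Y; under eq_fun do rewrite big_nil; exact: Ex0.
rewrite big_cons -IH; last by move=> z zl; apply: h; right.
rewrite -(E_D us); [|by apply: h; left|by apply: pol_sum_In => z zl; apply: h; right].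
by congr E; apply/funext => y; rewrite big_cons.
Qed.

(** Hypercontractivity for vectors of multi-affine forms.  The vector-valued statement is what makes
    the induction on the variables close: splitting off one variable turns each form [A + y_j B] into
    the two forms [A] and [sqrt v B], whose squares have the same mean sum. *)
Lemma hypercontractivity_seq s (Fs : seq ((I -> R) -> R)) : uniq s ->
  (forall F, List.In F Fs -> multiaffine s F) ->
  E (fun y => (\sum_(F <- Fs) dilate r F y ^+ 2) ^+ m) <=
  (E (fun y => \sum_(F <- Fs) F y ^+ 2)) ^+ m.
Proof.
elim: s Fs => [|j s IH] Fs us hF.
  have [c cE] : exists c, forall y, \sum_(F <- Fs) F y ^+ 2 = c.
    elim: Fs hF => [|F Fs IH] hF; first by exists 0 => y; rewrite big_nil.
    have [|c hc] := IH; first by move=> G GFs; apply: hF; right.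
    have [a aE] := hF F (or_introl erefl).
    by exists (a ^+ 2 + c) => y; rewrite big_cons hc aE.
  rewrite /E /at_Y /dilate; under eq_fun do rewrite cE.
  by under [X in _ <= Ex P X ^+ m]eq_fun do rewrite cE; rewrite !Ex_cst.
move: (us) => /= /andP[js us'].
have [ABs [hAB ->]] := multiaffine_cons_seq hF.
pose al y := \sum_(AB <- ABs) dilate r AB.1 y ^+ 2.
pose be y := \sum_(AB <- ABs) dilate r AB.2 y ^+ 2.
pose ga y := \sum_(AB <- ABs) dilate r AB.1 y * dilate r AB.2 y.
have pd G : multiaffine s G -> pol s (dilate r G).
  by move=> mG; apply: multiaffine_pol => //; exact: multiaffine_dilate.
have pal : pol s al by apply: pol_sum_In => AB /hAB[h1 _]; apply: polX; exact: pd.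
have pbe : pol s be by apply: pol_sum_In => AB /hAB[_ h2]; apply: polX; exact: pd.
have pga : pol s ga by apply: pol_sum_In => AB /hAB[h1 h2]; apply: polM; exact: pd.
pose c i l := ('C(m, i) * 'C(m - i, l))%:R * (2 * r) ^+ i * r ^+ l.*2 : R.
pose G i l y := al y ^+ (m - i - l) * be y ^+ l * ga y ^+ i.
have pG i l : pol s (G i l) by apply: polM; [apply: polM|]; exact: polX.
have expand y : (\sum_(F <- [seq (fun y => AB.1 y + y j * AB.2 y) | AB <- ABs]) dilate r F y ^+ 2) ^+ m =
    \sum_(i < m.+1) \sum_(l < (m - i).+1) c i l * (y j ^+ (i + l.*2) * G i l y).
  have -> : \sum_(F <- [seq (fun y => AB.1 y + y j * AB.2 y) | AB <- ABs]) dilate r F y ^+ 2 =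
      (al y + (r * y j) ^+ 2 * be y) + 2 * (r * y j) * ga y.
    rewrite big_map /al /be /ga !mulr_sumr -!big_split /=; apply: eq_bigr => AB _.
    by rewrite /dilate; ring.
  rewrite exprDn; apply: eq_bigr => i _; rewrite exprDn mulr_suml -sumrMnl.
  apply: eq_bigr => l _; rewrite /c /G natrM -[_ *+ 'C(m, i)]mulr_natr -[_ *+ 'C(m - i, l)]mulr_natr.
  rewrite -!muln2 !exprMn exprD [(l * 2)%N]mulnC !exprM !exprMn; ring.
have iG i l : integ P (at_Y Y (fun y => y j ^+ (i + l.*2) * G i l y)).
  by case: (Ex_indep mY Yind Ymom (i + l.*2) us' js (pG i l)).
have eG i l : E (fun y => y j ^+ (i + l.*2) * G i l y) = mu P Y j (i + l.*2) * E (G i l).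
  by case: (Ex_indep mY Yind Ymom (i + l.*2) us' js (pG i l)).
have step1 : E (fun y => (\sum_(F <- [seq (fun y => AB.1 y + y j * AB.2 y) | AB <- ABs]) dilate r F y ^+ 2) ^+ m)
   = E (fun y => \sum_(i < m.+1) \sum_(l < (m - i).+1) c i l * (mu P Y j (i + l.*2) * G i l y)).
  rewrite /E /at_Y; under eq_fun do rewrite expand.
  have i1 (i : 'I_m.+1) (l : 'I_(m - i).+1) :
     integ P (fun w => c i l * (Y j w ^+ (i + l.*2) * G i l (fun k => Y k w))).
    by apply: integZ; exact: iG.
  have i2 (i : 'I_m.+1) (l : 'I_(m - i).+1) :
     integ P (fun w => c i l * (mu P Y j (i + l.*2) * G i l (fun k => Y k w))).
    by do 2 apply: integZ; exact: E_integ us' (pG i l).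
  rewrite !Ex_sum; [|by move=> i; apply: integ_sum|by move=> i; apply: integ_sum].
  apply: eq_bigr => i _; rewrite !Ex_sum//; apply: eq_bigr => l _.
  rewrite !ExZ//; [by rewrite [X in _ * X]eG|exact: E_integ us' (pG i l)|
    by apply: integZ; exact: E_integ us' (pG i l)|exact: iG].
(* the induction hypothesis is applied to twice as many forms in one variable less *)
pose Hs := [seq AB.1 | AB <- ABs] ++ [seq (fun y => Num.sqrt v * AB.2 y) | AB <- ABs].
have hH F : List.In F Hs -> multiaffine s F.
  rewrite /Hs => /List.in_app_iff[] /List.in_map_iff[AB [<- /hAB[h1 h2]]] //.
  exact: multiaffineZ.
have sv : Num.sqrt v ^+ 2 = v by rewrite sqr_sqrtr.
have HsE y : \sum_(F <- Hs) dilate r F y ^+ 2 = al y + v * be y.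
  rewrite big_cat !big_map /al /be mulr_sumr; congr (_ + _); apply: eq_bigr => AB _.
  by rewrite /dilate exprMn sv.
have pvb : pol s (fun y => al y + v * be y) by apply: polD => //; exact: polZ.
rewrite step1; apply: (@le_trans _ _ (E (fun y => (al y + v * be y) ^+ m))).
  apply: le_Ex.
  - apply: integ_sum => i; apply: integ_sum => l.
    by do 2 apply: integZ; exact: E_integ us' (pG i l).
  - by apply: E_integ us' _; exact: polX.
  - move=> w; apply: trinomial_bound => //.
    + by apply: sumr_ge0 => *; exact: sqr_ge0.
    + by apply: sumr_ge0 => *; exact: sqr_ge0.
    + exact: cauchy_schwarz_seq.
    + exact: mu0.
    + by move=> k; exact: Yodd.
    + by move=> k; exact: hmu.
have := IH Hs us' hH.
have -> : (fun y => (\sum_(F <- Hs) dilate r F y ^+ 2) ^+ m) = (fun y => (al y + v * be y) ^+ m).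
  by apply/funext => y; rewrite HsE.
move=> h; apply: le_trans h _; rewrite le_eqVlt; apply/orP; left; apply/eqP; congr (_ ^+ m).
have pM (AB : ((I -> R) -> R) * ((I -> R) -> R)) : List.In AB ABs -> pol s AB.1 /\ pol s AB.2.
  by move=> /hAB[h1 h2]; split; exact: multiaffine_pol.
have -> : (fun y => \sum_(F <- Hs) F y ^+ 2) =
   (fun y => \sum_(AB <- ABs) (AB.1 y ^+ 2 + v * AB.2 y ^+ 2)).
  apply/funext => y; rewrite big_cat !big_map /= -big_split /=; apply: eq_bigr => AB _.
  by rewrite /= exprMn sv.
have -> : (fun y => \sum_(F <- [seq (fun y => AB.1 y + y j * AB.2 y) | AB <- ABs]) F y ^+ 2) =
   (fun y => \sum_(AB <- ABs) (AB.1 y + y j * AB.2 y) ^+ 2).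
  by apply/funext => y; rewrite big_map.
rewrite (E_sum_In us')//; last first.
  by move=> AB /pM[h1 h2]; apply: polD; [exact: polX|apply: polZ; exact: polX].
rewrite (E_sum_In us)//; last first.
  move=> AB /pM[h1 h2]; apply: polX; apply: polD; first exact: pol_cons.
  by apply: polM; [apply: pol_var; rewrite ?inE ?eqxx|exact: pol_cons].
have congr_In (l : seq (((I -> R) -> R) * ((I -> R) -> R))) f g :
    (forall AB, List.In AB l -> f AB = g AB) ->
    \sum_(AB <- l) f AB = \sum_(AB <- l) g AB :> R.
  elim: l => [|x l IHl] fg; first by rewrite !big_nil.
  rewrite !big_cons fg; last by left.
  by rewrite IHl// => z zl; apply: fg; right.
by apply: congr_In => AB /pM[h1 h2]; rewrite (E_affine_sq us' js h1 h2).
Qed.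

Lemma hypercontractivity s F : uniq s -> multiaffine s F ->
  E (fun y => dilate r F y ^+ m.*2) <= (E (fun y => F y ^+ 2)) ^+ m.
Proof.
move=> us mF; have := @hypercontractivity_seq s [:: F] us.
rewrite (_ : (fun y => (\sum_(F0 <- [:: F]) dilate r F0 y ^+ 2) ^+ m) =
   (fun y => dilate r F y ^+ m.*2)); last first.
  by apply/funext => y; rewrite big_seq1 -muln2 mulnC exprM.
rewrite (_ : (fun y => \sum_(F0 <- [:: F]) F0 y ^+ 2) = (fun y => F y ^+ 2)); last first.
  by apply/funext => y; rewrite big_seq1.
by apply=> G /= [<-|].
Qed.

(** Multi-affine monomials are orthogonal, and a dilation multiplies each by a constant. *)
Lemma dilate_selfadjoint s F G : uniq s -> multiaffine s F -> multiaffine s G ->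
  E (fun y => dilate r F y * G y) = E (fun y => F y * dilate r G y).
Proof.
elim: s F G => [|j s IH] F G us /=.
  by move=> [a FE] [b GE]; rewrite (funext FE) (funext GE).
move: us => /= /andP[js us] [A [B [mA mB FE]]] [A' [B' [mA' mB' GE]]].
have pp H : multiaffine s H -> pol s H /\ pol s (dilate r H).
  by move=> mH; split; apply: multiaffine_pol => //; exact: multiaffine_dilate.
have [pA pAr] := pp _ mA; have [pB pBr] := pp _ mB.
have [pA' pAr'] := pp _ mA'; have [pB' pBr'] := pp _ mB'.
have key (a b a' b' : (I -> R) -> R) : pol s a -> pol s b -> pol s a' -> pol s b' ->
    E (fun y => (a y + y j * b y) * (a' y + y j * b' y)) =
    E (fun y => a y * a' y) + v * E (fun y => b y * b' y).
  move=> pa pb pa' pb'.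
  have p1 : pol s (fun y => a y * a' y) by exact: polM.
  have p2 : pol s (fun y => a y * b' y + b y * a' y) by apply: polD; exact: polM.
  have p3 : pol s (fun y => b y * b' y) by exact: polM.
  have [i2 e2] := Ex_indep mY Yind Ymom 1 us js p2.
  have [i3 e3] := Ex_indep mY Yind Ymom 2 us js p3.
  have i1 := E_integ us p1.
  have -> : (fun y : I -> R => (a y + y j * b y) * (a' y + y j * b' y)) =
     (fun y => (a y * a' y + y j ^+ 1 * (a y * b' y + b y * a' y)) + y j ^+ 2 * (b y * b' y)).
    by apply/funext => y; ring.
  rewrite /E /at_Y ExD//; last exact: integD.
  rewrite ExD// [X in _ + X + _]e2 [X in _ + X]e3 Yodd// Yvar mul0r addr0.
  by [].
have -> : (fun y => dilate r F y * G y) =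
   (fun y => (dilate r A y + y j * (r * dilate r B y)) * (A' y + y j * B' y)).
  by apply/funext => y; rewrite /dilate FE GE; ring.
have -> : (fun y => F y * dilate r G y) =
   (fun y => (A y + y j * B y) * (dilate r A' y + y j * (r * dilate r B' y))).
  by apply/funext => y; rewrite /dilate FE GE; ring.
rewrite !key//; try exact: polZ.
rewrite IH//; congr (_ + v * _).
have -> : (fun y => r * dilate r B y * B' y) = (fun y => r * (dilate r B y * B' y)).
  by apply/funext => y; rewrite mulrA.
have -> : (fun y => B y * (r * dilate r B' y)) = (fun y => r * (B y * dilate r B' y)).
  by apply/funext => y; rewrite mulrCA.
rewrite (E_Z r us); last exact: polM.
rewrite (E_Z r us); last exact: polM.
by rewrite IH.
Qed.

End Hypercontractivity.

(** * Comparison of L^q and L^p norms of dilated forms *)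

Section ExponentMonotonicity.
Context {R : realType} {d : measure_display} {T : measurableType d}.
Variable P : probability T R.

Lemma LN_exponent_le (X : T -> R) (a b : R) : 0 < a -> a <= b -> measurable_fun setT X ->
  (LN P a X <= LN P b X)%E.
Proof.
move=> a0; rewrite le_eqVlt => /predU1P[->//|ab] mX.
have b0 : 0 < b by exact: lt_trans ab.
pose t := b / a; have t1 : 1 < t by rewrite ltr_pdivlMr// mul1r.
have t0 : 0 < t by exact: lt_trans t1.
pose u := (1 - t^-1)^-1.
have ti : t^-1 < 1 by rewrite invf_lt1.
have u0 : 0 < u by rewrite invr_gt0 subr_gt0.
have tu : t^-1 + u^-1 = 1 by rewrite invrK addrC subrK.
pose Z w := `|X w| `^ a.
have mZ : measurable_fun setT Z by apply/measurable_EFinP; exact: measurable_abs_powR.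
pose one (_ : T) : R := 1.
have m1 : measurable_fun setT one by exact: measurable_cst.
have := hoelder P mZ m1 t0 u0 tu.
have -> : ('N[P]_1[EFin \o (Z \* one)%R] = \int[P]_w (`|X w| `^ a)%:E)%E.
  rewrite Lnorm1; apply: eq_integral => w _ /=.
  by rewrite mulr1 ger0_norm// powR_ge0.
have -> : ('N[P]_u%:E[EFin \o one] = 1)%E.
  have -> : (EFin \o one = cst 1)%E by [].
  by rewrite Lnorm_cst1 (_ : _ setT = 1%E) ?poweR1r//; exact: probability_setT.
rewrite mule1 -/(LN P t Z) LNE => h.
have e1 : (\int[P]_w (`|Z w| `^ t)%:E = \int[P]_w (`|X w| `^ b)%:E)%E.
  apply: eq_integral => w _; rewrite ger0_norm ?powR_ge0// -powRrM.
  by rewrite /t mulrC divfK ?gt_eqF.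
rewrite e1 in h.
rewrite !LNE.
have -> : b^-1 = t^-1 * a^-1 by rewrite /t invf_div; field; rewrite !gt_eqF.
rewrite poweRrM; apply: gt0_ler_poweR => //; first by rewrite invr_ge0 ltW.
- by rewrite in_itv/= leey andbT integral_ge0// => w _; rewrite lee_fin powR_ge0.
- by rewrite in_itv/= leey andbT poweR_ge0.
Qed.

Lemma fin_of_even (X : T -> R) (n : nat) (q : R) : (0 < n)%N -> 0 < q -> q <= n.*2%:R ->
  measurable_fun setT X -> integ P (fun w => X w ^+ n.*2) -> fin P q X.
Proof.
move=> n0 q0 qn mX iX; split=> //; apply: le_lt_trans (LN_exponent_le q0 qn mX) _.
rewrite LNE; apply: poweR_lty.
have -> : (\int[P]_w (`|X w| `^ n.*2%:R)%:E)%E = mean P (fun w => X w ^+ n.*2).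
  apply: eq_integral => w _; congr EFin; rewrite powR_mulrn//.
  by rewrite -muln2 mulnC !exprM real_normK// num_real.
by rewrite (integ_meanE iX) ltry.
Qed.

Lemma nq_even (X : T -> R) (n : nat) : (0 < n)%N -> nq P n.*2%:R X `^ n.*2%:R = Ex P (fun w => X w ^+ n.*2).
Proof.
move=> n0; have n20 : n.*2%:R != 0 :> R by rewrite pnatr_eq0 double_eq0 -lt0n.
rewrite /nq -fine_poweR LN_pow// /Ex; congr fine.
apply: eq_integral => w _; congr EFin; rewrite powR_mulrn//.
by rewrite -muln2 mulnC !exprM real_normK// num_real.
Qed.

End ExponentMonotonicity.

Section Comparison.
Variables (R : realType) (m : nat) (r v : R).
Hypothesis m1 : (0 < m)%N.
Hypothesis r0 : 0 < r.
Hypothesis r1 : r <= 1.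
Hypothesis v0 : 0 <= v.

Definition qexp : R := m.*2%:R.
(** The exponent conjugate to [qexp]. *)
Definition pexp : R := qexp / (qexp - 1).

(** All that is used about the random variables.  The last condition says that the dilation factor [r]
    is small compared with the moments up to order [2 m]. *)
Record good_variables d (T : measurableType d) (P : probability T R) (I : eqType)
    (Y : I -> T -> R) : Prop := {
  good_meas : forall i, measurable_fun setT (Y i);
  good_indep : indep_family P Y;
  good_mom : forall i k, integ P (fun w => Y i w ^+ k);
  good_var : forall i, mu P Y i 2 = v;
  good_odd : forall i k, odd k -> mu P Y i k = 0;
  good_even : forall i j, (0 < j <= m)%N ->
    (m.+1 ^ 2 * 8 ^ m)%:R * r ^+ 2 * mu P Y i j.*2 <= v ^+ j }.

Lemma qexp2 : 2 <= qexp.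
Proof. by rewrite /qexp ler_nat -[2%N]/(1.*2) leq_double. Qed.

Lemma qexp0 : 0 < qexp. Proof. exact: lt_le_trans qexp2. Qed.

Lemma qexpB : 0 < qexp - 1.
Proof. by rewrite subr_gt0; apply: lt_le_trans qexp2; rewrite ltr1n. Qed.

Lemma pexp1 : 1 <= pexp.
Proof. by rewrite /pexp ler_pdivlMr ?qexpB// mul1r lerBlDr lerDl. Qed.

Lemma pexp0 : 0 < pexp. Proof. exact: lt_le_trans pexp1. Qed.

Lemma pexp_le2 : pexp <= 2.
Proof. by rewrite /pexp ler_pdivrMr ?qexpB//; have := qexp2; lra. Qed.

Lemma pqexp : pexp^-1 + qexp^-1 = 1.
Proof. by rewrite /pexp; field; rewrite !gt_eqF ?qexp0 ?qexpB. Qed.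

Section One.
Context d (T : measurableType d) (P : probability T R) (I : eqType) (Y : I -> T -> R).
Hypothesis Yg : good_variables P Y.
Implicit Types (s : seq I) (F G : (I -> R) -> R).

Let mY := good_meas Yg.
Let Yind := good_indep Yg.
Let Ymom := good_mom Yg.

Lemma pol_fin s G (q : R) : uniq s -> pol s G -> 0 < q -> q <= qexp -> fin P q (at_Y Y G).
Proof.
move=> us pG q0 qq; apply: (fin_of_even m1 q0 qq).
  exact: integ_meas (pol_integ mY Yind Ymom us pG).
exact: (pol_integ mY Yind Ymom us (polX m.*2 pG)).
Qed.

Lemma nq_hyper s F : uniq s -> multiaffine s F ->
  nq P qexp (at_Y Y (dilate r F)) <= nq P 2 (at_Y Y F).
Proof.
move=> us mF; apply: (@le_powR_inv _ qexp); first exact: qexp0.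
  exact: nq_ge0.
rewrite /qexp nq_even//.
have := hypercontractivity mY Yind Ymom v0 (good_var Yg) (good_odd Yg) r0 r1 (good_even Yg) us mF.
have -> : Ex P (at_Y Y (fun y => F y ^+ 2)) = nq P 2 (at_Y Y F) `^ 2.
  by rewrite -[2 in RHS]/(1%N.*2%:R) nq_even.
rewrite powR_mulrn ?nq_ge0// powR_mulrn ?nq_ge0//.
by rewrite -exprM mul2n.
Qed.

(** Dual to [nq_hyper]: the square of the left-hand side is the pairing of [F] with its double
    dilation, to which Hoelder's inequality with exponents [pexp] and [qexp] and then [nq_hyper]
    apply. *)
Lemma nq_dual s F : uniq s -> multiaffine s F ->
  nq P 2 (at_Y Y (dilate r F)) <= nq P pexp (at_Y Y F).
Proof.
move=> us mF; have mrF := multiaffine_dilate r mF.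
have mrrF := multiaffine_dilate r mrF.
set X := at_Y Y (dilate r F); set Z := at_Y Y (dilate r (dilate r F)); set W := at_Y Y F.
have pF := multiaffine_pol us mF; have prF := multiaffine_pol us mrF.
have prrF := multiaffine_pol us mrrF.
have mW : measurable_fun setT W by exact: integ_meas (pol_integ mY Yind Ymom us pF).
have mZ : measurable_fun setT Z by exact: integ_meas (pol_integ mY Yind Ymom us prrF).
have q2 := qexp2; have p2 := pexp_le2.
have fW : fin P pexp W by apply: (pol_fin us pF pexp0); exact: le_trans q2.
have fZ : fin P qexp Z by apply: (pol_fin us prrF qexp0).
have X2 : nq P 2 X ^+ 2 = Ex P (fun w => W w * Z w).
  have -> : nq P 2 X ^+ 2 = Ex P (fun w => X w ^+ 2).
    by rewrite -powR_mulrn ?nq_ge0// -[2 in LHS]/(1%N.*2%:R) nq_even.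
  rewrite -[RHS](dilate_selfadjoint mY Yind Ymom (good_var Yg) (good_odd Yg) r us mF mrF).
  by congr Ex; apply/funext => w; rewrite expr2.
have WZ : Ex P (fun w => W w * Z w) <= nq P pexp W * nq P qexp Z.
  have iWZ : integ P (fun w => W w * Z w) by exact: (pol_integ mY Yind Ymom us (polM pF prrF)).
  rewrite -lee_fin -integ_meanE// EFinM -!finE//.
  have h := hoelder P mW mZ pexp0 qexp0 pqexp; apply: le_trans h.
  rewrite Lnorm1; apply: le_integral => //.
    by have := integrable_abse iWZ.
  by move=> w _; rewrite /= lee_fin ler_norm.
have hy := nq_hyper us mrF.
have W0 := nq_ge0 P pexp W; have X0 := nq_ge0 P 2 X.
have [X00|Xn] := eqVneq (nq P 2 X) 0; first by rewrite X00.
have Xp : 0 < nq P 2 X by rewrite lt_neqAle eq_sym Xn.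
rewrite -(ler_pM2r Xp) -expr2 X2; apply: le_trans WZ _.
exact: ler_wpM2l.
Qed.

End One.

(** Both norms are compared with the common second moment of the singly dilated forms. *)
Lemma compare_nq d (T : measurableType d) (P : probability T R) (I : eqType) (Y : I -> T -> R)
    d' (T' : measurableType d') (P' : probability T' R) (I' : eqType) (Y' : I' -> T' -> R)
    s F s' F' :
  good_variables P Y -> good_variables P' Y' ->
  uniq s -> multiaffine s F -> uniq s' -> multiaffine s' F' ->
  Ex P (at_Y Y (fun y => dilate r F y ^+ 2)) = Ex P' (at_Y Y' (fun y => dilate r F' y ^+ 2)) ->
  nq P qexp (at_Y Y (dilate r (dilate r F))) <= nq P' pexp (at_Y Y' F').
Proof.
move=> Yg Yg' us mF us' mF' e.
apply: le_trans (nq_hyper Yg us (multiaffine_dilate r mF)) _.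
apply: le_trans (nq_dual Yg' us' mF').
have nE d1 (T1 : measurableType d1) (P1 : probability T1 R) (I1 : eqType) (Y1 : I1 -> T1 -> R) G :
    nq P1 2 (at_Y Y1 G) `^ 2 = Ex P1 (at_Y Y1 (fun y => G y ^+ 2)).
  by rewrite -[2 in LHS]/(1%N.*2%:R) nq_even.
by apply: (@le_powR_inv _ 2) => //; [exact: nq_ge0|rewrite !nE e].
Qed.

End Comparison.

(** * Moments of Rademacher variables *)

Section Laws.
Context {R : realType}.

Lemma one_neqN1 : (1 : R) <> -1. Proof. lra. Qed.

Lemma integral_law d (T : measurableType d) (P : probability T R)
    d' (T' : measurableType d') (nu : {measure set T' -> \bar R})
    (X : T -> R) (X' W' : T' -> R) (phi : R -> R) :
  measurable_fun setT X -> measurable_fun setT X' -> measurable_fun setT W' ->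
  measurable_fun setT phi -> (forall w, 0 <= W' w) -> (forall x, 0 <= phi x) ->
  (forall B, measurable B -> P (X @^-1` B) = \int[nu]_w (\1_B (X' w) * W' w)%:E)%E ->
  (\int[P]_w (phi (X w))%:E = \int[nu]_w (phi (X' w) * W' w)%:E)%E.
Proof.
move=> mX mX' mW' mphi W'0 phi0 h; rewrite -[RHS]mule1.
under [in LHS]eq_integral do rewrite -[phi _]mulr1.
apply: (@integral_weighted R _ _ P _ _ nu X (fun=> 1) X' W' 1%E phi) => // B mB; rewrite mule1 -h//.
under eq_integral do rewrite mulr1.
have mpre : measurable (X @^-1` B) by rewrite -[X in measurable X]setTI; exact: mX.
rewrite (_ : (fun w => _) = (fun w => (\1_(X @^-1` B) w)%:E))//.
by rewrite integral_indic// setIT.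
Qed.

Section OneVariable.
Context d (T : measurableType d) (P : probability T R).
Variable X : T -> R.
Hypothesis mX : measurable_fun setT X.

Let mpre B : measurable B -> measurable (X @^-1` B).
Proof. by move=> mB; rewrite -[X in measurable X]setTI; exact: mX. Qed.

(** The positive part of [X^k] has the same law as the negative part. *)
Lemma odd_moment_symmetric k : odd k -> integ P (fun w => X w ^+ k) ->
  (forall B, measurable B -> P (X @^-1` B) = P ((fun w => - X w) @^-1` B)) ->
  Ex P (fun w => X w ^+ k) = 0.
Proof.
move=> ok iX symX; have mN : measurable_fun setT (fun w => - X w) by exact: measurableT_comp.
pose phi (x : R) := Num.max (x ^+ k) 0.
have mphi : measurable_fun setT phi.
  by apply: measurable_maxr => //; exact: measurable_funX.
have phi0 x : 0 <= phi x by rewrite le_max lexx orbT.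
have h : (\int[P]_w (phi (X w))%:E = \int[P]_w (phi (- X w))%:E)%E.
  under [RHS]eq_integral do rewrite -[phi _]mulr1.
  apply: integral_law => // B mB; rewrite symX//.
  under eq_integral do rewrite mulr1.
  rewrite (_ : (fun w => _) = (fun w => (\1_((fun w => - X w) @^-1` B) w)%:E))//.
  by rewrite integral_indic ?setIT//; rewrite -[X in measurable X]setTI; exact: mN.
rewrite /Ex /mean (integralE _ _ (fun w => (X w ^+ k)%:E)).
have -> : (\int[P]_w ((fun w0 => (X w0 ^+ k)%:E)^\+ w) = \int[P]_w (phi (X w))%:E)%E.
  by apply: eq_integral => w _; rewrite funeposE /phi EFin_max.
have -> : (\int[P]_w ((fun w0 => (X w0 ^+ k)%:E)^\- w) = \int[P]_w (phi (X w))%:E)%E.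
  rewrite h; apply: eq_integral => w _.
  by rewrite funenegE /phi exprNn -signr_odd ok expr1 mulN1r EFin_max.
have [->|fin0] := eqVneq (\int[P]_w (phi (X w))%:E)%E +oo%E; first by [].
rewrite subee//; rewrite ge0_fin_numE ?lt_neqAle ?fin0 ?leey//.
by apply: integral_ge0 => w _; rewrite lee_fin.
Qed.

Lemma integ_power_even k : integ P (fun w => X w ^+ k.*2) -> integ P (fun w => X w ^+ k).
Proof.
move=> iX; have := integD (integ_cst P 1) iX => i1.
apply: (le_integrable measurableT _ _ i1).
  by apply/measurable_EFinP; exact: measurable_funX.
move=> w _; rewrite /= lee_fin -muln2 exprM.
rewrite [X in _ <= X]ger0_norm ?addr_ge0 ?sqr_ge0//.
set y := X w ^+ k; rewrite ler_norml; apply/andP; split; nra.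
Qed.

Definition rademacher_law := P (X @^-1` [set 1]) = (2^-1)%:E /\ P (X @^-1` [set (-1)]) = (2^-1)%:E.

(** The two atoms already have total mass one. *)
Lemma rademacher_abs1 : rademacher_law -> {ae P, forall w, X w ^+ 2 = 1}.
Proof.
move=> [h1 h2]; exists (~` (X @^-1` [set 1] `|` X @^-1` [set (-1)])); split.
- by apply: measurableC; apply: measurableU; exact: mpre.
- rewrite probability_setC; last by apply: measurableU; exact: mpre.
  rewrite [X in (1 - X)%E](_ : _ = 1%E) ?subee//.
  transitivity (P (X @^-1` [set 1%R]) + P (X @^-1` [set (-1)%R]))%E; last first.
    by rewrite h1 h2 -EFinD (_ : _ + _ = 1 :> R)//; lra.
  apply: measureU; try exact: mpre.
  by apply/seteqP; split=> // w [/= ->] /one_neqN1.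
- move=> w /= nx; apply/not_orP; split => /= e; apply: nx; rewrite e ?sqrrN expr1n//.
Qed.

Lemma rademacher_moments : rademacher_law -> 
  [/\ forall k, integ P (fun w => X w ^+ k), forall k, Ex P (fun w => X w ^+ k.*2) = 1 &
      forall k, odd k -> Ex P (fun w => X w ^+ k) = 0].
Proof.
move=> hX; have ae1 := rademacher_abs1 hX.
have mXk k : measurable_fun setT (fun w => (X w ^+ k)%:E) by apply/measurable_EFinP; exact: measurable_funX.
have aek k : ae_eq P setT (fun=> 1%E) (fun w => (X w ^+ k.*2)%:E).
  by apply: filterS ae1 => w Xw _; rewrite -muln2 mulnC exprM Xw expr1n.
have ev k : integ P (fun w => X w ^+ k.*2).
  apply/integrableP; split; first exact: mXk.
  rewrite [X in (X < _)%E](_ : _ = (\int[P]_w (X w ^+ k.*2)%:E)%E); last first.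
    by apply: eq_integral => w _ /=; rewrite -muln2 mulnC exprM ger0_norm// exprn_ge0// sqr_ge0.
  rewrite -(ae_eq_integral (fun w => (X w ^+ k.*2)%:E) (fun=> 1%E) measurableT (measurable_cst _) (mXk _) (aek k))//.
  have /integrableP[_] := integ_cst P 1.
  by rewrite (_ : (fun w => _) = fun=> 1%E)//; apply/funext => w; rewrite /= normr1.
split; first by move=> k; exact: integ_power_even.
  move=> k; rewrite /Ex /mean -(ae_eq_integral (fun w => (X w ^+ k.*2)%:E) (fun=> 1%E) measurableT (measurable_cst _) (mXk _) (aek k))//.
  exact: (Ex_cst P 1).
move=> k ok; case: hX => h1 h2.
have m1 : measurable (X @^-1` [set 1]) by exact: mpre.
have m2 : measurable (X @^-1` [set (-1)]) by exact: mpre.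
have i1 : integ P (fun w => \1_(X @^-1` [set 1]) w) by exact: integrable_indic.
have i2 : integ P (fun w => \1_(X @^-1` [set (-1)]) w) by exact: integrable_indic.
have E1 : Ex P (fun w => \1_(X @^-1` [set 1]) w) = 2^-1.
  by rewrite /Ex /mean integral_indic// setIT; exact: (congr1 fine h1).
have E2 : Ex P (fun w => \1_(X @^-1` [set (-1)]) w) = 2^-1.
  by rewrite /Ex /mean integral_indic// setIT; exact: (congr1 fine h2).
have iN := integZ (-1) i2; have iD := integD i1 iN.
have <- : Ex P (fun w => \1_(X @^-1` [set 1]) w + -1 * \1_(X @^-1` [set (-1)]) w) = 0.
  by rewrite ExD// ExZ// E1 E2; lra.
rewrite /Ex /mean; congr fine; apply: ae_eq_integral => //.
  by apply/measurable_EFinP; exact: integ_meas iD.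
apply: filterS ae1 => w /eqP; rewrite sqrf_eq1 => /orP[] /eqP Xw _; congr EFin.
  rewrite Xw expr1n !indicE mem_set//= memNset ?mulr0 ?addr0//= Xw.
  exact: one_neqN1.
rewrite Xw -signr_odd ok expr1 !indicE memNset ?mem_set//= ?mulr1 ?add0r//= Xw.
by move/esym/one_neqN1.
Qed.

End OneVariable.
End Laws.

(** * Moments of Gaussian variables *)

Section Gaussian.
Context {R : realType}.
Notation leb := (@lebesgue_measure R).
Notation pdf := (@normal_pdf R 0 1).

Definition gaussian_law d (T : measurableType d) (P : probability T R) (X : T -> R) :=
  forall B : set R, measurable B -> P (X @^-1` B) = normal_prob 0 1 B.

Lemma normal_probE (B : set R) : measurable B ->
  normal_prob 0 1 B = (\int[leb]_x (\1_B x * pdf x)%:E)%E.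
Proof.
move=> mB; rewrite /normal_prob integral_mkcond; apply: eq_integral => x _.
by rewrite patchE indicE; case: ifPn => _; rewrite ?mul1r ?mul0r.
Qed.

Lemma pdfE x : pdf x = normal_peak 1 * expR (- (x ^+ 2 / 2)).
Proof.
rewrite normal_pdfE ?oner_neq0// /normal_fun subr0 expr1n.
by congr (_ * expR _); rewrite mulNr.
Qed.

Lemma pdfN x : pdf (- x) = pdf x. Proof. by rewrite !pdfE sqrrN. Qed.

Lemma lebesgue_reflection (h : R -> R) : measurable_fun setT h -> (forall x, 0 <= h x) ->
  (\int[leb]_x (h (- x))%:E = \int[leb]_x (h x)%:E)%E.
Proof.
move=> mh h0.
have mN : measurable_fun [set: measurableTypeR R] (-%R : _ -> measurableTypeR R) by exact: oppr_measurable.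
have mhE : measurable_fun [set: measurableTypeR R] (EFin \o h) by exact/measurable_EFinP.
have := @ge0_integral_pushforward _ _ (measurableTypeR R) (measurableTypeR R) R -%R mN leb setT (EFin \o h) measurableT mhE.
move=> <-; last by move=> y _; rewrite /= lee_fin.
by apply: eq_measure_integral => A mA _; exact: lebesgue_measureN.
Qed.

(** From [y^k / k! <= exp y] at [y = x^2 / 4], which costs half of the Gaussian exponent. *)
Lemma power_le_exp (k : nat) (x : R) :
  x ^+ k.*2 * expR (- (x ^+ 2 / 2)) <= (k`! * 4 ^ k)%:R * expR (- (x ^+ 2 / 4)).
Proof.
pose y := x ^+ 2 / 4; have y0 : 0 <= y by rewrite divr_ge0// sqr_ge0.
have -> : x ^+ 2 / 2 = y + y by rewrite /y; lra.
have -> : x ^+ 2 / 4 = y by [].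
rewrite opprD expRD mulrA ler_wpM2r ?expR_ge0//.
have -> : x ^+ k.*2 = 4 ^+ k * y ^+ k.
  by rewrite -muln2 mulnC exprM -exprMn /y mulrC divfK.
rewrite natrM natrX [_%:R * _]mulrC -mulrA ler_wpM2l ?exprn_ge0//.
rewrite -ler_pdivlMr ?expR_gt0// -expRN opprK.
rewrite -ler_pdivrMl ?ltr0n ?fact_gt0//.
case: k => [|k]; first by rewrite expr0 invr1 mulr1 -expR0 ler_expR.
by apply: le_trans (expR_ge1Dxn k y0); rewrite mulrC lerDr.
Qed.

(** What remains of the exponent is up to a constant the density of the normal law of variance two. *)
Lemma gaussian_power_finite k : (\int[leb]_x (x ^+ k.*2 * pdf x)%:E < +oo)%E.
Proof.
have s0 : Num.sqrt (2 : R) != 0 by rewrite gt_eqF// sqrtr_gt0.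
pose C : R := normal_peak 1 * (k`! * 4 ^ k)%:R / normal_peak (Num.sqrt 2).
have np : 0 < normal_peak (Num.sqrt 2 : R) by exact: normal_peak_gt0.
have C0 : 0 <= C by rewrite !mulr_ge0 ?invr_ge0 ?ler0n ?normal_peak_ge0.
apply: (@le_lt_trans _ _ (\int[leb]_x (C%:E * (normal_pdf 0 (Num.sqrt 2) x)%:E))%E); last first.
  rewrite ge0_integralZl_EFin//.
  - by rewrite integral_normal_pdf mule1 ltry.
  - by move=> x _; rewrite lee_fin normal_pdf_ge0.
  - by apply/measurable_EFinP; exact: measurable_normal_pdf.
apply: ge0_le_integral => //.
- by move=> x _; rewrite lee_fin mulr_ge0 ?normal_pdf_ge0// -muln2 mulnC exprM exprn_ge0 ?sqr_ge0.
- apply/measurable_EFinP; apply: measurable_funM; last exact: measurable_normal_pdf.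
  exact: measurable_funX.
- by apply: measurable_funeM; apply/measurable_EFinP; exact: measurable_normal_pdf.
move=> x _; rewrite -EFinM lee_fin pdfE normal_pdfE// /normal_fun subr0 sqr_sqrtr//.
rewrite mulrCA; apply: le_trans (ler_wpM2l (normal_peak_ge0 1) (power_le_exp k x)) _.
rewrite (_ : - (x ^+ 2) / (2 *+ 2) = - (x ^+ 2 / 4)); last by field.
set b := expR _; rewrite [X in _ <= X](_ : _ = normal_peak 1 * ((k`! * 4 ^ k)%:R * b)) ?lexx//.
by rewrite /C; field; rewrite gt_eqF.
Qed.

Definition gaussian_moment k : R := fine (\int[leb]_x (x ^+ k * pdf x)%:E)%E.

Lemma gaussian_variance_gt0 : 0 < gaussian_moment 2.
Proof.
have mx k : measurable_fun setT (fun x : R => (x ^+ k * pdf x)%:E).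
  apply/measurable_EFinP; apply: measurable_funM; last exact: measurable_normal_pdf.
  exact: measurable_funX.
have np : 0 < normal_peak (1 : R) by apply: normal_peak_gt0; rewrite oner_eq0.
pose e : R := normal_peak 1 * expR (- 2).
have e0 : 0 < e by rewrite mulr_gt0 ?expR_gt0.
rewrite /gaussian_moment -lte_fin fineK; last first.
  rewrite ge0_fin_numE; first exact: (gaussian_power_finite 1).
  by apply: integral_ge0 => x _; rewrite lee_fin mulr_ge0 ?normal_pdf_ge0 ?sqr_ge0.
apply: (@lt_le_trans _ _ (\int[leb]_x (e%:E * (\1_`[1%R, 2%R] x)%:E))%E).
  rewrite ge0_integralZl_EFin//; last 2 first.
  - by apply/measurable_EFinP; exact: measurable_indic.
  - exact: ltW.
  rewrite integral_indic//= setIT lebesgue_measure_itv/= lte_fin ltr1n -EFinB.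
  by rewrite mule_gt0 ?lte_fin//; lra.
apply: ge0_le_integral => //.
- by move=> x _; rewrite mule_ge0 ?lee_fin ?(ltW e0)// indicE. 
- by apply: measurable_funeM; apply/measurable_EFinP; exact: measurable_indic.
- exact: mx.
move=> x _; rewrite -EFinM lee_fin indicE.
have [|_] := boolP (x \in _); last by rewrite mulr0 mulr_ge0 ?normal_pdf_ge0 ?sqr_ge0.
rewrite inE /= in_itv/= mulr1 => /andP[x1 x2].
have xx : 1 <= x ^+ 2 <= 4 by apply/andP; split; nra.
case/andP: xx => xx1 xx2.
apply: (@le_trans _ _ (pdf x)); last by rewrite ler_peMl ?normal_pdf_ge0.
rewrite pdfE /e; apply: (ler_wpM2l (ltW np)); rewrite ler_expR; lra.
Qed.

Section OneVariable.
Context d (T : measurableType d) (P : probability T R).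
Variable X : T -> R.
Hypothesis mX : measurable_fun setT X.
Hypothesis hX : gaussian_law P X.

Let mpdf : measurable_fun [set: measurableTypeR R] pdf.
Proof. exact: measurable_normal_pdf. Qed.

Lemma gaussian_integral (phi : R -> R) : measurable_fun setT phi -> (forall x, 0 <= phi x) ->
  (\int[P]_w (phi (X w))%:E = \int[leb]_x (phi x * pdf x)%:E)%E.
Proof.
move=> mphi phi0; apply: (@integral_law _ _ _ P _ (measurableTypeR R) leb X id) => //.
- by move=> x; exact: normal_pdf_ge0.
- by move=> B mB; rewrite hX// normal_probE.
Qed.

Lemma gaussian_symmetric (B : set R) : measurable B ->
  P (X @^-1` B) = P ((fun w => - X w) @^-1` B).
Proof.
move=> mB; pose B' : set R := -%R @^-1` B.
have mB' : measurable B' by rewrite -[X in measurable X]setTI; exact: oppr_measurable.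
rewrite hX// (_ : _ @^-1` B = X @^-1` B')// hX// !normal_probE//.
rewrite -lebesgue_reflection.
- by apply: eq_integral => x _; rewrite pdfN.
- by apply: measurable_funM => //; exact: measurable_indic.
- by move=> x; rewrite mulr_ge0 ?normal_pdf_ge0// indicE.
Qed.

Lemma gaussian_moments :
  [/\ forall k, integ P (fun w => X w ^+ k),
      forall k, Ex P (fun w => X w ^+ k.*2) = gaussian_moment k.*2 &
      forall k, odd k -> Ex P (fun w => X w ^+ k) = 0].
Proof.
have ev0 k (x : R) : 0 <= x ^+ k.*2 by rewrite -muln2 mulnC exprM exprn_ge0 ?sqr_ge0.
have e k : (\int[P]_w (X w ^+ k.*2)%:E = \int[leb]_x (x ^+ k.*2 * pdf x)%:E)%E.
  by apply: (gaussian_integral (phi := fun x => x ^+ k.*2)) => //; exact: measurable_funX.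
have ev k : integ P (fun w => X w ^+ k.*2).
  apply/integrableP; split; first by apply/measurable_EFinP; exact: measurable_funX.
  rewrite [X in (X < _)%E](_ : _ = (\int[P]_w (X w ^+ k.*2)%:E)%E); last first.
    by apply: eq_integral => w _ /=; rewrite ger0_norm.
  by rewrite e; exact: gaussian_power_finite.
have iX k : integ P (fun w => X w ^+ k) by exact: integ_power_even.
split=> // [k|k ok]; first by rewrite /Ex /mean e.
by apply: odd_moment_symmetric => //; exact: gaussian_symmetric.
Qed.

End OneVariable.
End Gaussian.

(** * Independent copies of a sequence *)

Section Copies.
Context {R : realType}.

Lemma seq_measurable_cylinder (u : seq nat) (B : nat -> set R) : (forall j, measurable (B j)) ->
  seq_measurable [set x : nat -> R | forall j, j \in u -> B j (x j)].
Proof.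
move=> mB; pose G := [set A | exists (j : nat) (B : set R),
         measurable B /\ A = [set x : nat -> R | B (x j)]].
have -> : [set x : nat -> R | forall j, j \in u -> B j (x j)] =
   \big[setI/setT]_(j <- u) [set x : nat -> R | B j (x j)].
  rewrite -bigcap_seq; apply/seteqP; split=> x h j; exact: h.
have sG : sigma_algebra setT (seq_measurable (R := R)) by exact: smallest_sigma_algebra.
have mI A1 A2 : seq_measurable A1 -> seq_measurable A2 -> @seq_measurable R (A1 `&` A2).
  exact: (@measurableI _ (g_sigma_algebraType G) A1 A2).
elim: u => [|j u IH].
  by rewrite big_nil; exact: (@measurableT _ (g_sigma_algebraType G)).
rewrite big_cons; apply: mI => //; apply: sub_sigma_algebra.
by exists j, (B j).
Qed.

Context d (T : measurableType d) (P : probability T R) (X : nat -> {RV P >-> R}).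
Context d' (T' : measurableType d') (P' : probability T' R) (XX : nat -> nat -> {RV P' >-> R}).
Hypothesis Xind : mutually_independent P measurable (fun j w => X j w).
Hypothesis copies : independent_copies P X P' XX.

Lemma copy_marginal i j (B : set R) : measurable B ->
  P' ((fun w => XX i j w) @^-1` B) = P ((fun w => X j w) @^-1` B).
Proof.
move=> mB; have := (copies.2 i [set x | forall j0, j0 \in [:: j] -> B (x j0)]
  (@seq_measurable_cylinder [:: j] (fun=> B) (fun=> mB))).
rewrite (_ : [set w | _] = (fun w => XX i j w) @^-1` B); last first.
  apply/seteqP; split=> w /= h; first by apply: h; rewrite inE.
  by move=> j0; rewrite inE => /eqP ->.
move=> ->; congr (P _); apply/seteqP; split=> w /= h; first by apply: h; rewrite inE.
by move=> j0; rewrite inE => /eqP ->.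
Qed.

Lemma prod_fibers (s : seq (nat * nat)) (r : seq nat) (F : nat * nat -> \bar R) :
  uniq r -> (forall p, p \in s -> p.1 \in r) ->
  (\prod_(i <- r) \prod_(p <- s | p.1 == i) F p = \prod_(p <- s) F p)%E.
Proof.
move=> ur sr; under eq_bigr do rewrite big_mkcond.
rewrite exchange_big; apply: eq_big_seq => p ps.
rewrite (bigD1_seq p.1) ?sr//= eqxx big1 ?mule1// => i.
by rewrite eq_sym => /negbTE ->.
Qed.

(** The events are grouped by columns.  The columns are independent, each has the law of the sequence
    [X], and the coordinates of [X] are independent. *)
Lemma copies_indep : indep_family P' (fun (ij : nat * nat) w => XX ij.1 ij.2 w).
Proof.
move=> s B us mB; pose r := undup (map fst s).
have ur : uniq r by exact: undup_uniq.
have sr p : p \in s -> p.1 \in r by move=> ps; rewrite mem_undup map_f.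
pose c i := [seq p.2 | p <- s & p.1 == i].
have uc i : uniq (c i).
  rewrite map_inj_in_uniq ?filter_uniq// => -[a1 b1] [a2 b2].
  by rewrite !mem_filter /= => /andP[/eqP-> _] /andP[/eqP-> _] ->.
have memc i j : (j \in c i) = ((i, j) \in s).
  apply/mapP/idP => [[[a b]]|ijs].
    by rewrite mem_filter /= => /andP[/eqP<- h] ->.
  by exists (i, j) => //; rewrite mem_filter /= eqxx.
pose A i := [set x : nat -> R | forall j, j \in c i -> B (i, j) (x j)].
have mA i : seq_measurable (A i) by apply: (@seq_measurable_cylinder (c i) (fun j => B (i, j))) => j; exact: mB.
have -> : \bigcap_(ij in [set` s]) (fun w => XX ij.1 ij.2 w) @^-1` B ij =
    \bigcap_(i in [set` r]) (fun w j => XX i j w) @^-1` A i.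
  apply/seteqP; split=> w h.
    move=> i _ j; rewrite memc => ijs; exact: (h (i, j) ijs).
  by move=> [i j] ijs; apply: (h i); [exact: (sr _ ijs)|rewrite memc].
rewrite (copies.1 r A ur mA) -(prod_fibers _ ur sr); apply: eq_bigr => i _.
transitivity (P (\bigcap_(j in [set` c i]) (fun w => X j w) @^-1` B (i, j))).
  exact: (copies.2 i _ (mA i)).
rewrite (Xind (uc i) (fun j => mB (i, j))) big_map big_filter.
by apply: eq_bigr => -[a b] /= /eqP ->; rewrite copy_marginal.
Qed.
End Copies.

(** * Choice of the dilation factor *)

Section DilationFactor.
Context {R : realType}.

Lemma small_square (n : nat) (a b : nat -> R) : (forall j, 0 < b j) ->
  exists2 r : R, 0 < r <= 1 & forall j, (j < n)%N -> a j * r ^+ 2 <= b j.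
Proof.
move=> b0; elim: n => [|n [r /andP[r0 r1] IH]]; first by exists 1 => //; rewrite ltr01 lexx.
pose t := b n / (`|a n| + b n + 1).
have den : 0 < `|a n| + b n + 1 by rewrite ltr_wpDl// addr_ge0// ltW.
have t0 : 0 < t by rewrite divr_gt0.
pose u := Num.min r t; have u0 : 0 < u by rewrite lt_min r0 t0.
have ur : u <= r by rewrite ge_min lexx.
have ut : u <= t by rewrite ge_min lexx orbT.
have u2r : u ^+ 2 <= r ^+ 2 by rewrite ler_pXn2r// nnegrE ltW.
exists u; first by rewrite u0 (le_trans ur).
move=> j; rewrite ltnS leq_eqVlt => /predU1P[->|jn]; last first.
  have [aj|aj] := leP 0 (a j); first by apply: le_trans (IH j jn); exact: ler_wpM2l.
  by apply: le_trans (ltW (b0 j)); rewrite mulr_le0_ge0 ?sqr_ge0 ?ltW.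
apply: le_trans (ler_norm _) _; rewrite normrM (ger0_norm (sqr_ge0 u)).
have u1 : u <= 1 by exact: le_trans r1.
have : u ^+ 2 <= t by apply: le_trans ut; rewrite expr2 ler_piMl// ltW.
move=> /(ler_wpM2l (normr_ge0 (a n))) /le_trans; apply.
rewrite /t mulrA ler_pdivrMr// mulrC ler_wpM2l ?(ltW (b0 n))//.
by rewrite -addrA lerDl addr_ge0// ltW.
Qed.

Definition chaos_law (rad : bool) d (T : measurableType d) (P : probability T R) (X : T -> R) :=
  if rad then rademacher_law P X else gaussian_law P X.

(** The factor [r] depends on [m] and on the moments of the two laws only; in particular one value serves
    both laws, all sequences and all of their copies. *)
Lemma good_parameters (m : nat) : (0 < m)%N ->
  exists2 r : R, 0 < r <= 1 & forall rad : bool, exists2 v : R, 0 <= v &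
  forall d (T : measurableType d) (P : probability T R) (I : eqType) (Y : I -> T -> R),
  (forall i, measurable_fun setT (Y i)) -> indep_family P Y ->
  (forall i, chaos_law rad P (Y i)) -> good_variables m r v P Y.
Proof.
move=> m0; pose K : R := (m.+1 ^ 2 * 8 ^ m)%:R.
pose g : nat -> R := gaussian_moment.
have g0 : 0 < g 2 by exact: gaussian_variance_gt0.
(* one bound for the moments of both laws: the Rademacher moments and variance are one *)
pose b j := Num.min 1 (g 2 ^+ j).
have b0 j : 0 < b j by rewrite lt_min ltr01 exprn_gt0.
have [r r01 hr] := @small_square m.+1 (fun j => K * Num.max 1 (g j.*2)) b b0.
have K0 : 0 <= K by rewrite ler0n.
exists r => // -[].
- exists 1 => // d T P I Y mY Yind Ylaw.
  have mom i := rademacher_moments (mY i) (Ylaw i).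
  split=> //.
  + by move=> i; case: (mom i).
  + by move=> i; case: (mom i) => _ /(_ 1%N).
  + by move=> i k ok; case: (mom i) => _ _; apply.
  + move=> i j /andP[_ jm]; case: (mom i) => _ /(_ j) e _; rewrite /mu e.
    rewrite mulr1 expr1n; have := hr j jm.
    move=> /le_trans /(_ (_ : b j <= 1)) h; apply: le_trans (h _); last by rewrite ge_min lexx.
    by rewrite ler_wpM2r ?sqr_ge0// ler_peMr// le_max lexx.
- exists (g 2); first exact: ltW.
  move=> d T P I Y mY Yind Ylaw.
  have mom i := gaussian_moments (mY i) (Ylaw i).
  split=> //.
  + by move=> i; case: (mom i).
  + by move=> i; case: (mom i) => _ /(_ 1%N).
  + by move=> i k ok; case: (mom i) => _ _; apply.
  + move=> i j /andP[_ jm]; case: (mom i) => _ /(_ j) e _; rewrite /mu e.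
    rewrite mulrAC; have := hr j jm.
    move=> /le_trans /(_ (_ : b j <= g 2 ^+ j)) h; apply: le_trans (h _); last by rewrite ge_min lexx orbT.
    by rewrite ler_wpM2r ?sqr_ge0// ler_wpM2l// le_max lexx orbT.
Qed.
End DilationFactor.

Section Sequences.
Context {R : realType}.
Context d (T : measurableType d) (P : probability T R) (X : nat -> {RV P >-> R}).
Context d' (T' : measurableType d') (P' : probability T' R) (XX : nat -> nat -> {RV P' >-> R}).

Lemma sequence_law : rademacher_sequence P X \/ gaussian_sequence P X ->
  mutually_independent P measurable (fun j w => X j w) /\
  exists rad, forall j, chaos_law rad P (fun w => X j w).
Proof. by move=> [[h1 h2]|[h1 h2]]; (split; first by []); [exists true|exists false]. Qed.

Lemma copies_law rad : independent_copies P X P' XX ->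
  (forall j, chaos_law rad P (fun w => X j w)) ->
  forall ij : nat * nat, chaos_law rad P' (fun w => XX ij.1 ij.2 w).
Proof.
move=> hc hX [i j] /=; have := hX j; rewrite /chaos_law; case: rad {hX} => [[h1 h2]|h].
  by split; rewrite (copy_marginal hc).
by move=> B mB; rewrite (copy_marginal hc)//; exact: h.
Qed.
End Sequences.

(** * Chaos polynomials *)

Section ChaosPolynomials.
Context {R : realType}.

(** Index tuples [t] of all lengths are lists; [M t] is the list of variables in the monomial of [t].
    The coupled chaos has [M t = t], the decoupled one [M t = cells t]. *)
Definition chaos (I : eqType) (M : seq nat -> seq I) (U : seq (seq nat)) (g : seq nat -> R)
    (y : I -> R) : R := \sum_(t <- U) g t * \prod_(p <- M t) y p.

Definition letters (I : eqType) (M : seq nat -> seq I) (U : seq (seq nat)) : seq I :=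
  undup (flatten [seq M t | t <- U]).

(** The position of an index selects the copy: the decoupled monomial of [t] is the product of the
    variables [(l, t_l)].  Different tuples have different cells, which is why decoupled monomials are
    orthogonal. *)
Definition cells (t : seq nat) : seq (nat * nat) := zip (iota 0 (size t)) t.

Lemma uniq_cells t : uniq (cells t).
Proof.
have : uniq (unzip1 (cells t)) by rewrite unzip1_zip ?size_iota// iota_uniq.
exact: map_uniq.
Qed.

Lemma size_cells t : size (cells t) = size t.
Proof. by rewrite size_zip size_iota minnn. Qed.

Lemma nth_cells t l : (l < size t)%N -> nth (0, 0)%N (cells t) l = (l, nth 0%N t l).
Proof. by move=> lt; rewrite nth_zip ?size_iota// nth_iota. Qed.

Lemma mem_cells t l x : ((l, x) \in cells t) = (l < size t)%N && (nth 0%N t l == x).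
Proof.
apply/idP/idP => [/(nthP (0, 0)%N) [k]|/andP[lt /eqP <-]].
  by rewrite size_cells => kt; rewrite nth_cells// => -[<- <-]; rewrite kt eqxx.
by rewrite -nth_cells//; apply: mem_nth; rewrite size_cells.
Qed.

Lemma perm_cells t t' : perm_eq (cells t) (cells t') = (t == t').
Proof.
apply/idP/eqP => [h|->]; last exact: perm_refl.
have := perm_size h; rewrite !size_cells => st.
apply: (@eq_from_nth _ 0%N) => // l lt; have := perm_mem h (l, nth 0%N t l).
by rewrite !mem_cells lt eqxx /= => /esym /andP[_ /eqP].
Qed.

Section OneFamily.
Variables (I : eqType) (M : seq nat -> seq I) (U : seq (seq nat)).
Hypothesis uM : forall t, t \in U -> uniq (M t).

Lemma uniq_letters : uniq (letters M U). Proof. exact: undup_uniq. Qed.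

Lemma multiaffine_chaos g : multiaffine (letters M U) (chaos M U g).
Proof.
have h V : {subset V <= U} -> multiaffine (letters M U) (chaos M V g).
  elim: V => [|t V IH] VU.
    by rewrite (_ : chaos _ _ _ = fun=> 0) ?funeqE => [|y]; [exact: multiaffine_cst|rewrite /chaos big_nil].
  rewrite (_ : chaos _ _ _ = fun y => g t * \prod_(p <- M t) y p + chaos M V g y); last first.
    by apply/funext => y; rewrite /chaos big_cons.
  have tU : t \in U by apply: VU; rewrite inE eqxx.
  apply: multiaffine_lin; last by apply: IH => x xV; apply: VU; rewrite inE xV orbT.
  apply: multiaffine_monomial; first exact: uM.
  by move=> p pt; rewrite mem_undup; apply/flattenP; exists (M t) => //; exact: map_f.
exact: h.
Qed.

Lemma dilate_chaos r g : dilate r (chaos M U g) = chaos M U (fun t => r ^+ size (M t) * g t).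
Proof.
apply/funext => y; rewrite /dilate /chaos; apply: eq_bigr => t _.
rewrite big_split /= big_const_seq count_predT iter_mulr_1.
by rewrite mulrCA mulrA.
Qed.

Variables (m : nat) (r v : R).
Context d (T : measurableType d) (P : probability T R) (Y : I -> T -> R).
Hypothesis Yg : good_variables m r v P Y.

(** If the two sets of variables coincide, each variable occurs squared; otherwise some variable
    occurs exactly once and the mean vanishes. *)
Lemma Ex_monomial2 s s' : uniq s -> uniq s' ->
  integ P (fun w => (\prod_(p <- s) Y p w) * (\prod_(p <- s') Y p w)) /\
  Ex P (fun w => (\prod_(p <- s) Y p w) * (\prod_(p <- s') Y p w)) =
  if perm_eq s s' then v ^+ size s else 0.
Proof.
move=> us us'; pose S := undup (s ++ s'); pose a p := (count_mem p (s ++ s')).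
have uS : uniq S by exact: undup_uniq.
have e w : (\prod_(p <- s) Y p w) * (\prod_(p <- s') Y p w) = \prod_(p <- S) Y p w ^+ a p.
  by rewrite -big_cat -big_undup_iterop_count /=; apply: eq_bigr => p _; rewrite /a; case: count => //= k; elim: k => //= k IHk; rewrite exprS IHk.
have [h1 h2] := mean_monomial (good_meas Yg) (good_indep Yg) (good_mom Yg) a uS.
under eq_fun do rewrite e; split=> //; rewrite h2.
have cE p : a p = ((p \in s) + (p \in s'))%N by rewrite /a count_cat !count_uniq_mem.
case: ifPn => ss'.
  have eS : perm_eq S s.
    apply: uniq_perm => // p; rewrite mem_undup mem_cat (perm_mem ss') orbb//.
  rewrite (perm_big _ eS) /= (eq_big_seq (fun=> v)) => [|p ps].
    by rewrite big_const_seq count_predT iter_mulr_1.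
  by rewrite cE -(perm_mem ss') ps; exact: (good_var Yg).
have /allPn[p pS pn] : ~~ all (fun p => (p \in s) == (p \in s')) S.
  apply: contra ss' => /allP h; apply: uniq_perm => // p.
  have [pS|] := boolP (p \in S); first exact/eqP/h.
  by rewrite mem_undup mem_cat negb_or => /andP[/negbTE-> /negbTE->].
have ap : a p = 1%N by move: pn; rewrite cE; do 2 case: (_ \in _).
by rewrite (bigD1_seq p)//= ap (good_odd Yg)// mul0r.
Qed.

Lemma Ex_chaos_sq g : Ex P (at_Y Y (fun y => chaos M U g y ^+ 2)) =
  \sum_(t <- U) \sum_(t' <- U | perm_eq (M t) (M t')) g t * g t' * v ^+ size (M t).
Proof.
pose F t t' w := (\prod_(p <- M t) Y p w) * (\prod_(p <- M t') Y p w).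
have iF t t' : t \in U -> t' \in U -> integ P (F t t').
  by move=> tU t'U; case: (Ex_monomial2 (uM tU) (uM t'U)).
pose G t t' w := if (t \in U) && (t' \in U) then g t * g t' * F t t' w else 0.
have iG t t' : integ P (G t t').
  rewrite /G; case: andP => [[tU t'U]|_]; last exact: integ0.
  exact: integZ (iF _ _ tU t'U).
have -> : at_Y Y (fun y => chaos M U g y ^+ 2) = fun w => \sum_(t <- U) \sum_(t' <- U) G t t' w.
  apply/funext => w; rewrite /at_Y /chaos expr2 mulr_suml; apply: eq_big_seq => t tU.
  rewrite mulr_sumr; apply: eq_big_seq => t' t'U; rewrite /G tU t'U /F; ring.
rewrite Ex_sum => [|t]; last exact: integ_sum.
apply: eq_big_seq => t tU; rewrite Ex_sum// [RHS]big_mkcond.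
apply: eq_big_seq => t' t'U; rewrite /G tU t'U /= ExZ; last exact: iF.
by rewrite /F (Ex_monomial2 (uM tU) (uM t'U)).2; case: ifP; rewrite ?mulr0.
Qed.
End OneFamily.

(** On the coupled side the monomials of all rearrangements of [t] coincide; on the decoupled side they
    are orthogonal.  If [g] is constant on the [K] rearrangements that occur, their contributions are
    [(K g)^2] and [K (a g)^2], which agree for [K = a^2]. *)
Lemma second_moments_agree (U : seq (seq nat)) (m : nat) (r v : R) (a : nat -> R) (g : seq nat -> R)
    d (T : measurableType d) (P : probability T R) (Y : nat -> T -> R)
    d' (T' : measurableType d') (P' : probability T' R) (Y' : nat * nat -> T' -> R) :
  uniq U -> {in U, forall t, uniq t} ->
  {in U, forall t, (count (fun t' => sort leq t' == sort leq t) U)%:R = a (size t) ^+ 2} ->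
  {in U &, forall t t', sort leq t = sort leq t' -> g t = g t'} ->
  good_variables m r v P Y -> good_variables m r v P' Y' ->
  Ex P (at_Y Y (fun y => chaos id U g y ^+ 2)) =
  Ex P' (at_Y Y' (fun y => chaos cells U (fun t => a (size t) * g t) y ^+ 2)).
Proof.
move=> uU uM cU gU Yg Yg'.
have uC t : t \in U -> uniq (cells t) by move=> _; exact: uniq_cells.
rewrite (Ex_chaos_sq uM Yg) (Ex_chaos_sq uC Yg').
apply: eq_big_seq => t tU.
transitivity (\sum_(t' <- U | sort leq t' == sort leq t) g t ^+ 2 * v ^+ size t).
  rewrite [LHS]big_seq_cond [RHS]big_seq_cond; apply: eq_big => [t'|t'].
    congr (_ && _); rewrite eq_sym; apply/idP/eqP => /=.
      by move/perm_sortP; apply; [exact: leq_total|exact: leq_trans|exact: anti_leq].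
    by move=> e; apply/perm_sortP; [exact: leq_total|exact: leq_trans|exact: anti_leq|].
  move=> /andP[t'U /= h]; rewrite expr2 (gU _ _ t'U tU)//.
  by apply/perm_sortP; [exact: leq_total|exact: leq_trans|exact: anti_leq|rewrite perm_sym].
rewrite big_const_seq iter_addr addr0 -mulr_natl cU//.
rewrite (eq_bigl (fun t' => t == t')) => [|t']; last exact: perm_cells.
rewrite -big_filter (_ : [seq t' <- U | t == t'] = [:: t]); last first.
  rewrite (eq_filter (a2 := pred1 t)) => [|t']; last by rewrite /= eq_sym.
  exact: filter_pred1_uniq.
by rewrite big_seq1 size_cells; ring.
Qed.

End ChaosPolynomials.

(** * Comparison of lattice-valued chaoses *)

Section VectorComparison.
Context {R : realType} {E : banachLatticeType R}.
Variable N : E -> R.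
Hypothesis eqN : equivalent_norm N.

(** Pass to [L^q], take the norm inside the lattice by concavity, compare there by monotonicity of the
    calculus, and come back through [L^p] by convexity.  Convexity for one-element families also says
    that [N] is monotone. *)
Lemma vector_comparison (p q r : R) d (T : measurableType d) (P : probability T R)
    d' (T' : measurableType d') (P' : probability T' R)
    n (f : 'I_n -> E) (A : 'I_n -> T -> R) (A' : 'I_n -> T' -> R) :
  1 <= p -> p <= r -> r <= q ->
  (forall s w, ble (babs w) (lps p s) -> N w `^ p <= \sum_(x <- s) N x `^ p) ->
  (forall s w, ble (lps q s) (babs w) -> \sum_(x <- s) N x `^ q <= N w `^ q) ->
  (forall i, fin P q (A i)) -> (forall i, fin P' p (A' i)) ->
  (forall x : 'rV[R]_n, scal P A q x <= scal P' A' p x) ->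
  (LN P r (fun w => N (comb f A w)) <= LN P' r (fun w => N (comb f A' w)))%E.
Proof.
move=> p1 pr rq convN concN fA fA' h.
have p0 : 0 < p by exact: lt_le_trans p1.
have r1 : 1 <= r by exact: le_trans pr.
have r0 : 0 < r by exact: lt_le_trans r1.
have q1 : 1 <= q by exact: le_trans rq.
case: eqN => ND NZ _ [[al be] /= [al0 be0] Nb].
have Nlb x : al * `|x| <= N x by case/andP: (Nb x).
have Nub x : N x <= be * `|x| by case/andP: (Nb x).
have N0 x : 0 <= N x by apply: le_trans (Nlb x); rewrite mulr_ge0// ltW.
have mA : measurable_fun setT (fun w => N (comb f A w)).
  by apply: (measurable_comb be0 ND Nub) => i; case: (fA i).
have mA' : measurable_fun setT (fun w => N (comb f A' w)).
  by apply: (measurable_comb be0 ND Nub) => i; case: (fA' i).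
apply: (le_trans (LN_exponent_le P r0 rq mA)).
apply: (le_trans _ (LN_exponent_le P' p0 pr mA')).
apply: le_trans (concave_transfer al0 be0 ND NZ Nlb Nub f q1 fA concN) _.
apply: (le_trans _ (convex_transfer al0 be0 ND NZ Nlb Nub f p1 fA' convN)).
rewrite lee_fin.
set g := scal P A q; set g' := scal P' A' p.
have gp : pos_homogeneous g by exact: (scal_poshom f q1 fA).
have gp' : pos_homogeneous g' by exact: (scal_poshom f p1 fA').
apply: (le_powR_inv p0 (N0 _)).
(* monotonicity of [N] is convexity for a one-element family *)
have := convN [:: kc f g'] (kc f g); rewrite big_seq1; apply.
rewrite lps1// -(krivine_abs (krivine_kc f))// -(krivine_abs (krivine_kc f))//.
apply: (krivine_le (krivine_kc f)); try exact: pos_homogeneous_abs.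
by move=> x; rewrite ger0_norm ?nq_ge0// ger0_norm ?nq_ge0.
Qed.

End VectorComparison.

Section ChaosComparison.
Context {R : realType} {E : banachLatticeType R}.
Variable N : E -> R.
Hypothesis eqN : equivalent_norm N.
Variables (m : nat) (r rho v : R).
Hypothesis m0 : (0 < m)%N.
Hypothesis rho01 : 0 < rho <= 1.
Hypothesis v0 : 0 <= v.
Hypothesis pr : pexp R m <= r.
Hypothesis rq : r <= qexp R m.
Hypothesis convN : forall s w, ble (babs w) (lps (pexp R m) s) ->
  N w `^ (pexp R m) <= \sum_(x <- s) N x `^ (pexp R m).
Hypothesis concN : forall s w, ble (lps (qexp R m) s) (babs w) ->
  \sum_(x <- s) N x `^ (qexp R m) <= N w `^ (qexp R m).
Context d (T : measurableType d) (P : probability T R) (Y : nat -> T -> R).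
Context d' (T' : measurableType d') (P' : probability T' R) (Y' : nat * nat -> T' -> R).
Hypothesis Yg : good_variables m rho v P Y.
Hypothesis Yg' : good_variables m rho v P' Y'.
Variables (U : seq (seq nat)) (a : nat -> R).
Hypothesis uU : uniq U.
Hypothesis uM : {in U, forall t, uniq t}.
Hypothesis cU : {in U, forall t, (count (fun t' => sort leq t' == sort leq t) U)%:R = a (size t) ^+ 2}.
Variables (n : nat) (f : 'I_n -> E) (s_ : 'I_n -> seq nat).

Let sel i t : R := (sort leq t == s_ i)%:R.
Let coefs (x : 'rV[R]_n) t := \sum_i sel i t * x ord0 i.

Let uC : {in U, forall t, uniq (cells t)}. Proof. by move=> t _; exact: uniq_cells. Qed.

Let rho0 : 0 < rho. Proof. by case/andP: rho01. Qed.
Let rho1 : rho <= 1. Proof. by case/andP: rho01. Qed.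

(** The coefficient of the vector [f i] collects all tuples whose increasing rearrangement is [s_ i],
    with a factor [b k] in degree [k]. *)
Definition coupled_coef (b : nat -> R) i : T -> R :=
  at_Y Y (chaos id U (fun t => sel i t * b (size t))).

Definition decoupled_coef (b : nat -> R) i : T' -> R :=
  at_Y Y' (chaos cells U (fun t => sel i t * (b (size t) * a (size t)))).

Lemma coupled_coef_sum b (x : 'rV[R]_n) : (fun w => \sum_i coupled_coef b i w * x ord0 i) =
  at_Y Y (chaos id U (fun t => b (size t) * coefs x t)).
Proof.
apply/funext => w; rewrite /coupled_coef /at_Y /chaos.
under eq_bigr do rewrite mulr_suml; rewrite exchange_big; apply: eq_bigr => t _.
rewrite /coefs mulr_sumr mulr_suml; apply: eq_bigr => i _; ring.
Qed.

Lemma decoupled_coef_sum b (x : 'rV[R]_n) : (fun w => \sum_i decoupled_coef b i w * x ord0 i) =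
  at_Y Y' (chaos cells U (fun t => a (size t) * (b (size t) * coefs x t))).
Proof.
apply/funext => w; rewrite /decoupled_coef /at_Y /chaos.
under eq_bigr do rewrite mulr_suml; rewrite exchange_big; apply: eq_bigr => t _.
rewrite /coefs !mulr_sumr mulr_suml; apply: eq_bigr => i _; ring.
Qed.

Let pq : pexp R m <= qexp R m. Proof. exact: le_trans rq. Qed.

Lemma fin_coupled q b i : 0 < q -> q <= qexp R m -> fin P q (coupled_coef b i).
Proof.
move=> q0 qq; apply: (pol_fin m0 Yg (uniq_letters id U) _ q0 qq).
by apply: multiaffine_pol (uniq_letters _ _) _; exact: multiaffine_chaos.
Qed.

Lemma fin_decoupled q b i : 0 < q -> q <= qexp R m -> fin P' q (decoupled_coef b i).
Proof.
move=> q0 qq; apply: (pol_fin m0 Yg' (uniq_letters cells U) _ q0 qq).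
by apply: multiaffine_pol (uniq_letters _ _) _; exact: multiaffine_chaos.
Qed.

Lemma coefs_sort x : {in U &, forall t t', sort leq t = sort leq t' -> coefs x t = coefs x t'}.
Proof. by move=> t t' _ _ e; rewrite /coefs /sel e. Qed.

(** The coefficient functions depend on the increasing rearrangement only, for every real vector [x]:
    this is why the vectors are indexed by increasing tuples. *)
Lemma moments_agree (b : nat -> R) x :
  Ex P (at_Y Y (fun y => dilate rho (chaos id U (fun t => b (size t) * coefs x t)) y ^+ 2)) =
  Ex P' (at_Y Y' (fun y => dilate rho (chaos cells U
     (fun t => a (size t) * (b (size t) * coefs x t))) y ^+ 2)).
Proof.
rewrite !dilate_chaos.
rewrite (second_moments_agree uU uM cU _ Yg Yg') => [|t t' tU t'U e]; last first.
  by rewrite (coefs_sort x tU t'U e) -(size_sort leq t) e size_sort.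
congr Ex; congr at_Y; apply/funext => y; congr (_ ^+ 2); congr chaos.
by apply/funext => t; rewrite size_cells mulrCA.
Qed.

Lemma coupled_le_decoupled (b : nat -> R) :
  (LN P r (fun w => N (comb f (coupled_coef (fun k => rho ^+ k ^+ 2 * b k)%R) w)) <=
   LN P' r (fun w => N (comb f (decoupled_coef b) w)))%E.
Proof.
apply: (vector_comparison eqN _ (pexp1 R m0) pr rq convN concN).
- by move=> i; apply: fin_coupled => //; exact: qexp0.
- by move=> i; apply: fin_decoupled => //; exact: pexp0.
move=> x; rewrite /scal coupled_coef_sum decoupled_coef_sum.
have := compare_nq m0 rho0 rho1 v0 Yg Yg' (uniq_letters id U) (multiaffine_chaos uM _)
  (uniq_letters cells U) (multiaffine_chaos uC _) (moments_agree b x).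
rewrite !dilate_chaos => h; apply: le_trans h; rewrite le_eqVlt; apply/orP; left; apply/eqP.
by congr nq; congr at_Y; congr chaos; apply/funext => t; rewrite expr2 !mulrA.
Qed.

Lemma decoupled_le_coupled (b : nat -> R) :
  (LN P' r (fun w => N (comb f (decoupled_coef (fun k => rho ^+ k ^+ 2 * b k)%R) w)) <=
   LN P r (fun w => N (comb f (coupled_coef b) w)))%E.
Proof.
apply: (vector_comparison eqN _ (pexp1 R m0) pr rq convN concN).
- by move=> i; apply: fin_decoupled => //; exact: qexp0.
- by move=> i; apply: fin_coupled => //; exact: pexp0.
move=> x; rewrite /scal coupled_coef_sum decoupled_coef_sum.
have := compare_nq m0 rho0 rho1 v0 Yg' Yg (uniq_letters cells U) (multiaffine_chaos uC _)
  (uniq_letters id U) (multiaffine_chaos uM _) (esym (moments_agree b x)).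
rewrite !dilate_chaos => h; apply: le_trans h; rewrite le_eqVlt; apply/orP; left; apply/eqP.
congr nq; congr at_Y; congr chaos; apply/funext => t; rewrite size_cells; ring.
Qed.

End ChaosComparison.

(** * Expansion of the chaos sums *)

Section Expansion.
Context {R : realType} {E : normedModType R}.
Implicit Type f : forall k, k.-tuple nat -> E.

(** Lists instead of tuples of each length, so that all degrees are summed over one list of lists. *)
Definition value f (t : seq nat) : E := f (size t) (in_tuple t).

Lemma value_tuple f k (t : k.-tuple nat) : value f t = f k t.
Proof.
rewrite /value; case: t => s hs /=; have e := eqP hs; subst k.
by congr f; apply: val_inj.
Qed.

Lemma support_list f : finitely_supported f ->
  exists U : seq (seq nat), forall t, value f t != 0 -> t \in U.
Proof.
move=> [fk fK]; have : finite_set (\bigcup_(k in [set k | exists i, f k i != 0])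
    ((fun t : k.-tuple nat => (t : seq nat)) @` [set i | f k i != 0])).
  by apply: bigcup_finite => // k _; apply: finite_image; exact: fk.
move=> /finite_seqP[U UE]; exists U => t vt.
have : [set` U] t; last by [].
by rewrite -UE; exists (size t); [exists (in_tuple t)|exists (in_tuple t)].
Qed.

Section Sums.
Variable f : forall k, k.-tuple nat -> E.
Variable U : seq (seq nat).
Hypothesis uU : uniq U.
Hypothesis supp : forall t, value f t != 0 -> t \in U.

Lemma fsum_tuples k (F : seq nat -> R) :
  \sum_(i \in [set: k.-tuple nat]) F i *: f i =
  \sum_(t <- U | size t == k) F t *: value f t.
Proof.
pose V : seq (k.-tuple nat) := pmap insub U.
rewrite (fsbigE V)//=; last 2 first.
- exact: pmap_sub_uniq.
- move=> i _; rewrite mem_pmap_sub => iU; have [->|fi] := eqVneq (f i) 0; first by rewrite scaler0.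
  by move: iU; rewrite supp// value_tuple.
rewrite (eq_bigl xpredT) => [|i]; last by rewrite in_setT.
rewrite big_pmap [RHS]big_mkcond; apply: eq_bigr => t _.
case: insubP => [u ut <-|/negbTE ut] /=; last by rewrite ut.
by rewrite size_tuple eqxx value_tuple.
Qed.

Lemma coupled_sum k (x : nat -> R) : coupled (@f k) x =
  \sum_(t <- U | size t == k) (\prod_(j <- t) x j) *: value f t.
Proof.
rewrite -(fsum_tuples k (fun t => \prod_(j <- t) x j)); apply: eq_fsbigr => i _.
by rewrite big_tuple.
Qed.

Lemma decoupled_sum k (x : nat -> nat -> R) : decoupled (@f k) x =
  \sum_(t <- U | size t == k) (\prod_(p <- cells t) x p.1 p.2) *: value f t.
Proof.
rewrite -(fsum_tuples k (fun t => \prod_(p <- cells t) x p.1 p.2)); apply: eq_fsbigr => i _.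
rewrite (big_nth (0, 0)%N) size_cells size_tuple big_mkord; congr (_ *: _).
by apply: eq_bigr => l _; rewrite nth_cells ?size_tuple//= (tnth_nth 0%N).
Qed.

Lemma fsum_degrees (b : nat -> R) (H : seq nat -> E) :
  \sum_(k \in [set: nat]) b k *: (\sum_(t <- U | size t == k) H t) =
  \sum_(t <- U) b (size t) *: H t.
Proof.
rewrite (fsbigE (undup (map size U)))//=; last 2 first.
- exact: undup_uniq.
- move=> k _; rewrite mem_undup => kU.
  rewrite big_seq_cond big1 ?scaler0// => t /andP[tU /eqP tk].
  by move: kU; rewrite -tk map_f.
rewrite (eq_bigl xpredT) => [|i]; last by rewrite in_setT.
under eq_bigr do rewrite scaler_sumr big_mkcond.
rewrite exchange_big; apply: eq_big_seq => t tU.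
rewrite (bigD1_seq (size t)) ?undup_uniq ?mem_undup ?map_f//= eqxx big1 ?addr0// => k.
by rewrite eq_sym => /negbTE ->.
Qed.

(** Index tuples with the same increasing rearrangement have the same value, so their monomials can be
    collected. *)
Lemma comb_chaos (I : eqType) (M : seq nat -> seq I) (b : nat -> R) (y : I -> R) :
  {in U, forall t, value f t = value f (sort leq t)} ->
  let S := undup (map (sort leq) U) in
  \sum_(i < size S) chaos M U (fun t => (sort leq t == nth [::] S i)%:R * b (size t)) y *:
     value f (nth [::] S i) =
  \sum_(t <- U) (b (size t) * \prod_(p <- M t) y p) *: value f t.
Proof.
move=> sortU S; pose F s := chaos M U (fun t => (sort leq t == s)%:R * b (size t)) y *: value f s.
transitivity (\sum_(s <- S) F s); first by rewrite (big_nth [::]) big_mkord.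
rewrite /F /chaos; under eq_bigr do rewrite scaler_suml.
rewrite exchange_big; apply: eq_big_seq => t tU; rewrite sortU//.
rewrite (bigD1_seq (sort leq t)) ?undup_uniq ?mem_undup ?map_f//= eqxx mul1r.
rewrite [X in _ + X]big1 ?addr0// => s; rewrite eq_sym => /negbTE ->.
by rewrite !mul0r scale0r.
Qed.

End Sums.
End Expansion.

Section ExponentChoice.
Context {R : realType}.

(** The conjugate of [2 m] tends to one as [m] grows. *)
Lemma exponent_choice (p r q : R) : 1 < p -> 1 < r ->
  exists2 m : nat, (0 < m)%N & [/\ pexp R m <= p, pexp R m <= r, q <= qexp R m & r <= qexp R m].
Proof.
move=> p1 r1.
(* [2 m / (2 m - 1) <= t] as soon as [m >= t / (t - 1)] *)
pose B := `|q| + `|r| + p / (p - 1) + r / (r - 1) + 1.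
have pp : 0 < p / (p - 1) by rewrite divr_gt0 ?subr_gt0//; lra.
have rr : 0 < r / (r - 1) by rewrite divr_gt0 ?subr_gt0//; lra.
have q0 := normr_ge0 q; have r0 := normr_ge0 r.
have B0 : 0 <= B by rewrite /B; lra.
have hB := archi_boundP B0; set m := Num.bound B in hB.
have qm : qexp R m = m%:R + m%:R by rewrite /qexp -addnn natrD.
have m1 : 1 < (m%:R : R) by apply: le_lt_trans hB; rewrite /B; lra.
have pe t : 1 < t -> t / (t - 1) <= m%:R -> pexp R m <= t.
  move=> t1; rewrite ler_pdivrMr ?subr_gt0// => ht.
  rewrite /pexp ler_pdivrMr ?qm; last by lra.
  by nra.
have ql := ler_norm q; have rl := ler_norm r.
exists m; first by rewrite -(ltr0n R); lra.
split.
- apply: pe => //; apply: le_trans (ltW hB); rewrite /B; lra.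
- apply: pe => //; apply: le_trans (ltW hB); rewrite /B; lra.
- rewrite qm; have := hB; rewrite /B; lra.
- rewrite qm; have := hB; rewrite /B; lra.
Qed.

End ExponentChoice.

(** * Symmetric and tetrahedral families *)

Section IndexSets.
Context {R : realType} {E : normedModType R}.
Variable f : forall k, k.-tuple nat -> E.
Hypothesis fin_f : finitely_supported f.

Lemma value_perm t t' : symmetric_family f -> perm_eq t t' -> value f t = value f t'.
Proof.
move=> symf tt'; have e := perm_size tt'.
have st : size t == size t' by rewrite e.
have [s ts] := tuple_permP (s := Tuple st) (t := in_tuple t') tt'.
transitivity (f [tuple tnth (in_tuple t') (s l) | l < size t']); last exact: symf.
by rewrite -(value_tuple f) -ts.
Qed.

(** The support is closed under rearrangement, and a tuple of distinct indices has [k!] of them. *)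
Lemma symmetric_indices : vanishes_on_diagonals f -> symmetric_family f ->
  exists U : seq (seq nat), [/\ uniq U, forall t, value f t != 0 -> t \in U,
    {in U, forall t, uniq t},
    {in U, forall t, (count (fun t' => sort leq t' == sort leq t) U)%:R = Num.sqrt (size t)`!%:R ^+ 2 :> R} &
    {in U, forall t, value f t = value f (sort leq t)}].
Proof.
move=> vf symf; have [U0 hU0] := support_list fin_f.
pose U := undup (flatten [seq permutations s | s <- U0 & uniq s]).
have memU t : reflect (exists s, [/\ s \in U0, uniq s & perm_eq t s]) (t \in U).
  rewrite mem_undup; apply: (iffP flattenP) => [[x /mapP[s]]|[s [sU us ts]]].
    by rewrite mem_filter => /andP[us sU] ->; rewrite mem_permutations => ts; exists s.
  by exists (permutations s); [apply: map_f; rewrite mem_filter us|rewrite mem_permutations].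
exists U; split.
- exact: undup_uniq.
- move=> t vt; apply/memU; exists t; split=> //; first exact: hU0.
  by apply: contraR vt => nt; apply/eqP; exact: vf.
- by move=> t /memU[s [_ us ts]]; rewrite (perm_uniq ts).
- move=> t /memU[s [sU us ts]].
  rewrite sqr_sqrtr// -size_permutations ?(perm_uniq ts)//; congr (_%:R).
  rewrite -size_filter; apply: perm_size; apply: uniq_perm.
  + by rewrite filter_uniq// undup_uniq.
  + exact: permutations_uniq.
  move=> t'; rewrite mem_filter mem_permutations.
  have -> : (sort leq t' == sort leq t) = perm_eq t' t.
    apply/eqP/idP => [e|]; last by move/perm_sortP; apply; [exact: leq_total|exact: leq_trans|exact: anti_leq].
    by apply/perm_sortP; [exact: leq_total|exact: leq_trans|exact: anti_leq|].
  have [t't|//] := boolP (perm_eq t' t); apply/memU; exists s; split=> //.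
  exact: perm_trans ts.
- by move=> t _; apply: value_perm => //; rewrite perm_sym perm_sort.
Qed.

(** Increasing tuples are their own and only rearrangement. *)
Lemma tetrahedral_indices : tetrahedral f ->
  exists U : seq (seq nat), [/\ uniq U, forall t, value f t != 0 -> t \in U,
    {in U, forall t, uniq t},
    {in U, forall t, (count (fun t' => sort leq t' == sort leq t) U)%:R = 1 ^+ 2 :> R} &
    {in U, forall t, value f t = value f (sort leq t)}].
Proof.
move=> tf; have [U0 hU0] := support_list fin_f.
pose U := undup [seq t <- U0 | sorted ltn t].
have sU t : t \in U -> sorted ltn t by rewrite mem_undup mem_filter => /andP[].
have sE t : t \in U -> sort leq t = t.
  by move=> /sU; rewrite ltn_sorted_uniq_leq => /andP[_]; exact: (sorted_sort leq_trans).
exists U; split.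
- exact: undup_uniq.
- move=> t vt; rewrite mem_undup mem_filter hU0// andbT.
  by apply: contraR vt => nt; apply/eqP; exact: tf.
- by move=> t /sU; rewrite ltn_sorted_uniq_leq => /andP[].
- move=> t tU; rewrite expr1n (eq_in_count (a2 := pred1 t)) => [|t' t'U].
    by rewrite count_uniq_mem ?undup_uniq// tU.
  by rewrite /= !sE.
- by move=> t tU; rewrite sE.
Qed.

End IndexSets.

(** The constant is [rho^-2]: degree [k] is dilated twice by [rho^k] in the comparison of norms. *)
Lemma decoupling_of_indices (R : realType) (E : banachLatticeType R) (N : E -> R)
    (m : nat) (r rho v : R) (a : nat -> R)
    d (Omega : measurableType d) (P : probability Omega R) (X : nat -> {RV P >-> R})
    d' (Omega' : measurableType d') (P' : probability Omega' R) (XX : nat -> nat -> {RV P' >-> R})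
    (f : forall k, k.-tuple nat -> E) (U : seq (seq nat)) :
  equivalent_norm N -> (0 < m)%N -> 0 < rho <= 1 -> 0 <= v ->
  pexp R m <= r -> r <= qexp R m ->
  (forall s w, ble (babs w) (lps (pexp R m) s) ->
    N w `^ (pexp R m) <= \sum_(x <- s) N x `^ (pexp R m)) ->
  (forall s w, ble (lps (qexp R m) s) (babs w) ->
    \sum_(x <- s) N x `^ (qexp R m) <= N w `^ (qexp R m)) ->
  good_variables m rho v P (fun j w => X j w) ->
  good_variables m rho v P' (fun (ij : nat * nat) w => XX ij.1 ij.2 w) ->
  uniq U -> (forall t, value f t != 0 -> t \in U) -> {in U, forall t, uniq t} ->
  {in U, forall t, (count (fun t' => sort leq t' == sort leq t) U)%:R = a (size t) ^+ 2} ->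
  {in U, forall t, value f t = value f (sort leq t)} ->
  decoupling_inequalities N r (rho ^+ 2)^-1 P X P' XX a f.
Proof.
move=> eqN m0 rho01 v0 pr rq convN concN Yg Yg' uU supp uM cU sortU.
have rho0 : 0 < rho by case/andP: rho01.
pose S := undup (map (sort leq) U); pose n := size S.
pose g (i : 'I_n) := value f (nth [::] S i); pose s_ (i : 'I_n) := nth [::] S i.
pose Y := fun j w => X j w; pose Y' := fun (ij : nat * nat) w => XX ij.1 ij.2 w.
pose C b := coupled_coef Y U s_ b; pose D b := decoupled_coef Y' U a s_ b.
have coupledE (b : nat -> R) w :
    \sum_(k \in [set: nat]) b k *: coupled (@f k) (fun j => X j w) = comb g (C b) w.
  under eq_fsbigr do rewrite (coupled_sum uU supp).
  rewrite (fsum_degrees U b (fun t => (\prod_(j <- t) X j w) *: value f t)).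
  under eq_bigr do rewrite scalerA.
  exact/esym/(comb_chaos id b (fun j => X j w) sortU).
have decoupledE w :
    \sum_(k \in [set: nat]) a k *: decoupled (@f k) (fun i j => XX i j w) = comb g (D (fun=> 1)) w.
  under eq_fsbigr do rewrite (decoupled_sum uU supp).
  rewrite (fsum_degrees U a (fun t => (\prod_(p <- cells t) XX p.1 p.2 w) *: value f t)).
  under eq_bigr do rewrite scalerA.
  apply/esym; apply: etrans (comb_chaos cells (fun k => 1 * a k) (fun p => XX p.1 p.2 w) sortU) _.
  by apply: eq_bigr => t _; rewrite mul1r.
have LrEE d1 (T1 : measurableType d1) (P1 : probability T1 R) (Z1 Z2 : T1 -> E) :
  Z1 = Z2 -> LrE N r P1 Z1 = LN P1 r (fun w => N (Z2 w)) by move=> ->.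
have cE : (fun k => (rho ^+ 2)^-1 ^- k) = (fun k => rho ^+ k ^+ 2 * 1).
  by apply/funext => k; rewrite exprVn invrK mulr1 exprAC.
have cE' : (fun k => rho ^+ k ^+ 2 * (rho ^+ 2)^-1 ^+ k) = fun=> 1.
  by apply/funext => k; rewrite exprVn exprAC divff// expf_neq0// expf_neq0// gt_eqF.
split.
- rewrite (LrEE _ _ _ _ _ (funext (coupledE _))) (LrEE _ _ _ _ _ (funext decoupledE)) cE.
  exact: (coupled_le_decoupled eqN m0 rho01 v0 pr rq convN concN Yg Yg' uU uM cU).
- rewrite (LrEE _ _ _ _ _ (funext (coupledE _))) (LrEE _ _ _ _ _ (funext decoupledE)) -cE'.
  exact: (decoupled_le_coupled eqN m0 rho01 v0 pr rq convN concN Yg Yg' uU uM cU).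
Qed.

Theorem theorem3p13 (R : realType) (E : banachLatticeType R) (p q : R)
    (hp : 1 < p) (hq : 0 < q)
    (hpE : krivine_type_ge E p) (hqE : krivine_type_le E q) :
  exists2 N : E -> R, equivalent_norm N &
  forall r : R, 1 < r ->
  exists2 c : R, 0 < c &
  forall (d : measure_display) (Omega : measurableType d)
    (P : probability Omega R) (X : nat -> {RV P >-> R})
    (d' : measure_display) (Omega' : measurableType d')
    (P' : probability Omega' R) (XX : nat -> nat -> {RV P' >-> R}),
  rademacher_sequence P X \/ gaussian_sequence P X ->
  independent_copies P X P' XX ->
  forall f : forall k, k.-tuple nat -> E,
  finitely_supported f -> vanishes_on_diagonals f ->
  (symmetric_family f ->
     decoupling_inequalities N r c P X P' XX (fun k => Num.sqrt (k`!)%:R) f) /\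
  (tetrahedral f ->
     decoupling_inequalities N r c P X P' XX (fun=> 1) f).
Proof.
have [N eqN [q1 q10 [convN concN]]] := convex_concave_renorming hp hq hpE hqE.
exists N => // r r1.
have [m m0 [mp mr mq1 mrq]] := exponent_choice q1 hp r1.
have [rho rho01 good] := @good_parameters R m m0.
have rho0 : 0 < rho by case/andP: rho01.
exists (rho ^+ 2)^-1; first by rewrite invr_gt0 exprn_gt0.
move=> d Omega P X d' Omega' P' XX hX hXX f ff vf.
have [Xind [rad lawX]] := sequence_law hX.
have [v v0 goodv] := good rad.
have Yg : good_variables m rho v P (fun j w => X j w) by exact: goodv.
have Yg' : good_variables m rho v P' (fun (ij : nat * nat) w => XX ij.1 ij.2 w).
  by apply: goodv => //; [exact: copies_indep Xind hXX|exact: copies_law hXX lawX].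
have convNm := convN _ (pexp0 R m0) mp.
have concNm := concN _ mq1.
split=> [sf|tf].
- have [U [uU supp uM cU sortU]] := @symmetric_indices R E f ff vf sf.
  exact: (decoupling_of_indices eqN m0 rho01 v0 mr mrq convNm concNm Yg Yg' uU supp uM cU sortU).
- have [U [uU supp uM cU sortU]] := @tetrahedral_indices R E f ff tf.
  exact: (decoupling_of_indices (a := fun=> 1) eqN m0 rho01 v0 mr mrq convNm concNm Yg Yg' uU supp uM cU sortU).
Qed.
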